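(* Let $d\in\mathbb N$, let $\Omega\subset\mathbb R^d$ be an open bounded Lipschitz domain and let $T>0$. Assume that: (1) $\rho\in C^1([0,T],L^\infty(\Omega))\cap C([0,T],H^1(\Omega))$ with $0<\underline\rho_0\le\rho(t,x)\le\underline\rho_1<\infty$ and $|\partial_t\rho(t,x)|\le\underline\rho_1'<\infty$; (2) $\eta\in C([0,T],L^\infty(\Omega))$ with $0<\underline\eta_0\le\eta(t,x)\le\underline\eta_1<\infty$; (3) $\kappa\in C^1([0,T],L^\infty(\Omega))$ with $0<\underline\kappa_0\le\kappa(t,x)\le\underline\kappa_1<\infty$ and $|\partial_t\kappa(t,x)|\le\underline\kappa_1'<\infty$; (4) $f:\mathbb R\to\mathbb R$ is Lipschitz continuous with constant $L_f$; (5) $\tilde u_0\in H^1_0(\Omega)$ and $\omega\in H^1_0(\Omega)$; (6) $p\in C([0,T],L^2(\Omega))$, and the function $\underline\omega(t):=\left(p(t),\frac{\omega}{\rho(t)}\right)$ satisfies $\underline\omega\in C([0,T])$ and $\underline\omega(t)\ne0$ for all $t\in[0,T]$; put $\underline\omega_m:=\min_{t\in[0,T]}|\underline\omega(t)|>0$; (7) $m\in H^1((0,T])$; (8) there is a positive constant $\zeta<1$ such that $$\|p\|_{\mathcal X}^2\,\frac{M^2\,\underline\eta_1^2}{4\,\underline\omega_m^2\,\underline\eta_0\,\underline\rho_0}<\zeta,\qquad M:=\sup_{t\in[0,T]}\left\|\nabla\left(\frac{\omega}{\rho(t)}\right)\right\|,\quad \mathcal X:=C([0,T],L^2(\Omega)).$$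 Let $\{u,h\}$ be the weak solution of the inverse problem, i.e. $u\in C([0,T],H_0^1(\Omega))$, $\partial_tu\in L^2((0,T),H^1_0(\Omega))$, $h\in L^2(0,T)$, $u(0,\cdot)=\tilde u_0$, $$(\partial_t(\rho(t)u(t)),\varphi)+(\eta(t)\nabla\partial_tu(t),\nabla\varphi)+(\kappa(t)\nabla u(t),\nabla\varphi)=h(t)(p(t),\varphi)+(f(u(t)),\varphi)$$ for a.a. $t\in(0,T)$ and all $\varphi\in H^1_0(\Omega)$, with $$h(t)=\frac1{\underline\omega(t)}\left[m'(t)+\left(u(t),\frac{\omega\,\partial_t\rho(t)}{\rho(t)}\right)+\left(\eta(t)\nabla\partial_tu(t),\nabla\left(\frac{\omega}{\rho(t)}\right)\right)+\left(\kappa(t)\nabla u(t),\nabla\left(\frac{\omega}{\rho(t)}\right)\right)-\left(f(u(t)),\frac{\omega}{\rho(t)}\right)\right].$$ Assume additionally that $\rho\in C^2([0,T],L^\infty(\Omega))$, $m\in C^2([0,T])$ and $u\in C^2([0,T],H^1_0(\Omega))$. Let $\tau=T/n$, $t_i=i\tau$, and let $(u_i,h_i)_{i=1}^n\subset H^1_0(\Omega)\times\mathbb R$ be the time-discrete solutions generated, starting from $u_0=\tilde u_0$, by $$(\delta(\rho_iu_i),\varphi)+(\eta_i\nabla\delta u_i,\nabla\varphi)+(\kappa_i\nabla u_i,\nabla\varphi)=h_i(p_i,\varphi)+(f(u_{i-1}),\varphi)\qquad\text{for all }\varphi\in H^1_0(\Omega),$$ $$h_i=\frac1{\underline\omega_i}\left[m'(t_i)+\left(u_{i-1},\frac{\omega\,\delta\rho_i}{\rho_i}\right)+\left(\eta_i\nabla\delta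 u_i,\nabla\left(\frac{\omega}{\rho_i}\right)\right)+\left(\kappa_i\nabla u_{i-1},\nabla\left(\frac{\omega}{\rho_i}\right)\right)-\left(f(u_{i-1}),\frac{\omega}{\rho_i}\right)\right].$$ Then there exist constants $C_u>0$ and $\tau_0>0$, independent of $\tau$, such that $$\max_{1\le i\le n}\|u(t_i)-u_i\|_{H^1(\Omega)}\le C_u\,\tau\qquad\text{for all }\tau\le\tau_0.$$ Moreover, there exists $C_h>0$, independent of $\tau$, such that $$\left(\sum_{i=1}^n|h(t_i)-h_i|^2\,\tau\right)^{1/2}\le C_h\,\tau\qquad\text{for all }\tau\le\tau_0.$$
   Context: $(\cdot,\cdot)$ is the $L^2(\Omega)$ inner product (for scalar or vector functions) and $\|\cdot\|$ the associated norm. The bounds $\underline\rho_0,\underline\rho_1,\underline\rho_1',\underline\eta_0,\underline\eta_1,\underline\kappa_0,\underline\kappa_1,\underline\kappa_1'$ are constants, and the pointwise bounds hold for all $t\in[0,T]$ and a.e. $x\in\Omega$. Condition (8) includes that $M<\infty$. The number of steps $n\in\mathbb N$ satisfies $\tau=T/n<1$. $\rho_i=\rho(t_i)$, $\eta_i=\eta(t_i)$, $\kappa_i=\kappa(t_i)$, $p_i=p(t_i)$, $\underline\omega_i=\underline\omega(t_i)$. Backward differences: $\delta z_i=(z_i-z_{i-1})/\tau$ and $\delta(\rho_iu_i)=(\rho_iu_i-\rho_{i-1}u_{i-1})/\tau$. The value $h(t_i)$ is given by the displayed formula for $h(t)$ at $t=t_i$ (meaningful under the additional regularity). Under assumptions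 (1)-(8) the couple $\{u,h\}$ and the discrete couples $(u_i,h_i)$ exist and are unique. *)

(* Defs.v *)
From HB Require Import structures.
From mathcomp Require Import all_boot all_order all_algebra.
From mathcomp Require Import all_classical all_reals all_analysis.
Set Implicit Arguments.
Unset Strict Implicit.
Unset Printing Implicit Defensive.
Import Order.TTheory GRing.Theory Num.Theory.
Import numFieldNormedType.Exports.
Local Open Scope classical_set_scope.
Local Open Scope ring_scope.

(* Borel sets and Lebesgue measure on R^n.  The library topologizes 'rV[R]_n
   but provides neither; the sigma-algebra is the product one (which is the
   Borel one) and the measure is the n-fold product of the Lebesgue measure. *)

Section borel_rV.
Variables (R : realType) (n : nat).

Let coord : 'I_n -> 'rV[R]_n -> measurableTypeR R := fun i x => x 0 i.

Let rV_set0 : g_sigma_preimage coord set0.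
Proof. exact: sigma_algebra0. Qed.

Let rV_setC A : g_sigma_preimage coord A -> g_sigma_preimage coord (~` A).
Proof. exact: sigma_algebraC. Qed.

Let rV_bigcup (F : (set 'rV[R]_n)^nat) :
  (forall i, g_sigma_preimage coord (F i)) ->
  g_sigma_preimage coord (\bigcup_i (F i)).
Proof. exact: sigma_algebra_bigcup. Qed.

Definition rV_display : measure_display.
Proof. exact: default_measure_display. Qed.

HB.instance Definition _ := @isMeasurable.Build rV_display
  'rV[R]_n (g_sigma_preimage coord) rV_set0 rV_setC rV_bigcup.

Lemma measurable_fun_rVP d (T : measurableType d) (f : T -> 'rV[R]_n) :
  (forall i, measurable_fun [set: T] (fun x => f x 0 i : measurableTypeR R)) ->
  measurable_fun [set: T] f.
Proof.
move=> mf _ Y mY; rewrite setTI.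
pose G : set_system 'rV[R]_n := [set B | measurable (f @^-1` B)].
suff: measurable `<=` G by exact.
apply: smallest_sub.
  split=> [|B GB|F GF]; rewrite /G/=.
  - by rewrite preimage_set0; exact: measurable0.
  - by rewrite setTD preimage_setC; exact: measurableC.
  - by rewrite preimage_bigcup; exact: bigcupT_measurable.
elim/big_ind: _ => [//|A B AG BG C [/AG|/BG]//|i _ B [C mC <-]].
by rewrite /G/= setTI; have := mf i measurableT C mC; rewrite setTI.
Qed.

Lemma measurable_coord (i : 'I_n) :
  measurable_fun setT (fun x : 'rV[R]_n => x 0 i : measurableTypeR R).
Proof.
move=> _ Y mY; rewrite setTI; apply: sub_sigma_algebra.
rewrite (bigD1 i)//=; left; exists Y => //; by rewrite setTI.
Qed.
End borel_rV.

Definition rV_cons (R : realType) n (x : measurableTypeR R * 'rV[R]_n) :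
    'rV[R]_n.+1 :=
  row_mx (x.1%:M) x.2.

Definition rV_split (R : realType) n (x : 'rV[R]_n.+1) :
    measurableTypeR R * 'rV[R]_n :=
  (x 0 0, \row_i x 0 (lift 0 i)).

Lemma rV_consK (R : realType) n : cancel (@rV_cons R n) (@rV_split R n).
Proof.
case=> a x; rewrite /rV_split /rV_cons/=; congr pair.
  have /= <- : lshift n (0 : 'I_1) = 0 by exact: val_inj.
  by apply: etrans (row_mxEl _ _ _ _) _; rewrite mxE.
apply/rowP => i; rewrite mxE.
have <- : rshift 1 i = lift 0 i by exact: val_inj.
exact: row_mxEr.
Qed.

Lemma measurable_rV_cons (R : realType) n : measurable_fun setT (@rV_cons R n).
Proof.
apply: measurable_fun_rVP => i; rewrite /rV_cons.
have [j ->|j ->] := split_ordP (i : 'I_(1 + n)).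
  rewrite (_ : (fun _ => _) = fst)//; apply/funext => x.
  by apply: etrans (row_mxEl _ _ _ _) _; rewrite (ord1 j) mxE.
rewrite (_ : (fun _ => _) = (fun y : 'rV[R]_n => y 0 j) \o snd); last first.
  by apply/funext => x; exact: row_mxEr.
exact: (measurableT_comp (measurable_coord j)).
Qed.

Lemma measurable_rV_split (R : realType) n :
  measurable_fun setT (@rV_split R n).
Proof.
apply/measurable_fun_pairP; split.
  exact: (measurable_coord 0).
apply: measurable_fun_rVP => i /=.
under eq_fun do rewrite mxE; exact: measurable_coord.
Qed.

Section lebesgue_rV.
Variable R : realType.

HB.instance Definition _ n := @isMeasurableFun.Build _ _ _ _
  (@rV_cons R n) (@measurable_rV_cons R n).

Section step.
Local Open Scope ereal_scope.
Variables (n : nat) (mu : {sigma_finite_measure set 'rV[R]_n -> \bar R}).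

Definition rV_prod : set 'rV[R]_n.+1 -> \bar R :=
  pushforward (@lebesgue_measure R \x mu) (@rV_cons R n).

Let rV_prod0 : rV_prod set0 = 0. Proof. exact: measure0. Qed.

Let rV_prod_ge0 A : 0 <= rV_prod A. Proof. exact: measure_ge0. Qed.

Let rV_prod_sigma_additive : semi_sigma_additive rV_prod.
Proof. exact: measure_semi_sigma_additive. Qed.

HB.instance Definition _ := isMeasure.Build _ _ _ rV_prod
  rV_prod0 rV_prod_ge0 rV_prod_sigma_additive.

Let rV_prod_sigma_finite : sigma_finite setT rV_prod.
Proof.
have /sigma_finiteP[F [TF ndF Foo]] := sigma_finiteT (@lebesgue_measure R).
have /sigma_finiteP[G [TG ndG Goo]] := sigma_finiteT mu.
exists (fun k => @rV_split R n @^-1` (F k `*` G k)).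
  rewrite -preimage_bigcup -[LHS](preimage_setT (@rV_split R n)).
  congr (_ @^-1` _); apply/esym; rewrite -subTset => -[x y] _.
  have [i _ Fix] : (\bigcup_i F i) x by rewrite -TF.
  have [j _ Gjy] : (\bigcup_i G i) y by rewrite -TG.
  exists (maxn i j) => //; split => /=.
    by move: x Fix; exact/subsetPset/ndF/leq_maxl.
  by move: y Gjy; exact/subsetPset/ndG/leq_maxr.
move=> k; have [mF Fk] := Foo k; have [mG Gk] := Goo k; split.
  rewrite -[X in measurable X]setTI; apply: measurable_rV_split => //.
  exact: measurableX.
rewrite /rV_prod /pushforward -comp_preimage.
rewrite (_ : _ \o _ = id); last by apply/funext => x; exact: rV_consK.
by rewrite preimage_id product_measure1E// lte_mul_pinfty// ge0_fin_numE.
Qed.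

HB.instance Definition _ := Measure_isSigmaFinite.Build _ _ _ rV_prod
  rV_prod_sigma_finite.

End step.

Fixpoint lebesgue_rV n : {sigma_finite_measure set 'rV[R]_n -> \bar R} :=
  match n with
  | 0 => \d_ (0 : 'rV[R]_0)
  | n.+1 => rV_prod (lebesgue_rV n)
  end.

End lebesgue_rV.

(* A space of functions is given by representatives: a set of vectors of an
   ambient module and a seminorm on it.  Two representatives denote the same
   element when the seminorm of their difference vanishes, see [eq_in]. *)
Record fspace (R : realType) (V : lmodType R) :=
  FSpace { fcarrier :> V -> Prop ; fnorm : V -> R }.

Definition eq_in (R : realType) (V : lmodType R) (X : fspace V) (u v : V) :=
  fnorm X (u - v) = 0.

Section smooth.
Variables (R : realType) (V : normedModType R).

Fixpoint Ck (k : nat) (phi : V -> R) : Prop :=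
  continuous phi /\
  match k with
  | 0 => True
  | k.+1 => forall v, (forall x, derivable phi x v) /\ Ck k ('D_v phi)
  end.

(* C_c^oo(Omega), by extension by zero *)
Definition test_function (Omega : set V) (phi : V -> R) :=
  (forall k, Ck k phi) /\
  exists K, [/\ compact K, K `<=` Omega & forall x, ~ K x -> phi x = 0].

End smooth.

Section domain.
Variables (R : realType) (d : nat).
Local Notation E := 'rV[R]_d.

(* Near each boundary point, in coordinates obtained from a rigid motion Q,
   Omega is the strict epigraph of a Lipschitz function of the d - 1
   coordinates other than the j-th one. *)
Definition lipschitz_boundary (Omega : set E) :=
  forall x0 : E, (closure Omega `\` interior Omega) x0 ->
  exists (r L : R) (Q : 'M[R]_d) (j : 'I_d) (gamma : 'rV[R]_d.-1 -> R),
    [/\ 0 < r, Q *m Q^T = 1%:M,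
        forall a b, `|gamma a - gamma b| <= L * `|a - b| &
        forall x, ball x0 r x ->
          Omega x <-> gamma (col' j (x *m Q)) < (x *m Q) 0 j].

Definition lipschitz_domain (Omega : set E) :=
  [/\ open Omega, connected Omega, bounded_set Omega &
      lipschitz_boundary Omega].

End domain.

Section sobolev.
Variables (R : realType) (d : nat) (Omega : set 'rV[R]_d).
Local Notation E := 'rV[R]_d.
Local Notation mu := (lebesgue_rV R d).

Definition ip (u v : E -> R) : R := \int[mu]_(x in Omega) (u x * v x).

Definition ipv (g h : E -> E) : R :=
  \int[mu]_(x in Omega) (\sum_(i < d) g x 0 i * h x 0 i).

Definition normv (g : E -> E) : R := Num.sqrt (ipv g g).

Definition L2 : fspace (E -> R) := FSpace
  [set u : E -> R | measurable_fun Omega u /\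
           mu.-integrable Omega (fun x => (u x ^+ 2)%:E)]
  (fun u => Num.sqrt (ip u u)).

Definition L2v (g : E -> E) := forall i, L2 (fun x => g x 0 i).

Definition Linf : fspace (E -> R) := FSpace
  [set u : E -> R | measurable_fun Omega u /\
           ('N[mu]_+oo[EFin \o (u \_ Omega)] < +oo)%E]
  (fun u => fine 'N[mu]_+oo[EFin \o (u \_ Omega)]%E).

Definition gradient (phi : E -> R) (x : E) : E :=
  \row_i 'D_(delta_mx 0 i) phi x.

Definition weak_gradient (u : E -> R) (g : E -> E) :=
  L2v g /\
  forall (i : 'I_d) phi, test_function Omega phi ->
    \int[mu]_(x in Omega) (u x * gradient phi x 0 i) =
    - \int[mu]_(x in Omega) (g x 0 i * phi x).

(* the weak gradient of u when u is in H^1(Omega), and 0 otherwise *)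
Definition grad (u : E -> R) : E -> E :=
  xget (fun=> 0) [set g | weak_gradient u g].

Definition H1norm (u : E -> R) : R :=
  Num.sqrt (ip u u + ipv (grad u) (grad u)).

Definition H1 : fspace (E -> R) := FSpace
  [set u | L2 u /\ exists g, weak_gradient u g] H1norm.

(* H^1_0(Omega), the closure of C_c^oo(Omega) in H^1(Omega) *)
Definition H10 : fspace (E -> R) := FSpace
  [set u | H1 u /\ forall e, 0 < e ->
             exists2 phi, test_function Omega phi & H1norm (u - phi) < e]
  H1norm.

End sobolev.

(* R, as the target space of scalar functions of time *)
Definition Rspace (R : realType) : fspace R :=
  FSpace (fun=> True) (fun x => `|x|).

Section time.
Variables (R : realType) (V : lmodType R) (X : fspace V) (T : R).
Implicit Types (u v : R -> V) (t : R).
Local Notation mu := (@lebesgue_measure R).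

(* C([0,T], X) and its norm *)
Definition C0 u :=
  forall t, t \in `[0, T] ->
    X (u t) /\ fnorm X (u s - u t) @[s --> within `[0, T] (nbhs t)] --> (0 : R).

Definition normC u : R := sup [set fnorm X (u t) | t in `[0, T]].

(* v is the derivative of u at t in X, one-sided if t = 0 or t = T *)
Definition tderive u t (v : V) :=
  X v /\ fnorm X ((s - t)^-1 *: (u s - u t) - v)
    @[s --> within `[0, T] (dnbhs t)] --> (0 : R).

(* u is in C^1([0,T], X) with derivative u' *)
Definition C1 u u' :=
  [/\ C0 u, forall t, t \in `[0, T] -> tderive u t (u' t) & C0 u'].

Definition C2 u u' u'' := C1 u u' /\ C1 u' u''.

Record simple := Simple {
  simple_size : nat ;
  simple_set : 'I_simple_size -> set (measurableTypeR R) ;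
  simple_val : 'I_simple_size -> V }.
Arguments simple_set s i : clear implicits.
Arguments simple_val s i : clear implicits.

Definition is_simple (s : simple) :=
  forall i, measurable (simple_set s i) /\ X (simple_val s i).

Definition simple_fun (s : simple) (t : R) : V :=
  \sum_i \1_(simple_set s i) t *: simple_val s i.

Definition simple_integral (s : simple) : V :=
  \sum_i fine (mu (simple_set s i `&` `]0, T[)) *: simple_val s i.

Definition bochner_measurable u :=
  exists2 s : nat -> simple, (forall k, is_simple (s k)) &
    {ae mu, forall t, t \in `]0, T[ -> X (u t) /\
      fnorm X (simple_fun (s k) t - u t) @[k --> \oo] --> (0 : R)}.

Definition bochner_integral u (I : V) :=
  [/\ bochner_measurable u, X I & exists s : nat -> simple,
    [/\ forall k, is_simple (s k),
        (\int[mu]_(t in `]0%R, T[) (fnorm X (u t - simple_fun (s k) t))%:E)%E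
          @[k --> \oo] --> 0%E &
        fnorm X (simple_integral (s k) - I) @[k --> \oo] --> (0 : R)]].

(* L^2((0,T), X) *)
Definition L2time u :=
  bochner_measurable u /\
  (\int[mu]_(t in `]0%R, T[) ((fnorm X (u t)) ^+ 2)%:E < +oo)%E.

(* u' is the weak derivative of u on (0,T), as an X-valued distribution *)
Definition weak_tderive u u' :=
  forall phi : R -> R, test_function `]0, T[ phi ->
  exists2 I, bochner_integral (fun t => derive1 phi t *: u t) I &
             bochner_integral (fun t => phi t *: u' t) (- I).

(* u is in H^1((0,T), X) with weak derivative u' *)
Definition H1time u u' := [/\ L2time u, L2time u' & weak_tderive u u'].

End time.

Section problem.
Variables (R : realType) (d : nat) (Omega : set 'rV[R]_d).
Local Notation E := 'rV[R]_d.
Local Notation ip := (ip Omega).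
Local Notation ipv := (ipv Omega).
Local Notation grad := (grad Omega).

Definition scalev (a : E -> R) (g : E -> E) : E -> E := fun x => a x *: g x.

Definition fdiv (u v : E -> R) : E -> R := fun x => u x / v x.

(* (w, phi) + (eta grad v, grad phi) + (kappa grad u, grad phi)
   = h (p, phi) + (g, phi) for all phi in H^1_0(Omega) *)
Definition variational (eta kappa w v u : E -> R) (h : R) (p g : E -> R) :=
  forall phi, H10 Omega phi ->
    ip w phi + ipv (scalev eta (grad v)) (grad phi)
             + ipv (scalev kappa (grad u)) (grad phi)
    = h * ip p phi + ip g phi.

(* The common right-hand side of the formulas for h(t) and for h_i: [v] is the
   time derivative (or the backward difference) of the unknown, [u] the unknown
   (or its value at the previous step), [rho'] that of the density, [wbar] is
   (p, omega / rho) and [m'] the value of the derivative of the measurement. *)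
Definition source (f : R -> R) (omega : E -> R) (wbar m' : R)
    (rho rho' eta kappa v u : E -> R) : R :=
  let q := fdiv omega rho in
  wbar^-1 * (m' + ip u (fdiv (omega \* rho') rho)
                + ipv (scalev eta (grad v)) (grad q)
                + ipv (scalev kappa (grad u)) (grad q)
                - ip (f \o u) q).

Definition node (T : R) (n i : nat) : R := i%:R * (T / n%:R).

(* backward difference at step i >= 1 *)
Definition delta (V : lmodType R) (tau : R) (z : nat -> V) (i : nat) : V :=
  tau^-1 *: (z i - z i.-1).

(* (U i, H i), 1 <= i <= n, solves the scheme with n steps started at u0 *)
Definition discrete_solution (T : R) (rho eta kappa : R -> E -> R)
    (f m' : R -> R) (omega : E -> R) (p : R -> E -> R) (wbar : R -> R)
    (u0 : E -> R) (n : nat) (U : nat -> E -> R) (H : nat -> R) :=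
  let tau := T / n%:R in
  let t := node T n in
  [/\ H10 Omega (U 0), eq_in (H10 Omega) (U 0) u0 &
  forall i, (1 <= i <= n)%N ->
    [/\ H10 Omega (U i),
        variational (eta (t i)) (kappa (t i))
          (delta tau (fun j => rho (t j) \* U j) i) (delta tau U i) (U i)
          (H i) (p (t i)) (f \o U i.-1) &
        H i = source f omega (wbar (t i)) (m' (t i)) (rho (t i))
          (delta tau (rho \o t) i) (eta (t i)) (kappa (t i))
          (delta tau U i) (U i.-1)]].

End problem.

(* Main.v *)
Require Import Defs.
From HB Require Import structures.
From mathcomp Require Import all_boot all_order all_algebra.
From mathcomp Require Import all_classical all_reals all_analysis.
From mathcomp Require Import measurable_realfun ess_sup_inf ring lra.
Set Implicit Arguments.
Unset Strict Implicit.
Unset Printing Implicit Defensive.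
Import Order.TTheory GRing.Theory Num.Theory.
Import numFieldNormedType.Exports.
Local Open Scope classical_set_scope.
Local Open Scope ring_scope.

(* Let [D] be the difference between u'(t_i) and the backward difference of the
   scheme.  Subtracting the scheme from the equation at t_i and testing with [D],
   which lies in H^1_0, gives
     rho_0 |D|^2 + eta_0 |grad D|^2 <= |p| |h(t_i) - h_i| |D| + lower order terms,
   while |h(t_i) - h_i| is at most M eta_1 |grad D| / omega_m plus lower order
   terms.  The smallness condition is exactly what is needed to absorb the
   product |D| |grad D| by Young's inequality, so that the H^1 norm of [D] is
   bounded by C (|e_(i-1)| + |e_i| + tau), with e_i = u(t_i) - u_i.  A discrete
   Gronwall argument and the Taylor expansion of u conclude.

   The equation is only known for almost every time; it holds at every node
   because all its terms are continuous in time.  For the terms that contain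
   grad (omega / rho(t)), which is only bounded in L^2, this is a weak-strong
   continuity argument that rests on the density of test functions in L^2.  The
   same density gives the uniqueness of weak gradients, hence the linearity of
   the gradient, and integration by parts for test functions makes H^1_0 a
   linear space. *)

(** * Semi-inner products and seminormed spaces *)

(** The error in h contains the gradient of [D]. The viscous term acts on the time derivative, so
    testing with [D] is what produces a coercive term able to dominate that gradient. It also bounds
    |h(t_i) - h_i| at every single step, and the estimate of the sum is then immediate. With
    [theta := Num.sqrt zeta], the product term consumes at most the fraction [theta] of the coercive
    part, and all final constants carry the factor 1 / (1 - theta). The term in kappa is implicit
    and puts e_i into its own bound; this is what forces tau to be small.

    Functions are representatives, and [grad] chooses one weak gradient among many. All spaces are
    therefore only seminormed, and identities between gradients hold up to an element of norm zero;
    Cauchy-Schwarz turns them into genuine equalities between inner products, the only form in which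
    they enter the equation. *)

Section semi_inner.
Variables (R : realType) (V : lmodType R).

(** No definiteness: a function that vanishes almost everywhere has norm zero without being [0].
    Linearity is asked on [P] only, since outside [P] the integrals may take default values. *)
Record semi_inner (P : V -> Prop) (B : V -> V -> R) : Prop := SemiInner {
  semi_inner0 : P 0 ;
  semi_innerP : forall a u v, P u -> P v -> P (a *: u + v) ;
  semi_innerC : forall u v, B u v = B v u ;
  semi_innerPl : forall a u v w, P u -> P v -> P w ->
    B (a *: u + v) w = a * B u w + B v w ;
  semi_inner_ge0 : forall u, P u -> 0 <= B u u }.

Variables (P : V -> Prop) (B : V -> V -> R) (PB : semi_inner P B).

Let P0 := semi_inner0 PB.
Let PP := semi_innerP PB.

Lemma siZ a u : P u -> P (a *: u).
Proof. by move=> Pu; rewrite -[_ *: _]addr0; exact: PP. Qed.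

Lemma siD u v : P u -> P v -> P (u + v).
Proof. by move=> Pu Pv; rewrite -[u]scale1r; exact: PP. Qed.

Lemma siN u : P u -> P (- u).
Proof. by move=> Pu; rewrite -scaleN1r; exact: siZ. Qed.

Lemma siB u v : P u -> P v -> P (u - v).
Proof. by move=> Pu Pv; apply: siD => //; exact: siN. Qed.

Lemma siDl u v w : P u -> P v -> P w -> B (u + v) w = B u w + B v w.
Proof.
by move=> Pu Pv Pw; rewrite -[u in LHS]scale1r (semi_innerPl PB)// mul1r.
Qed.

Lemma si0l w : P w -> B 0 w = 0.
Proof.
by move=> Pw; apply: (addrI (B 0 w)); rewrite -siDl// !addr0.
Qed.

Lemma siZl a u w : P u -> P w -> B (a *: u) w = a * B u w.
Proof.
by move=> Pu Pw; rewrite -[_ *: _]addr0 (semi_innerPl PB)// si0l// addr0.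
Qed.

Lemma siNl u w : P u -> P w -> B (- u) w = - B u w.
Proof. by move=> Pu Pw; rewrite -scaleN1r siZl// mulN1r. Qed.

Lemma siBl u v w : P u -> P v -> P w -> B (u - v) w = B u w - B v w.
Proof. by move=> Pu Pv Pw; rewrite siDl ?siNl//; exact: siN. Qed.

Lemma siDr u v w : P u -> P v -> P w -> B w (u + v) = B w u + B w v.
Proof. by move=> Pu Pv Pw; rewrite !(semi_innerC PB w) siDl. Qed.

Lemma siZr a u w : P u -> P w -> B w (a *: u) = a * B w u.
Proof. by move=> Pu Pw; rewrite !(semi_innerC PB w) siZl. Qed.

Lemma siBr u v w : P u -> P v -> P w -> B w (u - v) = B w u - B w v.
Proof. by move=> Pu Pv Pw; rewrite !(semi_innerC PB w) siBl. Qed.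

Lemma siC_sqr u v : P u -> P v -> B u v ^+ 2 <= B u u * B v v.
Proof.
move=> Pu Pv.
have key a : 0 <= a ^+ 2 * B u u + 2 * a * B u v + B v v.
  have Pw : P (a *: u + v) by exact: PP.
  have := semi_inner_ge0 PB Pw.
  rewrite (semi_innerPl PB)// !(semi_innerC PB _ (_ + _)).
  by rewrite !(semi_innerPl PB)// (semi_innerC PB v u) => /le_trans; apply; lra.
have [uu0|uu0] := eqVneq (B u u) 0.
  rewrite uu0 mul0r; have [->|uv0] := eqVneq (B u v) 0; first by rewrite expr0n.
  (* When [B u u = 0] the quadratic is affine in [a]; at this point it would equal -1. *)
  have := key (- (B v v + 1) / (2 * B u v)).
  rewrite uu0 mulr0 add0r.
  have -> : 2 * (- (B v v + 1) / (2 * B u v)) * B u v = - (B v v + 1) by field.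
  by lra.
have uup : 0 < B u u by rewrite lt_def uu0 (semi_inner_ge0 PB).
(* The minimiser of the quadratic, where its value is the discriminant inequality. *)
have := key (- B u v / B u u).
have -> : (- B u v / B u u) ^+ 2 * B u u + 2 * (- B u v / B u u) * B u v + B v v
   = (B u u * B v v - B u v ^+ 2) / B u u by field.
by rewrite pmulr_lge0 ?invr_gt0// subr_ge0.
Qed.

Local Notation N u := (Num.sqrt (B u u)).

Lemma si_CS u v : P u -> P v -> `|B u v| <= N u * N v.
Proof.
move=> Pu Pv; rewrite -sqrtrM ?(semi_inner_ge0 PB)// -sqrtr_sqr ler_wsqrtr//.
exact: siC_sqr.
Qed.

Lemma si_normsq u : P u -> N u ^+ 2 = B u u.
Proof. by move=> Pu; rewrite sqr_sqrtr// (semi_inner_ge0 PB). Qed.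

Lemma si_normZ a u : P u -> N (a *: u) = `|a| * N u.
Proof.
move=> Pu; rewrite siZl//; last exact: siZ.
rewrite siZr// mulrA -expr2 sqrtrM ?sqr_ge0// sqrtr_sqr//.
Qed.

Lemma si_normD u v : P u -> P v -> N (u + v) <= N u + N v.
Proof.
move=> Pu Pv; have Puv : P (u + v) by exact: siD.
rewrite -(@ler_pXn2r _ 2)// ?nnegrE ?addr_ge0 ?sqrtr_ge0//.
rewrite si_normsq// sqrrD !si_normsq// siDl// !siDr// (semi_innerC PB v u).
have := le_trans (ler_norm _) (si_CS Pu Pv); lra.
Qed.

(** The replacement for rewriting with an equality: representatives at distance zero are
    indistinguishable by inner products. *)
Lemma si_norm_eq0 u v w : P u -> P v -> P w -> N (u - v) = 0 -> B u w = B v w.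
Proof.
move=> Pu Pv Pw uv0; apply/eqP; rewrite -subr_eq0 -siBl// -normr_le0.
by apply: le_trans (si_CS (siB Pu Pv) Pw) _; rewrite uv0 mul0r.
Qed.

End semi_inner.

Section seminorm.
Variables (R : realType) (V : lmodType R) (X : fspace V).

(** The common ground of L^2, L^oo, H^1, H^1_0 and the square-integrable vector fields, on which the
    calculus in time is developed once. *)
Record seminormed : Prop := Seminormed {
  seminormed0 : X 0 ;
  seminormedP : forall a u v, X u -> X v -> X (a *: u + v) ;
  seminormed_ge0 : forall u, 0 <= fnorm X u ;
  seminormedZ : forall a u, X u -> fnorm X (a *: u) = `|a| * fnorm X u ;
  seminormedD : forall u v, X u -> X v ->
    fnorm X (u + v) <= fnorm X u + fnorm X v }.

Hypothesis SX : seminormed.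

Lemma smZ a u : X u -> X (a *: u).
Proof. by move=> Xu; rewrite -[_ *: _]addr0; exact: seminormedP (seminormed0 SX). Qed.

Lemma smD u v : X u -> X v -> X (u + v).
Proof. by move=> Xu Xv; rewrite -[u]scale1r; exact: seminormedP. Qed.

Lemma smN u : X u -> X (- u).
Proof. by move=> Xu; rewrite -scaleN1r; exact: smZ. Qed.

Lemma smB u v : X u -> X v -> X (u - v).
Proof. by move=> Xu Xv; apply: smD => //; exact: smN. Qed.

Lemma sm_norm0 : fnorm X 0 = 0.
Proof. by rewrite -(scale0r 0) (seminormedZ SX) ?normr0 ?mul0r//; exact: seminormed0. Qed.

Lemma sm_normN u : X u -> fnorm X (- u) = fnorm X u.
Proof. by move=> Xu; rewrite -scaleN1r (seminormedZ SX)// normrN1 mul1r. Qed.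

Lemma sm_normB u v : X u -> X v -> fnorm X (u - v) <= fnorm X u + fnorm X v.
Proof. by move=> Xu Xv; rewrite -(sm_normN Xv) (seminormedD SX)//; exact: smN. Qed.

Lemma sm_normC u v : X u -> X v -> fnorm X (u - v) = fnorm X (v - u).
Proof. by move=> Xu Xv; rewrite -opprB sm_normN//; exact: smB. Qed.

Lemma sm_normBB u v w : X u -> X v -> X w ->
  fnorm X (u - w) <= fnorm X (u - v) + fnorm X (v - w).
Proof.
move=> Xu Xv Xw; have -> : u - w = (u - v) + (v - w) by rewrite addrA subrK.
by apply: (seminormedD SX); exact: smB.
Qed.

Lemma sm_dist_norm u v : X u -> X v -> `|fnorm X u - fnorm X v| <= fnorm X (u - v).
Proof.
move=> Xu Xv; rewrite ler_norml; apply/andP; split.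
  have := seminormedD SX Xu (smB Xv Xu); rewrite addrC subrK sm_normC//; lra.
have := seminormedD SX Xv (smB Xu Xv); rewrite addrC subrK; lra.
Qed.

End seminorm.

Lemma semi_inner_seminormed (R : realType) (V : lmodType R) (X : fspace V) B :
  semi_inner X B -> (forall u, fnorm X u = Num.sqrt (B u u)) -> seminormed X.
Proof.
move=> XB XN; split.
- exact: semi_inner0 XB.
- exact: semi_innerP XB.
- by move=> u; rewrite XN sqrtr_ge0.
- by move=> a u Xu; rewrite !XN (si_normZ XB).
- by move=> u v Xu Xv; rewrite !XN (si_normD XB).
Qed.

(** * Lebesgue spaces on a domain *)

Section lebesgue_spaces.
Variables (R : realType) (d : nat) (Omega : set 'rV[R]_d).
Hypothesis mO : measurable Omega.
Local Notation E := 'rV[R]_d.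
Local Notation mu := (lebesgue_rV R d).
Local Notation ip := (ip Omega).
Local Notation ipv := (ipv Omega).
Local Notation L2 := (L2 Omega).
Local Notation L2v := (L2v Omega).
Local Notation Linf := (Linf Omega).
Implicit Types (u v w a b : E -> R) (g h k : E -> E).

Lemma L2_meas u : L2 u -> measurable_fun Omega u.
Proof. by case. Qed.

Lemma L2_integrableM u v : L2 u -> L2 v ->
  mu.-integrable Omega (EFin \o (u \* v)).
Proof.
move=> [mu_ iu] [mv iv].
have mM := measurable_funM mu_ mv.
apply: (le_integrable mO _ _ (integrableD mO iu iv)).
  exact/measurable_EFinP.
move=> x Ox /=; rewrite lee_fin (ger0_norm (addr_ge0 (sqr_ge0 _) (sqr_ge0 _))).
rewrite normrM; have := sqr_ge0 (`|u x| - `|v x|).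
rewrite -(real_normK (num_real (u x))) -(real_normK (num_real (v x))).
have := sqr_ge0 `|u x|; have := sqr_ge0 `|v x|; nra.
Qed.

Lemma L2P (a : R) u v : L2 u -> L2 v -> L2 (a *: u + v).
Proof.
move=> Lu Lv; have mw : measurable_fun Omega (a *: u + v : E -> R).
  apply: measurable_funD; last exact: L2_meas Lv.
  by apply: measurable_funM => //; exact: L2_meas Lu.
split => //.
have iuv := L2_integrableM Lu Lv; case: Lu Lv => _ iu [_ iv].
have := integrableD mO (integrableZl mO (a ^+ 2) iu)
  (integrableD mO (integrableZl mO (2 * a) iuv) iv).
apply: eq_integrable => // x _ /=.
by rewrite -!EFinM -!EFinD; congr EFin; rewrite !fctE /= /GRing.scale/=; ring.
Qed.

Lemma L20 : L2 0.
Proof.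
split; first exact: measurable_cst.
have := integrable0 mu Omega.
by apply: eq_integrable => // x _ /=; rewrite /GRing.zero/= expr0n.
Qed.

Lemma ip_semi_inner : semi_inner L2 ip.
Proof.
split.
- exact: L20.
- exact: L2P.
- by move=> u v; apply: eq_Rintegral => x _; rewrite mulrC.
- move=> a u v w Lu Lv Lw; rewrite /Defs.ip.
  rewrite -RintegralZl//; last exact: L2_integrableM.
  rewrite -RintegralD//; last exact: L2_integrableM.
    by apply: eq_Rintegral => x _; rewrite !fctE /GRing.scale/=; ring.
  exact: (integrableZl mO _ (L2_integrableM Lu Lw)).
- by move=> u Lu; apply: Rintegral_ge0 => x _; rewrite -expr2 sqr_ge0.
Qed.

Lemma L2_seminormed : seminormed L2.
Proof. exact: semi_inner_seminormed ip_semi_inner _. Qed.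

Lemma ipv_sum g h : L2v g -> L2v h ->
  ipv g h = \sum_(i < d) ip (fun x => g x 0 i) (fun x => h x 0 i).
Proof.
move=> Lg Lh; rewrite /Defs.ipv /Defs.ip /Rintegral.
under eq_integral do rewrite -sumEFin.
rewrite integral_sum//; last by move=> i; exact: (L2_integrableM (Lg i) (Lh i)).
rewrite -sum_fine// => i _; apply: integrable_fin_num => //.
exact: (L2_integrableM (Lg i) (Lh i)).
Qed.

Lemma ipv_semi_inner : semi_inner L2v ipv.
Proof.
have LP (a : R) g h : L2v g -> L2v h -> L2v (a *: g + h).
  move=> Lg Lh i; have := L2P a (Lg i) (Lh i).
  congr (L2 _); apply/funext => x; by rewrite !fctE !mxE.
split=> //.
- move=> i; have := L20; congr (L2 _); apply/funext => x.
  by rewrite /GRing.zero/= mxE.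
- by move=> u v; apply: eq_Rintegral => x _; apply: eq_bigr => i _; rewrite mulrC.
- move=> a g h k Lg Lh Lk; rewrite !ipv_sum//; last exact: LP.
  rewrite mulr_sumr -big_split/=; apply: eq_bigr => i _.
  rewrite -(semi_innerPl ip_semi_inner)//; congr ip.
  by apply/funext => x; rewrite !fctE !mxE.
- move=> g Lg; rewrite ipv_sum// sumr_ge0// => i _.
  exact: (semi_inner_ge0 ip_semi_inner).
Qed.

Lemma Linf_ae a : Linf a ->
  {ae mu, forall x, Omega x -> `|a x| <= fnorm Linf a}.
Proof.
move=> [ma]; rewrite /fnorm/= => fa.
have /fineK eqa : ('N[mu]_+oo[EFin \o (a \_ Omega)])%E \is a fin_num.
  by rewrite ge0_fin_numE// Lnorm_ge0.
(* The essential supremum norm is set to 0 when the whole space is null, and then every property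
   holds almost everywhere. *)
have : ((0 : \bar R) < mu setT)%E \/ mu setT = 0.
  have := measure_ge0 mu setT; rewrite le_eqVlt => /orP[/eqP|]; by [right|left].
move=> [mu0|mu0]; last first.
  exists setT; split=> //; exact: measurableT.
have := ess_sup_ge mu (abse \o (EFin \o (a \_ Omega))).
apply: filterS => x; rewrite -lee_fin eqa unlock/= mu0 => + Ox.
by rewrite /= patchE mem_set.
Qed.

Lemma ae_Linf a c : measurable_fun Omega a -> 0 <= c ->
  {ae mu, forall x, Omega x -> `|a x| <= c} -> Linf a /\ fnorm Linf a <= c.
Proof.
move=> ma c0 ac.
have H : ('N[mu]_+oo[EFin \o (a \_ Omega)] <= c%:E)%E.
  rewrite unlock/=; case: ifPn => _; last by rewrite lee_fin.
  apply/ess_supP; apply: filterS ac => x xc /=; rewrite lee_fin patchE.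
  by case: ifPn => [/set_mem|_]; [exact: xc|rewrite normr0].
split; first by split => //; apply: le_lt_trans H (ltry _).
rewrite -lee_fin /fnorm/= fineK// ge0_fin_numE ?Lnorm_ge0//.
exact: le_lt_trans H (ltry _).
Qed.

Lemma Linf_meas a : Linf a -> measurable_fun Omega a.
Proof. by case. Qed.

Lemma Linf_norm_ge0 a : 0 <= fnorm Linf a.
Proof. by rewrite /fnorm/= fine_ge0// Lnorm_ge0. Qed.

Lemma Linf_seminormed : seminormed Linf.
Proof.
have LD a b : Linf a -> Linf b ->
    Linf (a + b) /\ fnorm Linf (a + b) <= fnorm Linf a + fnorm Linf b.
  move=> La Lb; apply: ae_Linf.
  - by apply: measurable_funD; exact: Linf_meas.
  - by rewrite addr_ge0 ?Linf_norm_ge0.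
  - apply: filterS2 (Linf_ae La) (Linf_ae Lb) => x ax bx Ox.
    by apply: le_trans (ler_normD _ _) _; exact: lerD (ax Ox) (bx Ox).
have LZ c a : Linf a ->
    Linf (c *: a) /\ fnorm Linf (c *: a) <= `|c| * fnorm Linf a.
  move=> La; apply: ae_Linf.
  - by apply: measurable_funM => //; exact: Linf_meas.
  - by rewrite mulr_ge0 ?Linf_norm_ge0.
  - apply: filterS (Linf_ae La) => x ax Ox.
    by rewrite [_ x]/(c * a x) normrM ler_wpM2l// ax.
have L0 : Linf 0 /\ fnorm Linf 0 <= 0.
  apply: ae_Linf => //; first exact: measurable_cst.
  by apply: aeW => x _; rewrite normr0.
split.
- by case: L0.
- by move=> c u v Lu Lv; case: (LD _ _ (LZ c u Lu).1 Lv).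
- exact: Linf_norm_ge0.
- move=> c u Lu; apply/eqP; rewrite eq_le (LZ _ _ Lu).2/=.
  have [->|c0] := eqVneq c 0; first by rewrite normr0 mul0r Linf_norm_ge0.
  have := (LZ c^-1 _ (LZ c u Lu).1).2.
  rewrite scalerA mulVf// scale1r normfV mulrC ler_pdivlMr ?normr_gt0//.
  by rewrite mulrC.
- by move=> u v Lu Lv; case: (LD _ _ Lu Lv).
Qed.

(** Membership and norm bound are obtained together from a pointwise domination; multiplication by
    bounded coefficients, Lipschitz composition and division by the density are all instances. *)
Lemma L2_bounded u w c : L2 u -> measurable_fun Omega w -> 0 <= c ->
  {ae mu, forall x, Omega x -> `|w x| <= c * `|u x|} ->
  L2 w /\ fnorm L2 w <= c * fnorm L2 u.
Proof.
move=> Lu mw c0 ae.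
have [mu_ iu] := Lu.
have mw2 : measurable_fun Omega (fun x => (w x ^+ 2)%:E).
  exact/measurable_EFinP/measurable_funX.
have icu : mu.-integrable Omega (fun x => (c ^+ 2 * u x ^+ 2)%:E).
  exact: (integrableZl mO (c ^+ 2) iu).
have mc := measurable_int _ icu.
have key : (\int[mu]_(x in Omega) (w x ^+ 2)%:E <=
    \int[mu]_(x in Omega) (c ^+ 2 * u x ^+ 2)%:E)%E.
  apply: ae_ge0_le_integral => //.
  - by move=> x _; rewrite lee_fin sqr_ge0.
  - by move=> x _; rewrite lee_fin mulr_ge0 ?sqr_ge0.
  - apply: filterS ae => x wx Ox; rewrite /= lee_fin.
    rewrite -exprMn -(real_normK (num_real (w x))) -(real_normK (num_real (_ * _))).
    by rewrite ler_pXn2r ?nnegrE// normrM (ger0_norm c0) wx.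
have iw : mu.-integrable Omega (fun x => (w x ^+ 2)%:E).
  apply/integrableP; split => //.
  under eq_integral do rewrite gee0_abs ?lee_fin ?sqr_ge0//.
  exact: le_lt_trans key (integrable_lty mO icu).
have Lw : L2 w by [].
split => //.
rewrite /fnorm/= -(@ler_pXn2r _ 2)// ?nnegrE ?sqrtr_ge0 ?mulr_ge0 ?sqrtr_ge0//.
rewrite exprMn !(si_normsq ip_semi_inner)// /Defs.ip /= -RintegralZl//.
rewrite /Rintegral fine_le ?integrable_fin_num//.
Qed.

Lemma Linf_L2 a u : Linf a -> L2 u ->
  L2 (a \* u) /\ fnorm L2 (a \* u) <= fnorm Linf a * fnorm L2 u.
Proof.
move=> La Lu; apply: L2_bounded => //.
- by apply: measurable_funM; [exact: Linf_meas|exact: L2_meas].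
- exact: Linf_norm_ge0.
- apply: filterS (Linf_ae La) => x ax Ox.
  by rewrite normrM ler_wpM2r// ax.
Qed.

Lemma fnormL2v_ge0 g : 0 <= normv Omega g.
Proof. exact: sqrtr_ge0. Qed.

Lemma L2v_bounded g k c : L2v g -> (forall i, measurable_fun Omega (fun x => k x 0 i)) ->
  0 <= c ->
  {ae mu, forall x, Omega x -> forall i, `|k x 0 i| <= c * `|g x 0 i|} ->
  L2v k /\ normv Omega k <= c * normv Omega g.
Proof.
move=> Lg mk c0 ae.
have H i : L2 (fun x => k x 0 i) /\ fnorm L2 (fun x => k x 0 i) <=
    c * fnorm L2 (fun x => g x 0 i).
  apply: L2_bounded => //; apply: filterS ae => x + Ox; exact.
have Lk : L2v k by move=> i; exact: (H i).1.
split => //.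
rewrite -(@ler_pXn2r _ 2)// ?nnegrE ?mulr_ge0 ?fnormL2v_ge0//.
rewrite exprMn /normv !(si_normsq ipv_semi_inner)// !ipv_sum// mulr_sumr.
apply: ler_sum => i _; have Hi := (H i).2.
rewrite /fnorm/= -(@ler_pXn2r _ 2)// ?nnegrE ?mulr_ge0 ?sqrtr_ge0// in Hi.
by move: Hi; rewrite exprMn !(si_normsq ip_semi_inner).
Qed.

Lemma Linf_L2v a g : Linf a -> L2v g ->
  L2v (scalev a g) /\ normv Omega (scalev a g) <= fnorm Linf a * normv Omega g.
Proof.
move=> La Lg; apply: L2v_bounded => //.
- move=> i; rewrite (_ : (fun _ => _) = a \* (fun x => g x 0 i)).
    by apply: measurable_funM; [exact: Linf_meas|exact: L2_meas].
  by apply/funext => x; rewrite !mxE.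
- exact: Linf_norm_ge0.
- apply: filterS (Linf_ae La) => x ax Ox i.
  by rewrite mxE normrM ler_wpM2r// ax.
Qed.

Lemma L2v_comp g i : L2v g -> fnorm L2 (fun x => g x 0 i) <= normv Omega g.
Proof.
move=> Lg; rewrite /fnorm/= /normv ler_wsqrtr// ipv_sum// (bigD1 i)//= lerDl.
by rewrite sumr_ge0// => j _; exact: (semi_inner_ge0 ip_semi_inner).
Qed.

End lebesgue_spaces.

(** * Boxes and Borel sets *)

Lemma coord_le_norm (R : realType) (d : nat) (x : 'rV[R]_d) i : `|x 0 i| <= `|x|.
Proof.
by rewrite [leRHS]/Num.norm/= mx_normrE; apply/bigmax_geP; right; exists (0, i).
Qed.

Section boxes.
Variables (R : realType) (d : nat).
Local Notation E := 'rV[R]_d.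
Local Notation mu := (lebesgue_rV R d).

Definition box (a b : E) : set E := [set x | forall i, a 0 i < x 0 i < b 0 i].
Definition cbox (a b : E) : set E := [set x | forall i, a 0 i <= x 0 i <= b 0 i].
Definition orthant (a : E) : set E := [set x | forall i, a 0 i < x 0 i].

Lemma box_cbox a b : box a b `<=` cbox a b.
Proof. by move=> x xab i; have /andP[/ltW-> /ltW->] := xab i. Qed.

Lemma measurable_coord_preimage (i : 'I_d) (Y : set R) :
  measurable (Y : set (measurableTypeR R)) -> measurable [set x : E | Y (x 0 i)].
Proof.
by move=> mY; rewrite -[X in measurable X]setTI; exact: (measurable_coord i).
Qed.

Lemma measurable_box a b : measurable (box a b).
Proof.
rewrite (_ : box a b = \bigcap_(i in [set: 'I_d]) [set x | `]a 0 i, b 0 i[%classic (x 0 i)]).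
  by apply: fin_bigcap_measurable => // i _; exact: measurable_coord_preimage.
apply/seteqP; split => x xab i; first by move=> _; rewrite /= in_itv/=; exact: xab.
by have := xab i Logic.I; rewrite /= in_itv.
Qed.

Lemma measurable_orthant a : measurable (orthant a).
Proof.
rewrite (_ : orthant a = \bigcap_(i in [set: 'I_d]) [set x | `]a 0 i, +oo[%classic (x 0 i)]).
  by apply: fin_bigcap_measurable => // i _; exact: measurable_coord_preimage.
apply/seteqP; split => x xab i; first by move=> _; rewrite /= in_itv/= andbT; exact: xab.
by have := xab i Logic.I; rewrite /= in_itv/= andbT.
Qed.

Lemma orthantI a b :
  orthant a `&` orthant b = orthant (\row_i Num.max (a 0 i) (b 0 i)).
Proof.
apply/seteqP; split => [x [xa xb] i|x xab]; first by rewrite mxE gt_max xa xb.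
by split => i; have := xab i; rewrite mxE gt_max => /andP[].
Qed.

Lemma orthant_boxI a b c : orthant a `&` box b c =
  box (\row_i Num.max (a 0 i) (b 0 i)) c.
Proof.
apply/seteqP; split => [x [xa xb] i|x xab].
  by have /andP[bi ci] := xb i; rewrite mxE gt_max xa bi.
by split => i; have := xab i; rewrite mxE gt_max => /andP[/andP[? ?] ?]//; apply/andP.
Qed.

(** Orthants are stable under intersection, so this generator makes the Dynkin induction of
    [test_closure_measurable_box] possible. *)
Lemma measurable_rVE : @measurable _ E = <<s range orthant >>.
Proof.
apply/seteqP; split; last first.
  apply: smallest_sub; first exact: sigma_algebra_measurable.
  by move=> _ [a _ <-]; exact: measurable_orthant.
have [d0|d0] := posnP d.
  move=> A _.
  have : A = set0 \/ A = setT.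
    have [->|/set0P[x Ax]] := eqVneq A set0; [by left|right].
    apply/seteqP; split => // y _.
    suff -> : y = x by [].
    apply/rowP => i; exfalso; have := ltn_ord i; move: (nat_of_ord i) => k.
    by rewrite d0.
  case=> ->; first exact: sigma_algebra0.
  by rewrite -[X in _ X]setD0; apply: sigma_algebraCD; exact: sigma_algebra0.
apply: smallest_sub; first exact: smallest_sigma_algebra.
elim/big_ind: _ => [//|A B AG BG C [/AG|/BG]//|i _ B [C mC <-]].
rewrite setTI => {B}; move: C mC.
have H C : @measurable _ (measurableTypeR R) C ->
    <<s range orthant >> ((fun x : E => x 0 i) @^-1` C).
  rewrite [X in X C]RGenOInfty.measurableE.
  move: C; apply: smallest_sub.
    split.
    - by rewrite preimage_set0; exact: sigma_algebra0.
    - by move=> A /sigma_algebraC; rewrite setTD preimage_setC.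
    - by move=> F HF; rewrite preimage_bigcup; exact: sigma_algebra_bigcup.
  (* The half-space [a < x 0 i] is the countable union of the orthants whose other corner
     coordinates are -n. *)
  move=> _ [a ->]; rewrite (_ : _ @^-1` _ = \bigcup_(n : nat)
      orthant (\row_j if j == i then a else - n%:R)).
    by apply: sigma_algebra_bigcup => n; apply: sub_sigma_algebra; eexists.
  apply/seteqP; split => [x|x [n _ /(_ i)]]; last first.
    by rewrite mxE eqxx /= in_itv/= andbT.
  rewrite /= in_itv/= andbT => ax.
  exists (Num.truncn (\sum_j `|x 0 j|)).+1 => // j; rewrite mxE; case: eqP => [->//|_].
  have := truncnS_gt (\sum_j `|x 0 j|); set M := _.+1%:R.
  rewrite (bigD1 j)//= => jM; rewrite ltrNl.
  apply: le_lt_trans jM; rewrite -normrN (le_trans (ler_norm _))// lerDl.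
  exact: sumr_ge0.
exact: H.
Qed.

(** The boxes have rational corners and are enumerated through their codes; a code that gives no
    admissible box contributes [set0]. The closed box is kept inside [U] so that bumps on the box
    have compact support in [U]. *)
Lemma open_bigcup_box (U : set E) : open U -> exists F : (set E)^nat,
  U = \bigcup_n F n /\ forall n, F n = set0 \/
    exists a b, F n = box a b /\ cbox a b `<=` U.
Proof.
move=> oU.
pose T := ({ffun 'I_d -> rat} * {ffun 'I_d -> rat})%type.
pose v (f : {ffun 'I_d -> rat}) : E := \row_i ratr (f i).
pose G (ab : T) := if `[< cbox (v ab.1) (v ab.2) `<=` U >]
  then box (v ab.1) (v ab.2) else set0.
exists (fun n => if unpickle n is Some ab then G ab else set0); split; last first.
  move=> n; case: unpickle => [ab|]; last by left.
  rewrite /G; case: asboolP => [sU|]; last by left.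
  by right; exists (v ab.1), (v ab.2).
apply/seteqP; split => [x Ux|x [n _]]; last first.
  case: unpickle => [ab|//]; rewrite /G; case: asboolP => [sU|//].
  by move=> /box_cbox/sU.
have [e /= e0 xeU] : exists2 e : R, 0 < e & ball x e `<=` U.
  by have /nbhs_ballP := open_nbhs_nbhs (conj oU Ux).
have ra i : exists q : rat, x 0 i - e < ratr q < x 0 i.
  have /rat_in_itvoo[q] : x 0 i - e < x 0 i by rewrite ltrBlDr ltrDl.
  by rewrite in_itv/=; exists q.
have rb i : exists q : rat, x 0 i < ratr q < x 0 i + e.
  have /rat_in_itvoo[q] : x 0 i < x 0 i + e by rewrite ltrDl.
  by rewrite in_itv/=; exists q.
pose a := [ffun i => projT1 (cid (ra i))].
pose b := [ffun i => projT1 (cid (rb i))].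
have aP i : x 0 i - e < ratr (a i) < x 0 i by rewrite ffunE; case: cid.
have bP i : x 0 i < ratr (b i) < x 0 i + e by rewrite ffunE; case: cid.
exists (pickle (a, b)) => //; rewrite pickleK /G asboolT/=.
  by move=> i; rewrite !mxE; have /andP[_ ->] := aP i; have /andP[-> _] := bP i.
move=> y yab; apply: xeU; split=> // i j; rewrite (ord1 i).
have := yab j; rewrite !mxE => /andP[ay yb].
have /andP[ax _] := aP j; have /andP[_ xb] := bP j.
by rewrite /ball/= ltr_norml; apply/andP; split; lra.
Qed.

Lemma open_measurable_rV (U : set E) : open U -> measurable U.
Proof.
move=> /open_bigcup_box[F [-> FP]]; apply: bigcupT_measurable => n.
by case: (FP n) => [->//|[a [b [-> _]]]]; exact: measurable_box.
Qed.

Lemma continuous_measurable_rV (f : E -> R) : continuous f ->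
  measurable_fun [set: E] (f : E -> measurableTypeR R).
Proof.
move=> cf; apply: (measurability _ (RGenOpens.measurableE R)) => //.
move=> _ [_ [a [b ->] <-]]; rewrite setTI; apply: open_measurable_rV.
move/continuousP : cf; apply; exact: interval_open.
Qed.

Lemma cbox_compact a b : compact (cbox a b).
Proof.
rewrite (_ : cbox a b = [set v : E | forall i, `[a 0 i, b 0 i]%classic (v 0 i)]).
  by apply: (@rV_compact R d (fun i => `[a 0 i, b 0 i]%classic)) => i; exact: segment_compact.
by apply/seteqP; split => x xab i; have := xab i; rewrite /= in_itv.
Qed.

End boxes.

Lemma lebesgue_rV_box (R : realType) (d : nat) (a b : 'rV[R]_d) :
  (lebesgue_rV R d (box a b) < +oo)%E.
Proof.
elim: d a b => [|d IH] a b.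
  by rewrite /= diracE ltry.
change ((rV_prod (lebesgue_rV R d)) (box a b) < +oo)%E.
rewrite /rV_prod /pushforward.
rewrite (_ : _ @^-1` _ = `]a 0 0, b 0 0[%classic `*`
   box (\row_i a 0 (lift 0 i)) (\row_i b 0 (lift 0 i))).
  rewrite product_measure1E//; last exact: measurable_box.
  apply: lte_mul_pinfty => //.
  by rewrite ge0_fin_numE// [X in (X < _)%E](lebesgue_measure_itv `]a 0 0, b 0 0[)/=;
    case: ifP; rewrite -?EFinB ltry.
apply/seteqP; split => [[x y]|[x y]].
  rewrite /box/= /rV_cons => xy; split => /=.
    have := xy 0; have -> : 0 = lshift d (0 : 'I_1) by exact: val_inj.
    by rewrite in_itv/= [X in _ < X < _](row_mxEl _ _ _ _) mxE.
  move=> i; rewrite !mxE; have := xy (lift 0 i).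
  have -> : lift 0 i = rshift 1 i by exact: val_inj.
  by rewrite [X in _ < X < _](row_mxEr _ _ _ _).
rewrite /box/= in_itv/= => -[x0 yi] i; rewrite /rV_cons.
have [j ->|j ->] := split_ordP (i : 'I_(1 + d)).
  rewrite (ord1 j) [X in _ < X < _](row_mxEl _ _ _ _) mxE.
  by have <- : 0 = lshift d (0 : 'I_1) by exact: val_inj.
rewrite [X in _ < X < _](row_mxEr _ _ _ _); have := yi j; rewrite !mxE.
by have <- : lift 0 j = rshift 1 j by exact: val_inj.
Qed.

Lemma lebesgue_rV_bounded (R : realType) (d : nat) (A : set 'rV[R]_d) :
  measurable A -> bounded_set A -> (lebesgue_rV R d A < +oo)%E.
Proof.
move=> mA [M [Mr AM]].
have {}AM : forall x, A x -> `|x| < M + 2.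
  move=> x Ax; have := AM (M + 1); rewrite ltrDl => /(_ ltr01 x Ax) /=.
  by move=> /le_lt_trans; apply; rewrite ltrD2l ltr1n.
apply: le_lt_trans (lebesgue_rV_box (const_mx (- (M + 2))) (const_mx (M + 2))).
apply: le_measure; rewrite ?inE//; first exact: measurable_box.
move=> x /AM xM i; rewrite !mxE -ltr_norml; apply: le_lt_trans xM.
exact: coord_le_norm.
Qed.

(** * Smooth bump functions *)

Section flat.
Variable R : realType.
Implicit Types (P : {poly R}) (x y : R).

(* P(1/x) exp(-1/x): a class of functions that is stable under derivation. *)
Definition flat P x := if 0 < x then P.[x^-1] * expR (- x^-1) else 0.

(** One term of the exponential series: y^(n+1) / (n+1)! is at most exp y. *)
Lemma pow_expRN_le n y : 0 < y -> y ^+ n * expR (- y) <= n.+1`!%:R / y.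
Proof.
move=> y0; rewrite expRN ler_pdivrMr ?expR_gt0// mulrAC ler_pdivlMr//.
rewrite -exprSr mulrC -ler_pdivrMr ?ltr0n ?fact_gt0//.
by apply: le_trans (expR_ge1Dxn n (ltW y0)); rewrite lerDr.
Qed.

(** Applied to [P * 'X], this shows that the difference quotient of [flat P] at 0 tends to 0. *)
Lemma flat_le P : exists2 C, 0 <= C & forall x, `|flat P x| <= C * `|x|.
Proof.
exists (\sum_(i < size P) `|P`_i| * i.+1`!%:R).
  by apply: sumr_ge0 => i _; rewrite mulr_ge0.
move=> x; rewrite /flat; case: ifP => x0; last first.
  by rewrite normr0 mulr_ge0// sumr_ge0// => i _; rewrite mulr_ge0.
rewrite normrM (ger0_norm (expR_ge0 _)) (ger0_norm (ltW x0)) horner_coef.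
apply: le_trans (ler_wpM2r (expR_ge0 _) (ler_norm_sum _ _ _)) _.
rewrite !mulr_suml; apply: ler_sum => i _.
rewrite normrM -!mulrA ler_wpM2l// normrX ger0_norm ?invr_ge0 ?(ltW x0)//.
by apply: le_trans (pow_expRN_le _ _) _; rewrite ?invr_gt0// invrK.
Qed.

(** With y = 1/x, the derivative in x of P(y) exp(-y) is y^2 (P(y) - P'(y)) exp(-y), which is again
    of the same form. *)
Lemma is_derive_flat P x : is_derive x 1 (flat P) (flat ('X^2 * (P - P^`())) x).
Proof.
have [x0|x0|->] := ltgtP x 0.
- rewrite [X in is_derive _ _ _ X]/flat ltNge (ltW x0)/=.
  apply: (near_eq_is_derive _ (is_derive_cst 0 x 1)).
  near=> y; rewrite /flat ifF//; apply/negbTE; rewrite -leNgt ltW//.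
  by near: y; exact: lt_nbhsl.
- rewrite [X in is_derive _ _ _ X]/flat x0.
  apply: (@near_eq_is_derive _ _ _ (fun y => P.[y^-1] * expR (- y^-1))).
    near=> y; rewrite /flat ifT//.
    by near: y; exact: lt_nbhsr.
  have x_neq0 : x != 0 by rewrite gt_eqF.
  have dV : is_derive x 1 (fun y : R => y^-1) (- x ^- 2).
    apply: DeriveDef; first exact: derivableV.
    by rewrite deriveV// derive_id [_ *: _]mulr1.
  have d1 := @is_derive1_comp _ (horner P) _ x _ _ (is_derive_poly P x^-1) dV.
  have dN : is_derive x 1 (fun y : R => - y^-1) (- - x ^- 2).
    exact: is_deriveN.
  have d2 := @is_derive1_comp _ expR _ x _ _ (is_derive_expR (- x^-1)) dN.
  apply: (is_derive_eq (is_deriveM d1 d2)).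
  rewrite /GRing.scale/= !hornerE/= exprVn; ring.
(* At the origin the difference quotient [flat P h / h] is [flat (P * 'X) h], bounded by a multiple
   of |h|. *)
have [C C0 HC] := flat_le (P * 'X).
have flat0 Q : flat Q 0 = 0 by rewrite /flat ltxx.
have Ch : C * `|h| @[h --> (0 : R)^'] --> (0 : R).
  have : C * `|h| @[h --> (0 : R)] --> C * `|0 : R|.
    by apply: cvgM; [exact: cvg_cst|apply: cvg_norm; exact: cvg_id].
  rewrite normr0 mulr0 => Ch.
  by apply: cvg_trans Ch; apply: cvg_app; exact: cvg_within.
have L : h^-1 *: ((flat P \o shift 0) (h *: (1 : R)) - flat P 0) @[h --> 0^'] --> (0 : R).
  apply: (@squeeze_cvgr _ _ _ _ (fun h => - (C * `|h|)) (fun h => C * `|h|)).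
  - near=> h; have h0 : h != 0 by near: h; exact: nbhs_dnbhs_neq.
    suff -> : h^-1 *: ((flat P \o shift 0) (h *: 1) - flat P 0) = flat (P * 'X) h.
      by rewrite -ler_norml HC.
    rewrite flat0 subr0/= addr0 [_ *: 1]mulr1 /flat; case: ifP => _.
      by rewrite /GRing.scale/= !hornerE/=; ring.
    by rewrite scaler0.
  - by have := cvgN Ch; rewrite oppr0; apply.
  - exact: Ch.
rewrite flat0; apply: DeriveDef; first by apply/cvg_ex; exists 0.
exact: cvg_lim L.
Unshelve. all: by end_near. Qed.

Lemma flat1_ge0 x : 0 <= flat 1 x.
Proof. by rewrite /flat; case: ifP => // _; rewrite hornerE mul1r expR_ge0. Qed.

Lemma flat1_le1 x : flat 1 x <= 1.
Proof.
rewrite /flat; case: ifP => // x0; rewrite hornerE mul1r expR_le1.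
by rewrite oppr_le0 invr_ge0 ltW.
Qed.

Lemma flat1_cvg x : (flat 1 (n.+1%:R * x)) @[n --> \oo] --> ((0 < x)%R%:R : R).
Proof.
case: ltP => x0 /=; last first.
  apply: cvg_near_cst; near=> n; rewrite /flat ifF//; apply/negbTE.
  by rewrite -leNgt pmulr_rle0.
under eq_fun do rewrite /flat pmulr_rgt0// x0 hornerE mul1r.
have H : expR (- (n.+1%:R^-1 * x^-1)) @[n --> \oo] --> expR (- (0 * x^-1)).
  apply: continuous_cvg; first exact: continuous_expR.
  by apply: cvgN; apply: cvgM; [exact: cvg_harmonic|exact: cvg_cst].
move: H; rewrite mul0r oppr0 expR0 => H.
by under eq_fun do rewrite invfM.
Unshelve. all: by end_near. Qed.

End flat.

Section Ck.
Variables (R : realType) (V : normedModType R).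
Implicit Types (phi psi : V -> R) (k : nat).

Lemma Ck_continuous k phi : Ck k phi -> continuous phi.
Proof. by case: k => [|k] []. Qed.

Lemma Ck_derivable k phi v x : Ck k.+1 phi -> derivable phi x v.
Proof. by case=> _ /(_ v)[]. Qed.

Lemma Ck_derive k phi v : Ck k.+1 phi -> Ck k ('D_v phi).
Proof. by case=> _ /(_ v)[]. Qed.

Lemma CkW k phi : Ck k.+1 phi -> Ck k phi.
Proof.
elim: k phi => [|k IH] phi [cphi dphi]; first by split.
by split => // v; have [? /IH] := dphi v.
Qed.

Lemma Ck_cst k (c : R) : Ck k (cst c : V -> R).
Proof.
elim: k c => [|k IH] c; split => //; try exact: cst_continuous.
move=> v; split; first by move=> x; exact: derivable_cst.
rewrite (_ : 'D_v _ = cst 0); first exact: IH.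
by apply/funext => x; rewrite derive_cst.
Qed.

Lemma CkD k phi psi : Ck k phi -> Ck k psi -> Ck k (phi + psi).
Proof.
elim: k phi psi => [|k IH] phi psi [cphi dphi] [cpsi dpsi]; split => //;
  try by (move=> x; exact: cvgD (cphi x) (cpsi x)).
move=> v; have [d1 k1] := dphi v; have [d2 k2] := dpsi v; split.
  by move=> x; exact: derivableD.
rewrite (_ : 'D_v (phi + psi) = 'D_v phi + 'D_v psi); first exact: IH.
by apply/funext => x; rewrite deriveD.
Qed.

Lemma CkM k phi psi : Ck k phi -> Ck k psi -> Ck k (phi * psi).
Proof.
elim: k phi psi => [|k IH] phi psi Cphi Cpsi; split;
  try by (move=> x; exact: cvgM (Ck_continuous Cphi (x:=x)) (Ck_continuous Cpsi (x:=x))).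
  by [].
move=> v; split.
  by move=> x; apply: derivableM; [exact: Ck_derivable Cphi|exact: Ck_derivable Cpsi].
rewrite (_ : 'D_v (phi * psi) = phi * 'D_v psi + psi * 'D_v phi).
  by apply: CkD; apply: IH; try exact: CkW; exact: Ck_derive.
by apply/funext => x; rewrite deriveM//; [exact: Ck_derivable Cphi|exact: Ck_derivable Cpsi].
Qed.

Lemma Ck_prod k (I : Type) (s : seq I) (F : I -> V -> R) :
  (forall i, Ck k (F i)) -> Ck k (fun x => \prod_(i <- s) F i x).
Proof.
move=> CF; elim: s => [|i s IH].
  by under eq_fun do rewrite big_nil; exact: Ck_cst.
by under eq_fun do rewrite big_cons; exact: CkM.
Qed.

End Ck.

Section test_function.
Variables (R : realType) (V : normedModType R) (U : set V).

Lemma test_functionP (c : R) (phi psi : V -> R) : test_function U phi ->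
  test_function U psi -> test_function U (c *: phi + psi).
Proof.
move=> [Cphi [K [cK KU K0]]] [Cpsi [L [cL LU L0]]]; split.
  move=> k; apply: CkD => //.
  rewrite (_ : c *: phi = cst c * phi); last exact/funext.
  by apply: CkM => //; exact: Ck_cst.
exists (K `|` L); split; [exact: compactU|by rewrite subUset|].
by move=> x /not_orP[Kx Lx]; rewrite !fctE K0// L0// scaler0 addr0.
Qed.

Lemma test_function0 : test_function U 0.
Proof.
split; first by move=> k; exact: Ck_cst.
by exists set0; split => //; exact: compact0.
Qed.

Lemma test_functionM (phi psi : V -> R) : test_function U phi ->
  test_function U psi -> test_function U (phi * psi).
Proof.
move=> [Cphi [K [cK KU K0]]] [Cpsi _]; split; first by move=> k; exact: CkM.
exists K; split => // x Kx; have -> : (phi * psi) x = phi x * psi x by [].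
by rewrite K0// mul0r.
Qed.

End test_function.

Section bump.
Variables (R : realType) (d : nat).
Local Notation E := 'rV[R]_d.

(** The induction on [k] is for all [P] at once, because differentiation changes the polynomial. *)
Lemma Ck_flat_affine k P c e i : Ck k (fun x : E => flat P (c * (x 0 i + e))).
Proof.
elim: k P => [|k IH] P.
  split => // x.
  apply: (@continuous_comp _ _ _ (fun x : E => c * (x 0 i + e)) (flat P)).
    move: x; suff cc : continuous (fun y : E => c * (y 0 i + e)) by [].
    move=> y; apply: (@continuousM R _ (fun=> c) (fun y : E => y 0 i + e) y); first exact: cst_continuous.
    by apply: (@continuousD _ _ _ (fun y : E => y 0 i) (fun=> e)); [exact: coord_continuous|exact: cst_continuous].
  apply: differentiable_continuous; apply/derivable1_diffP.
  exact: (@ex_derive _ _ _ _ _ _ _ (is_derive_flat P _)).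
split; first exact: Ck_continuous (IH P).
move=> v.
have D x : is_derive x v (fun x : E => flat P (c * (x 0 i + e)))
    (c * v 0 i * flat ('X^2 * (P - P^`())) (c * (x 0 i + e))).
  set y := c * (x 0 i + e).
  have dP : differentiable (flat P) y.
    by apply/derivable1_diffP; exact: (@ex_derive _ _ _ _ _ _ _ (is_derive_flat P y)).
  have dw : derivable (flat P) y (c * v 0 i) by exact: diff_derivable.
  have wE : 'D_(c * v 0 i) (flat P) y = c * v 0 i * flat ('X^2 * (P - P^`())) y.
    rewrite deriveE// -[X in 'd _ _ X]mulr1 linearZ/= -deriveE//.
    by rewrite (@derive_val _ _ _ _ _ _ _ (is_derive_flat P y)).
  (* The chain rule by hand: along [v], the argument of [flat P] moves by [h * (c * v 0 i)], so the
     two difference quotients coincide for every [h]. *)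
  have quot : (fun h : R => h^-1 *: ((flat P \o shift y) (h *: (c * v 0 i)) - flat P y)) =
    (fun h : R => h^-1 *: (((fun x : E => flat P (c * (x 0 i + e))) \o shift x) (h *: v) - flat P (c * (x 0 i + e)))).
    apply/funext => h /=; congr (_ *: (flat P _ - _)).
    by rewrite !mxE /y /GRing.scale/=; ring.
  apply: DeriveDef; first by move: dw; rewrite /derivable quot.
  by rewrite -wE /derive quot.
split; first by move=> x; exact: (@ex_derive _ _ _ _ _ _ _ (D x)).
rewrite (_ : 'D_v _ = cst (c * v 0 i) * (fun x : E => flat ('X^2 * (P - P^`())) (c * (x 0 i + e)))).
  by apply: CkM; [exact: Ck_cst|exact: IH].
by apply/funext => x; rewrite (@derive_val _ _ _ _ _ _ _ (D x)).
Qed.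

(** A smooth approximation of the indicator of the open box: it vanishes off the closed box for
    every [n], has values in [0, 1] and tends to the indicator pointwise as [n] grows. *)
Definition bump (a b : E) (n : nat) (x : E) : R :=
  \prod_(i < d) (flat 1 (n.+1%:R * (x 0 i - a 0 i)) *
                 flat 1 (n.+1%:R * (b 0 i - x 0 i))).

Lemma bump_ge0 a b n x : 0 <= bump a b n x.
Proof. by apply: prodr_ge0 => i _; rewrite mulr_ge0 ?flat1_ge0. Qed.

Lemma bump_le1 a b n x : bump a b n x <= 1.
Proof.
by apply: prodr_ile1 => i; rewrite mulr_ge0 ?flat1_ge0// mulr_ile1 ?flat1_ge0 ?flat1_le1.
Qed.

Lemma bump_cvg a b x : bump a b n x @[n --> \oo] --> (\1_(box a b) x : R).
Proof.
have -> : \1_(box a b) x = \prod_(i < d) ((0 < x 0 i - a 0 i)%R%:R * (0 < b 0 i - x 0 i)%R%:R) :> R.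
  rewrite indicE; have [/set_mem xab|/negP xab] := boolP (x \in box a b).
    by rewrite big1// => i _; rewrite !subr_gt0; have /andP[-> ->] := xab i; rewrite mulr1.
  have : ~ forall i, a 0 i < x 0 i < b 0 i by move=> H; apply: xab; exact: mem_set.
  move=> /existsNP[i /negP xi]; rewrite (bigD1 i)//= !subr_gt0.
  by move: xi; rewrite negb_and => /orP[|] /negbTE ->; rewrite mulr0n ?mulr0 !mul0r.
rewrite /bump; elim: (index_enum _) => [|i s IH].
  by rewrite big_nil; under eq_fun do rewrite big_nil; exact: cvg_cst.
rewrite big_cons; under eq_fun do rewrite big_cons.
by apply: cvgM => //; apply: cvgM; exact: flat1_cvg.
Qed.

Lemma test_function_bump (U : set E) a b n : cbox a b `<=` U ->
  test_function U (bump a b n).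
Proof.
move=> abU; split.
  move=> k.
  apply: (@Ck_prod _ _ _ _ _ (fun i x => _ * _)) => i; apply: CkM.
    exact: Ck_flat_affine.
  under eq_fun do rewrite -opprB mulrN -mulNr; exact: Ck_flat_affine.
exists (cbox a b); split => //; first exact: cbox_compact.
move=> x; rewrite /cbox/= => /existsNP[i /negP]; rewrite negb_and -!ltNge => xi.
rewrite /bump (bigD1 i)//=.
suff -> : flat 1 (n.+1%:R * (x 0 i - a 0 i)) * flat 1 (n.+1%:R * (b 0 i - x 0 i)) = 0 :> R.
  by rewrite mul0r.
rewrite /flat !pmulr_rgt0// !subr_gt0; case/orP: xi => /ltW; rewrite leNgt => /negbTE ->.
  by rewrite mul0r.
by rewrite mulr0.
Qed.

End bump.

(** * Density of test functions *)

Section density.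
Variables (R : realType) (d : nat) (Omega : set 'rV[R]_d).
Hypothesis oO : open Omega.
Hypothesis bO : bounded_set Omega.
Local Notation E := 'rV[R]_d.
Local Notation mu := (lebesgue_rV R d).
Local Notation ip := (ip Omega).
Local Notation L2 := (L2 Omega).
Implicit Types (f G u v : E -> R) (A : set E).

Let mO : measurable Omega. Proof. exact: open_measurable_rV. Qed.
Let foO : (mu Omega < +oo)%E. Proof. exact: lebesgue_rV_bounded. Qed.

Lemma eq_L2 u v : {in Omega, u =1 v} -> L2 u -> L2 v.
Proof.
move=> uv [mu_ iu]; split; first exact: eq_measurable_fun mu_.
by apply: eq_integrable iu => // x xO; rewrite uv.
Qed.

Lemma eq_ip u v u' v' : {in Omega, u =1 v} -> {in Omega, u' =1 v'} ->
  ip u u' = ip v v'.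
Proof. by move=> uv uv'; apply: eq_Rintegral => x xO; rewrite uv// uv'. Qed.

Lemma L2_of_bounded f c : measurable_fun Omega f ->
  (forall x, Omega x -> `|f x| <= c) -> L2 f.
Proof.
move=> mf fc; split => //.
apply: measurable_bounded_integrable => //; first exact: measurable_funX.
exists (c ^+ 2); split; first exact: num_real.
move=> y cy x Ox /=; apply: le_trans (ltW cy).
have c0 := le_trans (normr_ge0 _) (fc x Ox).
by rewrite normrX ler_pXn2r ?nnegrE// fc.
Qed.

Lemma test_function_bounded phi : test_function Omega phi ->
  exists c, forall x, `|phi x| <= c.
Proof.
move=> [Cphi [K [cK KO K0]]].
have [M [_ HM]] := compact_bounded (continuous_compact
  (continuous_subspaceT (Ck_continuous (Cphi 0%N))) cK).
exists (Num.max 0 (M + 1)) => x; have [Kx|Kx] := pselect (K x).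
  by rewrite le_max (HM (M + 1) _ (phi x)) ?orbT ?ltrDl//; exists x.
by rewrite K0// normr0 le_max lexx.
Qed.

Lemma test_function_L2 phi : test_function Omega phi -> L2 phi.
Proof.
move=> tphi; have [c phic] := test_function_bounded tphi.
apply: (@L2_of_bounded _ c) => //; apply: measurable_funTS.
by case: tphi => /(_ 0%N) /Ck_continuous/continuous_measurable_rV.
Qed.

Lemma L2_dominated (F : (E -> R)^nat) f g : L2 g ->
  (forall n, measurable_fun Omega (F n)) ->
  (forall n x, Omega x -> `|F n x| <= g x) ->
  (forall x, Omega x -> F n x @[n --> \oo] --> f x) ->
  L2 f /\ fnorm L2 (f - F n) @[n --> \oo] --> (0 : R).
Proof.
move=> Lg mF Fg Ff.
have mf : measurable_fun Omega f by exact: measurable_fun_cvg mF Ff.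
have fg x : Omega x -> `|f x| <= g x.
  move=> Ox; have /cvg_norm nf := Ff x Ox.
  rewrite -(cvg_lim _ nf)//; apply: limr_le; first by apply/cvg_ex; exists `|f x|.
  by apply: nearW => n; exact: Fg.
have Lf : L2 f.
  apply: (L2_bounded mO (c := 1) Lg mf ler01 _).1.
  by apply: aeW => x Ox; rewrite mul1r (le_trans (fg x Ox))// ler_norm.
split => //.
pose D n x := (f x - F n x) ^+ 2.
have mD n : measurable_fun Omega (EFin \o D n).
  by apply/measurable_EFinP/measurable_funX/measurable_funB.
have ig : mu.-integrable Omega (fun x => (4 * g x ^+ 2)%:E).
  by have := integrableZl mO 4 Lg.2.
have H1 : {ae mu, forall x, Omega x -> EFin (D n x) @[n --> \oo] --> (0 : \bar R)%E}.
  apply: aeW => x Ox; apply: cvg_EFin; first exact: nearW.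
  have : (f x - F n x) ^+ 2 @[n --> \oo] --> (f x - f x) ^+ 2.
    rewrite expr2; under eq_fun do rewrite expr2.
    by apply: cvgM; (apply: cvgB; [exact: cvg_cst|exact: Ff]).
  by rewrite subrr expr0n.
have H2 : {ae mu, forall x n, Omega x -> (`|(EFin \o D n) x| <= (4 * g x ^+ 2)%:E)%E}.
  apply: aeW => x n Ox; rewrite /= lee_fin ger0_norm ?sqr_ge0// /D.
  rewrite -(real_normK (num_real (f x - F n x))).
  have -> : 4 * g x ^+ 2 = (2 * g x) ^+ 2 by ring.
  have := le_trans (normr_ge0 _) (fg x Ox) => g0.
  rewrite ler_pXn2r ?nnegrE ?mulr_ge0// (le_trans (ler_normB _ _))//.
  by rewrite mulr_natl mulr2n lerD ?fg ?Fg.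
have [_ _ +] := dominated_convergence mO mD (measurable_cst _) H1 ig H2.
rewrite integral0 => /fine_cvg L.
have {}L : ip (f - F n) (f - F n) @[n --> \oo] --> (0 : R).
  rewrite (_ : (fun n => ip (f - F n) (f - F n)) =
    fine \o (fun n => \int[mu]_(x in Omega) (EFin \o D n) x)%E); first exact: L.
  by apply/funext => n; congr fine; apply: eq_integral => x _; rewrite /= /D expr2.
have : Num.sqrt (ip (f - F n) (f - F n)) @[n --> \oo] --> Num.sqrt (0 : R).
  by apply: continuous_cvg L; exact: sqrt_continuous.
by rewrite sqrtr0.
Qed.

(** The L^2 closure of the test functions. Density is proved by enlarging the functions known to lie
    in it: boxes, measurable sets, nonnegative functions, all of L^2. *)
Definition test_closure G := L2 G /\
  forall e, 0 < e -> exists2 phi, test_function Omega phi & fnorm L2 (G - phi) < e.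

Let SL2 := L2_seminormed mO.

Lemma test_closureP (a : R) u v : test_closure u -> test_closure v ->
  test_closure (a *: u + v).
Proof.
move=> [Lu Hu] [Lv Hv]; split; first exact: L2P.
move=> e e0.
(* Dividing the tolerance by [|a| + 1] instead of [|a|] covers [a = 0] as well. *)
have a1 : 0 < `|a| + 1 by rewrite ltr_wpDl.
have [phi tphi uphi] := Hu (e / 2 / (`|a| + 1)) (divr_gt0 (divr_gt0 e0 (ltr0Sn _ 1)) a1).
have [psi tpsi vpsi] := Hv (e / 2) (divr_gt0 e0 (ltr0Sn _ 1)).
exists (a *: phi + psi); first exact: test_functionP.
have Lup := smB SL2 Lu (test_function_L2 tphi).
have Lvp := smB SL2 Lv (test_function_L2 tpsi).
have -> : a *: u + v - (a *: phi + psi) = a *: (u - phi) + (v - psi).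
  by rewrite scalerBr opprD addrACA.
apply: le_lt_trans (seminormedD SL2 (smZ SL2 a Lup) Lvp) _.
rewrite (seminormedZ SL2)// [e]splitr ltr_leD ?(ltW vpsi)//.
move: uphi; rewrite ltr_pdivlMr// => uphi; apply: le_lt_trans uphi.
rewrite mulrC ler_wpM2l ?(seminormed_ge0 SL2)// lerDl//.
Qed.

Lemma test_closure_test phi : test_function Omega phi -> test_closure phi.
Proof.
move=> tphi; split; first exact: test_function_L2.
by move=> e e0; exists phi => //; rewrite subrr (sm_norm0 SL2).
Qed.

Lemma test_closure_sum (I : Type) (s : seq I) (c : I -> R) (F : I -> E -> R) :
  (forall i, test_closure (F i)) ->
  test_closure (fun x => \sum_(i <- s) c i * F i x).
Proof.
move=> HF; elim: s => [|i s IH].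
  under eq_fun do rewrite big_nil.
  by apply: test_closure_test; exact: test_function0.
by under eq_fun do rewrite big_cons; exact: test_closureP.
Qed.

Lemma test_closure_eq u v : {in Omega, u =1 v} -> test_closure u ->
  test_closure v.
Proof.
move=> uv [Lu Hu]; split; first exact: eq_L2 Lu.
move=> e /Hu[phi tphi uphi]; exists phi => //.
rewrite /fnorm/= (@eq_ip _ (u - phi) _ (u - phi))// => x xO;
by rewrite [LHS]/(v x - phi x) -uv.
Qed.

Lemma test_closure_lim G (F : (E -> R)^nat) : L2 G ->
  (forall n, test_closure (F n)) ->
  fnorm L2 (G - F n) @[n --> \oo] --> (0 : R) -> test_closure G.
Proof.
move=> LG HF GF; split => // e e0.
have e20 : 0 < e / 2 by rewrite divr_gt0.
have [n nGF] : exists n, fnorm L2 (G - F n) < e / 2.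
  have /cvgr_lt /(_ _ e20) [n _ /(_ n (leqnn n))] := GF; by exists n.
have [LF /(_ _ e20)[phi tphi Fphi]] := HF n.
exists phi => //.
apply: le_lt_trans (sm_normBB SL2 LG LF (test_function_L2 tphi)) _.
by rewrite [e]splitr ltrD.
Qed.

Lemma test_closure_dominated G (F : (E -> R)^nat) g : L2 g ->
  (forall n, test_closure (F n)) ->
  (forall n x, Omega x -> `|F n x| <= g x) ->
  (forall x, Omega x -> F n x @[n --> \oo] --> G x) -> test_closure G.
Proof.
move=> Lg HF Fg FG.
have [LG] := L2_dominated Lg (fun n => L2_meas (HF n).1) Fg FG.
exact: test_closure_lim.
Qed.

Lemma L2_cst (c : R) : L2 (cst c).
Proof. exact: (@L2_of_bounded _ `|c|). Qed.

Lemma test_closure_box a b : cbox a b `<=` Omega -> test_closure \1_(box a b).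
Proof.
move=> abO; apply: (@test_closure_dominated _ (bump a b) (cst 1)).
- exact: L2_cst.
- by move=> n; apply: test_closure_test; exact: test_function_bump.
- by move=> n x _; rewrite ger0_norm ?bump_ge0 ?bump_le1.
- by move=> x _; exact: bump_cvg.
Qed.

(** Partial sums of disjoint indicators are dominated by the constant 1, which is in L^2 because
    [Omega] has finite measure. *)
Lemma test_closure_bigcup (F : (set E)^nat) : trivIset setT F ->
  (forall n, test_closure \1_(F n)) -> test_closure \1_(\bigcup_n F n).
Proof.
move=> tF HF.
have H1 n x : \sum_(i < n) 1 * \1_(F i) x = \1_(\bigcup_(i in `I_n) F i) x :> R.
  rewrite [RHS]indicE; have [/set_mem[k /= kn Fk]|/negP nx] := boolP (_ \in _).
    rewrite (bigD1 (Ordinal kn))//= indicE mem_set// mul1r big1 ?addr0//.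
    move=> i ik; rewrite indicE memNset ?mulr0// => Fi.
    move/trivIsetP : tF => /(_ i k Logic.I Logic.I ik).
    by move/seteqP => [/(_ x (conj Fi Fk))].
  rewrite big1// => i _; rewrite indicE memNset ?mulr0// => Fi.
  by apply: nx; apply/mem_set; exists i => //=.
apply: (@test_closure_dominated _ (fun n x => \sum_(i < n) 1 * \1_(F i) x) (cst 1)).
- exact: L2_cst.
- by move=> n; exact: test_closure_sum.
- by move=> n x _; rewrite H1 indicE; case: (_ \in _); rewrite ?normr1 ?normr0.
- move=> x _; under eq_fun do rewrite H1.
  apply: cvg_near_cst; have [[k _ Fk]|nF] := pselect ((\bigcup_n F n) x).
    exists k.+1 => // n /= kn; rewrite !indicE !mem_set//; first by exists k.
    by exists k.
  apply: nearW => n; rewrite !indicE !memNset// => -[k _ Fk].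
  by apply: nF; exists k.
Qed.

(** Dynkin's theorem on the traces of sets on a fixed box. An orthant meets the box in a box,
    complements become differences with the box, and disjoint unions pass to the limit by dominated
    convergence. *)
Lemma test_closure_measurable_box A a b : measurable A ->
  cbox a b `<=` Omega -> test_closure \1_(A `&` box a b).
Proof.
move=> + abO; rewrite (measurable_rVE R d) => mA.
pose P A := test_closure \1_(A `&` box a b).
apply: (@dynkin_induction _ E (range (@orthant R d)) P) mA.
- exact: measurable_rVE.
- by move=> _ _ [u _ <-] [v _ <-]; rewrite orthantI; eexists.
- by rewrite /P setTI; exact: test_closure_box.
- move=> _ [u _ <-]; rewrite /P orthant_boxI; apply: test_closure_box => x xb.
  apply: abO => i; have := xb i; rewrite mxE ge_max => /andP[/andP[_ ->] ->].
  by [].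
- move=> S mS PS; rewrite /P.
  have := test_closureP (- 1) PS (test_closure_box abO).
  apply: test_closure_eq => x _; rewrite !fctE /GRing.scale/= mulN1r !indicE !in_setI in_setC.
  case: (x \in S); case: (x \in _) => /=; rewrite ?mulr0n ?mulr1n; lra.
- move=> F mF tF PF; rewrite /P setI_bigcupl.
  apply: test_closure_bigcup => //.
  by apply/trivIsetP => i j _ _ ij; rewrite setIACA; move/trivIsetP : tF => -> //; rewrite set0I.
Qed.

(** [Omega] is a countable union of admissible boxes; made disjoint, each piece lies in one box. *)
Lemma test_closure_measurable A : measurable A -> test_closure \1_A.
Proof.
move=> mA; have [F [OF HF]] := open_bigcup_box oO.
have mF n : measurable (F n).
  by case: (HF n) => [->//|[a [b [-> _]]]]; exact: measurable_box.
have H : test_closure \1_(\bigcup_n (A `&` seqDU F n)).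
  apply: test_closure_bigcup.
    have /trivIsetP tF := @trivIset_seqDU _ F.
    by apply/trivIsetP => i j _ _ ij; rewrite setIACA tF// setI0.
  move=> n; have [F0|[a [b [Fab abO]]]] := HF n.
    have -> : A `&` seqDU F n = set0.
      apply/seteqP; split=> // x [_ Fx]; have := subset_seqDU Fx; by rewrite F0.
    by rewrite indic0; apply: test_closure_test; exact: test_function0.
  rewrite -(setIidl (@subset_seqDU _ F n)) Fab setIA.
  apply: test_closure_measurable_box => //; apply: measurableI => //.
  exact: seqDU_measurable.
apply: test_closure_eq H => x /set_mem Ox; rewrite !indicE; congr (_%:R).
rewrite -setI_bigcupr -seqDU_bigcup_eq -OF in_setI.
by rewrite (mem_set Ox) andbT.
Qed.

Import HBSimple HBNNSimple.

(** The increasing approximation by simple functions is dominated by [G] itself. *)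
Lemma test_closure_ge0 G : L2 G -> (forall x, 0 <= G x) -> test_closure G.
Proof.
move=> LG G0.
have mG : measurable_fun Omega (EFin \o G) by apply/measurable_EFinP; case: LG.
have G0' x : Omega x -> (0 <= (EFin \o G) x)%E by rewrite lee_fin.
pose g := nnsfun_approx mO mG.
have gG x : Omega x -> g n x @[n --> \oo] --> G x.
  by move=> Ox; have /fine_cvgP[_] := cvg_nnsfun_approx mO mG G0' Ox; exact.
apply: (@test_closure_dominated _ g G) => //.
- move=> n; have /funext -> := fimfunEord (g n).
  apply: (test_closure_sum _ _ (F := fun i => _)) => i.
  apply: test_closure_measurable; exact: measurable_sfunP.
- move=> n x Ox; rewrite ger0_norm//.
  rewrite -(cvg_lim _ (gG x Ox))//; apply: nondecreasing_cvgn_le; last first.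
    by apply/cvg_ex; exists (G x); exact: gG.
  move=> i j ij; have /lefP := nd_nnsfun_approx mO mG ij; exact.
Qed.

Theorem test_function_dense G : L2 G -> test_closure G.
Proof.
move=> LG.
(* For [s = 1] and [s = -1] these are the positive and the negative part of [G]. *)
have H s : `|s| = 1 -> test_closure (fun x => Num.max (s * G x) 0).
  move=> s1; apply: test_closure_ge0; last by move=> x; rewrite le_max lexx orbT.
  apply: (L2_bounded mO (c := 1) LG _ ler01 _).1.
    apply: measurable_maxr => //; apply: measurable_funM => //; exact: L2_meas LG.
  apply: aeW => x _; rewrite mul1r -[X in _ <= X]mul1r -s1 -normrM.
  by case: (leP (s * G x) 0); rewrite ?normr0.
have := test_closureP (-1) (H (-1) _) (H 1 _).
rewrite normrN1 normr1 => /(_ erefl erefl); apply: test_closure_eq => x _.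
rewrite !fctE /GRing.scale/= !mulN1r !mul1r.
by case: (leP (G x) 0) => Gx; case: leP => Gx'; lra.
Qed.

End density.

(** * Integration by parts *)

Section cons.
Variables (R : realType) (d : nat).
Implicit Types (a : R) (y : 'rV[R]_d).

Lemma rV_cons0 a y : rV_cons (a, y) 0 0 = a.
Proof.
have -> : (0 : 'I_d.+1) = lshift d (0 : 'I_1) by exact: val_inj.
by rewrite [LHS](row_mxEl _ _ _ _) mxE.
Qed.

Lemma rV_consS a y j : rV_cons (a, y) 0 (lift 0 j) = y 0 j.
Proof.
have -> : lift 0 j = rshift 1 j by exact: val_inj.
exact: (row_mxEr _ _ _ _).
Qed.

Lemma rV_consP (x x' : 'rV[R]_d.+1) : x 0 0 = x' 0 0 ->
  (forall j, x 0 (lift 0 j) = x' 0 (lift 0 j)) -> x = x'.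
Proof. by move=> x0 xS; apply/rowP => i; case: (unliftP 0 i) => [j ->|->]. Qed.

Lemma rV_cons_shift0 h a y : rV_cons (h + a, y) = h *: delta_mx 0 0 + rV_cons (a, y).
Proof.
apply: rV_consP => [|j]; rewrite [RHS]mxE ?rV_cons0 ?rV_consS.
  by congr (_ + _); rewrite mxE mxE/= mulr1.
by rewrite !mxE/= mulr0 add0r.
Qed.

Lemma rV_cons_shiftS h a y j :
  rV_cons (a, h *: delta_mx 0 j + y) = h *: delta_mx 0 (lift 0 j) + rV_cons (a, y).
Proof.
apply: rV_consP => [|k]; rewrite [RHS]mxE ?rV_cons0 ?rV_consS.
  by rewrite !mxE/= mulr0 add0r.
by rewrite !mxE (inj_eq (@lift_inj _ _)).
Qed.

Lemma rV_norm_le n (x : 'rV[R]_n) e : 0 <= e ->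
  (forall i, `|x 0 i| <= e) -> `|x| <= e.
Proof.
move=> e0 xe; rewrite [leLHS]/Num.norm/= mx_normrE; apply/bigmax_leP; split => //.
by move=> [i j] _ /=; rewrite (ord1 i).
Qed.

Lemma rV_consB a b y z :
  `|rV_cons (a, y) - rV_cons (b, z)| <= Num.max `|a - b| `|y - z|.
Proof.
apply: rV_norm_le => [|i]; first by rewrite le_max normr_ge0.
rewrite mxE [X in _ + X]mxE le_max; case: (unliftP 0 i) => [j ->|->].
  rewrite !rV_consS; apply/orP; right.
  by have := coord_le_norm (y - z) j; rewrite !mxE.
by rewrite !rV_cons0 lexx.
Qed.

Lemma continuous_rV_consl y : continuous (fun a : R => rV_cons (a, y)).
Proof.
move=> a; apply/cvgrPdist_lt => e e0; near=> b.
apply: le_lt_trans (rV_consB _ _ _ _) _.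
rewrite subrr normr0 gt_max e0 andbT; near: b.
by apply/nbhs_normP; exists e.
Unshelve. all: by end_near. Qed.

Lemma continuous_rV_consr a : continuous (fun y : 'rV[R]_d => rV_cons (a, y)).
Proof.
move=> y; apply/(@cvgrPdist_lt _ _ _ (nbhs y) (nbhs_filter y)) => e e0.
apply: (filterS _ (nbhsx_ballx y e e0)) => z; rewrite -ball_normE /= => yz.
apply: le_lt_trans (rV_consB _ _ _ _) _.
by rewrite subrr normr0 gt_max e0.
Qed.

End cons.

Section partial.
Variable R : realType.

Lemma integrable_cpt_continuous d (g : 'rV[R]_d -> R) (N : R) : continuous g ->
  (forall x : 'rV_d, (exists j, N <= `|x 0 j|) -> g x = 0) ->
  (lebesgue_rV R d).-integrable setT (EFin \o g).
Proof.
move=> cg gN; pose B : set 'rV[R]_d := box (const_mx (- N)) (const_mx N).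
have -> : EFin \o g = (EFin \o g) \_ B.
  apply/funext => x; rewrite patchE; case: ifPn => // /negP xB /=.
  rewrite gN//; apply: contra_notP xB => /forallNP xN; apply/mem_set => i.
  by rewrite !mxE -ltr_norml ltNge; apply/negP; exact: xN.
have mB : measurable B by exact: measurable_box.
apply: (proj1 (integrable_mkcond _ mB)).
apply: measurable_bounded_integrable => //.
- exact: lebesgue_rV_box.
- by apply: measurable_funTS; exact: continuous_measurable_rV.
- have [M [Mr HM]] := compact_bounded (continuous_compact
    (continuous_subspaceT cg) (@cbox_compact R d (const_mx (- N)) (const_mx N))).
  exists M; split => // M' MM' x Bx; apply: (HM M' MM'); exists x => //.
  exact: box_cbox.
Qed.

(** Fubini and induction on the dimension. If [i] is a later coordinate, the first one is frozen and
    the induction hypothesis applies to the section; if [i] is the first, the inner integral is an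
    increment of [chi] between points where it vanishes. The support is bounded coordinatewise and
    [chi'] is a separate function so that sections satisfy the same hypotheses. *)
Lemma integral_partial_eq0 d (i : 'I_d) (N : R) (chi chi' : 'rV[R]_d -> R) :
  0 < N -> continuous chi' ->
  (forall x, is_derive x (delta_mx 0 i) chi (chi' x)) ->
  (forall x : 'rV_d, (exists j, N <= `|x 0 j|) -> chi x = 0 /\ chi' x = 0) ->
  (\int[lebesgue_rV R d]_x (chi' x)%:E = 0)%E.
Proof.
move=> N0; elim: d i chi chi' => [[]//|d IH] i chi chi' cchi' dchi chiN.
have ichi' : (lebesgue_rV R d.+1).-integrable setT (EFin \o chi').
  by apply: integrable_cpt_continuous cchi' _ => x /chiN[].
have mchi' := measurable_int _ ichi'.
pose nu := (@lebesgue_measure R \x lebesgue_rV R d)%E.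
pose F := (EFin \o chi') \o @rV_cons R d.
have mF : measurable_fun setT F.
  by apply: measurableT_comp => //; exact: measurable_rV_cons.
have iF : nu.-integrable setT F.
  apply/integrableP; split => //.
  case/integrableP : ichi' => _.
  rewrite -[X in (X < _)%E -> _]/(\int[pushforward nu (@rV_cons R d)]_x `|(EFin \o chi') x|)%E.
  rewrite ge0_integral_pushforward//; last exact: measurableT_comp.
have -> : (\int[lebesgue_rV R d.+1]_x (chi' x)%:E = \int[nu]_z F z)%E.
  rewrite -[LHS]/(\int[pushforward nu (@rV_cons R d)]_x (EFin \o chi') x)%E.
  by rewrite integral_pushforward.
case: (unliftP 0 i) => [j ij|i0].
  rewrite -integral12_prod_meas1//; apply: integral0_eq => a _.
  apply: (IH j (fun y => chi (rV_cons (a, y))) (fun y => chi' (rV_cons (a, y)))).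
  - move=> y; apply: continuous_comp; [exact: continuous_rV_consr|exact: cchi'].
  - move=> y; have := dchi (rV_cons (a, y)).
    by move=> [D E]; split; rewrite -?E /derivable /derive /=;
      under eq_fun do rewrite rV_cons_shiftS -ij.
  - move=> y [k yk]; apply: chiN; exists (lift 0 k); by rewrite rV_consS.
rewrite -integral21_prod_meas1//; apply: integral0_eq => y _.
rewrite /F /=.
pose G (a : R) : R := chi' (rV_cons (a, y)).
have G0 a : N <= `|a| -> G a = 0.
  by move=> Na; case: (chiN (rV_cons (a, y))) => //; exists 0; rewrite rV_cons0.
(* Outside [-N, N] the integrand vanishes; the fundamental theorem of calculus needs a bounded
   interval. *)
transitivity (\int[lebesgue_measure]_(a in `[(- N)%R, N]) (G a)%:E)%E.
  rewrite [RHS]integral_mkcond; apply: eq_integral => a _; rewrite patchE.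
  case: ifPn => // /negP aN; congr EFin; apply: G0.
  rewrite leNgt; apply: contra_notN aN.
  by move=> /ltW; rewrite ler_norml => aN; apply/mem_set; rewrite /= in_itv.
have dG (a : R) : is_derive a 1 (fun a : R => chi (rV_cons (a, y))) (G a).
  have := dchi (rV_cons (a, y)); rewrite i0.
  move=> [D E]; split; rewrite -?E /derivable /derive /=.
    by under eq_fun do rewrite [_ *: 1]mulr1 rV_cons_shift0.
  by under eq_fun do rewrite [_ *: 1]mulr1 rV_cons_shift0.
have cG : continuous G.
  by move=> a; apply: continuous_comp; [exact: continuous_rV_consl|exact: cchi'].
have cH : continuous (fun a : R => chi (rV_cons (a, y))).
  move=> a; apply: differentiable_continuous; apply/derivable1_diffP.
  exact: (@ex_derive _ _ _ _ _ _ _ (dG a)).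
rewrite (@continuous_FTC2 _ G (fun a : R => chi (rV_cons (a, y)))).
- have chi0 a : N <= `|a| -> chi (rV_cons (a, y)) = 0.
    by move=> Na; case: (chiN (rV_cons (a, y))) => //; exists 0; rewrite rV_cons0.
  by rewrite !chi0 ?normrN ?ger0_norm ?(ltW N0)// subee.
- by rewrite gt0_cp.
- exact: continuous_subspaceT.
- split => [a _||]; first exact: (@ex_derive _ _ _ _ _ _ _ (dG a)).
    exact/cvg_at_right_filter/cH.
  exact/cvg_at_left_filter/cH.
- by move=> a _; rewrite derive1E (@derive_val _ _ _ _ _ _ _ (dG a)).
Qed.

End partial.

(** * Sobolev spaces *)

Section sobolev.
Variables (R : realType) (d : nat) (Omega : set 'rV[R]_d).
Hypothesis oO : open Omega.
Hypothesis bO : bounded_set Omega.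
Local Notation E := 'rV[R]_d.
Local Notation mu := (lebesgue_rV R d).
Local Notation ip := (ip Omega).
Local Notation ipv := (ipv Omega).
Local Notation L2 := (L2 Omega).
Local Notation L2v := (L2v Omega).
Local Notation Linf := (Linf Omega).
Local Notation H1 := (H1 Omega).
Local Notation H10 := (H10 Omega).
Local Notation grad := (grad Omega).
Local Notation normv := (normv Omega).
Local Notation H1norm := (H1norm Omega).
Implicit Types (u v w phi psi : E -> R) (g k : E -> E).

Let mO : measurable Omega. Proof. exact: open_measurable_rV. Qed.
Let S2 := ip_semi_inner mO.
Let S2v := ipv_semi_inner mO.
Let test_L2 := test_function_L2 oO bO.

Lemma derive_out_compact phi (v x : E) (K : set E) : compact K ->
  (forall y, ~ K y -> phi y = 0) -> ~ K x -> 'D_v phi x = 0.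
Proof.
move=> cK K0 Kx; have oK : open (~` K) by apply: closed_openC; exact: compact_closed.
rewrite (@near_eq_derive _ _ _ phi (cst 0)) ?derive_cst//.
have : nbhs x (~` K) by exact: open_nbhs_nbhs.
by apply: filterS => y /K0.
Qed.

Lemma test_function_derive phi (v : E) : test_function Omega phi ->
  test_function Omega ('D_v phi).
Proof.
move=> [Cphi [K [cK KO K0]]]; split; first by move=> n; exact: Ck_derive (Cphi n.+1).
by exists K; split => // x; exact: derive_out_compact.
Qed.

(** The derivative is supported in a compact part of [Omega], so the integral is over the whole
    space and has no boundary term. *)
Lemma integral_test_derive phi i : test_function Omega phi ->
  \int[mu]_(x in Omega) ('D_(delta_mx 0 i) phi x) = 0.
Proof.
move=> tphi; have [Cphi [K [cK KO K0]]] := tphi.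
have [M [Mr KM]] := compact_bounded cK.
pose N := Num.max 0 M + 1.
have N0 : 0 < N by rewrite ltr_pwDr// le_max lexx.
have KN x : K x -> `|x| < N + 1.
  move=> Kx; have := KM N; rewrite ltr_pwDr// ?le_max ?lexx ?orbT// => /(_ isT x Kx).
  by move=> /= /le_lt_trans; apply; rewrite ltrDl.
have KN' (x : E) : (exists j, N + 1 <= `|x 0 j|) -> ~ K x.
  by move=> [j jN] /KN; rewrite ltNge (le_trans jN)// coord_le_norm.
have [CDphi [K' [_ K'O K'0]]] := test_function_derive (delta_mx 0 i) tphi.
rewrite Rintegral_mkcond.
have -> : ('D_(delta_mx 0 i) phi) \_ Omega = 'D_(delta_mx 0 i) phi.
  apply/funext => x; rewrite patchE; case: ifPn => // /negP xO.
  by rewrite K'0// => /K'O/mem_set.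
have N10 : 0 < N + 1 by rewrite addr_gt0.
have d1 x : is_derive x (delta_mx 0 i) phi ('D_(delta_mx 0 i) phi x).
  by apply: derivableP; exact: Ck_derivable (Cphi 1%N).
have z1 (x : E) : (exists j, N + 1 <= `|x 0 j|) ->
    phi x = 0 /\ 'D_(delta_mx 0 i) phi x = 0.
  move=> /KN' Kx; split; [exact: K0|exact: derive_out_compact Kx].
by rewrite /Rintegral (integral_partial_eq0 N10 (Ck_continuous (CDphi 0%N)) d1 z1).
Qed.

(** The product of two test functions is a test function, so the integral of its derivative
    vanishes; the product rule then gives integration by parts. *)
Lemma weak_gradient_test phi : test_function Omega phi ->
  weak_gradient Omega phi (gradient phi).
Proof.
move=> tphi.
have gE psi i : (fun x => gradient psi x 0 i) = 'D_(delta_mx 0 i) psi.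
  by apply/funext => x; rewrite mxE.
split.
  by move=> i; rewrite gE; apply: test_L2; exact: test_function_derive.
move=> i psi tpsi; apply/eqP; rewrite -addr_eq0 -RintegralD//; last 2 first.
- apply: L2_integrableM => //; first exact: test_L2.
  by rewrite gE; apply: test_L2; exact: test_function_derive.
- apply: L2_integrableM => //; last exact: test_L2.
  by rewrite gE; apply: test_L2; exact: test_function_derive.
apply/eqP; rewrite -[RHS](integral_test_derive i (test_functionM tphi tpsi)).
apply: eq_Rintegral => x _; rewrite !mxE deriveM.
- by rewrite /GRing.scale/=; ring.
- by case: tphi => /(_ 1%N) + _; exact: Ck_derivable.
- by case: tpsi => /(_ 1%N) + _; exact: Ck_derivable.
Qed.

(** For a test function [phi] within [e] of [w], |w|^2 = (w, w - phi) is at most |w| e. *)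
Lemma fundamental_lemma w : L2 w ->
  (forall phi, test_function Omega phi -> ip w phi = 0) -> fnorm L2 w = 0.
Proof.
move=> Lw w0; apply/eqP; rewrite eq_le (seminormed_ge0 (L2_seminormed mO)) andbT.
apply/ler_addgt0Pl => e e0; rewrite addr0.
have [_ /(_ e e0) [phi tphi wphi]] := test_function_dense oO bO Lw.
have Lphi := test_L2 tphi.
have [->|n0] := eqVneq (fnorm L2 w) 0; first exact: ltW.
have np : 0 < fnorm L2 w by rewrite lt_def n0 (seminormed_ge0 (L2_seminormed mO)).
rewrite -(ler_pM2l np) -expr2 (si_normsq S2)//.
rewrite -[leLHS]subr0 -(w0 _ tphi) -(siBr S2)//.
apply: le_trans (ler_norm _) (le_trans (si_CS S2 Lw (siB S2 Lw Lphi)) _).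
by rewrite ler_wpM2l// ltW.
Qed.

Lemma weak_gradient_uniq u g k : weak_gradient Omega u g ->
  weak_gradient Omega u k -> normv (g - k) = 0.
Proof.
move=> [Lg wg] [Lk wk].
have Lgk : L2v (g - k) by exact: (siB S2v Lg Lk).
rewrite /normv ipv_sum// big1 ?sqrtr0// => i _.
rewrite -(si_normsq S2)// (_ : Num.sqrt _ = 0) ?expr0n//.
apply: fundamental_lemma => // phi tphi.
have -> : (fun x => (g - k) x 0 i) = (fun x => g x 0 i) - (fun x => k x 0 i).
  by apply/funext => x; rewrite !fctE !mxE.
rewrite (siBl S2)//; last exact: test_L2.
by apply/eqP; rewrite subr_eq0 -eqr_opp; apply/eqP; rewrite -(wg i phi tphi) -(wk i phi tphi).
Qed.

Lemma weak_gradientP (a : R) u v g k : L2 u -> L2 v ->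
  weak_gradient Omega u g -> weak_gradient Omega v k ->
  weak_gradient Omega (a *: u + v) (a *: g + k).
Proof.
move=> Lu Lv [Lg wg] [Lk wk]; split; first exact: (semi_innerP S2v a Lg Lk).
move=> i phi tphi.
have Lphi := test_L2 tphi.
have LD : L2 (fun x => gradient phi x 0 i) by have [+ _] := weak_gradient_test tphi; apply.
have E1 : \int[mu]_(x in Omega) ((a *: u + v) x * gradient phi x 0 i) =
    a * ip u (fun x => gradient phi x 0 i) + ip v (fun x => gradient phi x 0 i).
  exact: (semi_innerPl S2).
have E2 : \int[mu]_(x in Omega) ((a *: g + k) x 0 i * phi x) =
    a * ip (fun x => g x 0 i) phi + ip (fun x => k x 0 i) phi.
  rewrite -(semi_innerPl S2)//; apply: eq_Rintegral => x _.
  by rewrite !fctE !mxE.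
rewrite E1 E2 opprD -mulrN; congr (_ * _ + _); [exact: wg|exact: wk].
Qed.

Lemma H1_L2 u : H1 u -> L2 u. Proof. by case. Qed.

Lemma H1_grad u : H1 u -> weak_gradient Omega u (grad u).
Proof. by move=> [_ ex]; exact: (xgetPex (fun=> 0) ex). Qed.

Lemma H1_gradL2 u : H1 u -> L2v (grad u).
Proof. by move=> /H1_grad[]. Qed.

Lemma H1P (a : R) u v : H1 u -> H1 v -> H1 (a *: u + v).
Proof.
move=> Hu Hv; split; first exact: (semi_innerP S2 a (H1_L2 Hu) (H1_L2 Hv)).
exists (a *: grad u + grad v).
by apply: weak_gradientP; [exact: H1_L2|exact: H1_L2|exact: H1_grad|exact: H1_grad].
Qed.

Lemma test_function_H1 phi : test_function Omega phi -> H1 phi.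
Proof.
by move=> tphi; split; [exact: test_L2|exists (gradient phi); exact: weak_gradient_test].
Qed.

(** [grad] is an arbitrary choice among weak gradients, hence linear only up to a field of norm
    zero. *)
Lemma gradP (a : R) u v : H1 u -> H1 v ->
  normv (grad (a *: u + v) - (a *: grad u + grad v)) = 0.
Proof.
move=> Hu Hv; apply: (@weak_gradient_uniq (a *: u + v)); first exact/H1_grad/H1P.
by apply: weak_gradientP; [exact: H1_L2|exact: H1_L2|exact: H1_grad|exact: H1_grad].
Qed.

Lemma ipv_gradP (a : R) u v k : H1 u -> H1 v -> L2v k ->
  ipv (grad (a *: u + v)) k = a * ipv (grad u) k + ipv (grad v) k.
Proof.
move=> Hu Hv Lk.
have Lau := semi_innerP S2v a (H1_gradL2 Hu) (H1_gradL2 Hv).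
rewrite -(semi_innerPl S2v)//; [|exact: H1_gradL2..].
by apply: (si_norm_eq0 S2v) => //; [exact/H1_gradL2/H1P|exact: gradP].
Qed.

Lemma H1_semi_inner :
  semi_inner H1 (fun u v => ip u v + ipv (grad u) (grad v)).
Proof.
split.
- by apply: test_function_H1; exact: test_function0.
- exact: H1P.
- by move=> u v; rewrite (semi_innerC S2) (semi_innerC S2v).
- move=> a u v w Hu Hv Hw; rewrite ipv_gradP//; last exact: H1_gradL2.
  rewrite (semi_innerPl S2) ?mulrDr; [|exact: H1_L2..].
  by rewrite addrACA.
- move=> u Hu; rewrite addr_ge0//.
    exact: (semi_inner_ge0 S2 (H1_L2 Hu)).
  exact: (semi_inner_ge0 S2v (H1_gradL2 Hu)).
Qed.

Lemma H1_seminormed : seminormed H1.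
Proof. exact: semi_inner_seminormed H1_semi_inner _. Qed.

Lemma H10_H1 u : H10 u -> H1 u. Proof. by case. Qed.

Lemma H10P (a : R) u v : H10 u -> H10 v -> H10 (a *: u + v).
Proof.
have S := H1_seminormed.
move=> [Hu Au] [Hv Av]; split; first exact: H1P.
move=> e e0.
have a1 : 0 < `|a| + 1 by rewrite ltr_wpDl.
have [phi tphi uphi] := Au (e / 2 / (`|a| + 1)) (divr_gt0 (divr_gt0 e0 (ltr0Sn _ 1)) a1).
have [psi tpsi vpsi] := Av (e / 2) (divr_gt0 e0 (ltr0Sn _ 1)).
exists (a *: phi + psi); first exact: test_functionP.
have Lup := smB S Hu (test_function_H1 tphi).
have Lvp := smB S Hv (test_function_H1 tpsi).
have -> : a *: u + v - (a *: phi + psi) = a *: (u - phi) + (v - psi).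
  by rewrite scalerBr opprD addrACA.
apply: le_lt_trans (seminormedD S (smZ S a Lup) Lvp) _.
rewrite (seminormedZ S)// [e]splitr ltr_leD ?(ltW vpsi)//.
move: uphi; rewrite ltr_pdivlMr// => uphi; apply: le_lt_trans uphi.
by rewrite mulrC ler_wpM2l ?(seminormed_ge0 S)// lerDl.
Qed.

Lemma H10_seminormed : seminormed H10.
Proof.
have S := H1_seminormed; split.
- split; first exact: seminormed0 S.
  move=> e e0; exists 0; first exact: test_function0.
  by rewrite subrr -[X in X < _]/(fnorm H1 0) (sm_norm0 S).
- exact: H10P.
- exact: seminormed_ge0 S.
- by move=> a u /H10_H1 Hu; exact: (seminormedZ S a Hu).
- by move=> u v /H10_H1 Hu /H10_H1 Hv; exact: (seminormedD S Hu Hv).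
Qed.

Lemma L2_le_H1norm u : H1 u -> fnorm L2 u <= H1norm u.
Proof.
move=> Hu; apply: ler_wsqrtr; rewrite lerDl.
exact: (semi_inner_ge0 S2v (H1_gradL2 Hu)).
Qed.

Lemma grad_le_H1norm u : H1 u -> normv (grad u) <= H1norm u.
Proof.
move=> Hu; apply: ler_wsqrtr; rewrite lerDr.
exact: (semi_inner_ge0 S2 (H1_L2 Hu)).
Qed.

Lemma H1norm_sqr u : H1 u ->
  H1norm u ^+ 2 = fnorm L2 u ^+ 2 + normv (grad u) ^+ 2.
Proof.
move=> Hu; rewrite (si_normsq H1_semi_inner)// (si_normsq S2) ?(si_normsq S2v)//.
  exact: H1_gradL2.
exact: H1_L2.
Qed.

(* Integrate by parts against a test function, then use density. *)
Lemma grad_weak_cvg (T : Type) (F : set_system T) (FF : Filter F)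
    (q : T -> E -> R) (q0 : E -> R) (M : R) (k : E -> E) :
  H1 q0 -> normv (grad q0) <= M -> L2v k ->
  (\forall t \near F, H1 (q t) /\ normv (grad (q t)) <= M) ->
  fnorm L2 (q t - q0) @[t --> F] --> (0 : R) ->
  ipv k (grad (q t)) @[t --> F] --> ipv k (grad q0).
Proof.
move=> H0 M0 Lk Hq qq0; apply/cvgrPdist_le => e e0.
have [M1 [M10 MM1]] : exists M1, 0 < M1 /\ M <= M1.
  by exists (Num.max M 1); rewrite lt_max ltr01 orbT le_max lexx.
have d1 : 0 < d.+1%:R :> R by rewrite ltr0n.
(* Each component gets two errors: [e1 * (2 * M1)], at most e / (2 (d + 1)), from replacing [k] by a
   test function, and a multiple of the L^2 distance of [q t] to [q0] after integration by parts.
   The successors in [d.+1] and [C + 1] keep the denominators positive. *)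
pose e1 := e / (4 * M1 * d.+1%:R).
have e10 : 0 < e1 by rewrite divr_gt0// mulr_gt0// mulr_gt0.
have H i : exists phi, test_function Omega phi /\ fnorm L2 ((fun x => k x 0 i) - phi) < e1.
  by have [_ /(_ _ e10)[phi]] := test_function_dense oO bO (Lk i); exists phi.
pose phi i := projT1 (cid (H i)).
have tphi i : test_function Omega (phi i) by rewrite /phi; case: cid => ? [].
have kphi i : fnorm L2 ((fun x => k x 0 i) - phi i) < e1 by rewrite /phi; case: cid => ? [].
pose D i x := gradient (phi i) x 0 i.
have LD i : L2 (D i) by have [+ _] := weak_gradient_test (tphi i); apply.
pose C := \sum_(i < d) fnorm L2 (D i).
have C0 : 0 <= C by apply: sumr_ge0 => i _; exact: (seminormed_ge0 (L2_seminormed mO)).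
have small : 0 < e / (2 * (C + 1)) by rewrite divr_gt0// mulr_gt0// ltr_wpDl.
have near_small : \forall t \near F, fnorm L2 (q t - q0) < e / (2 * (C + 1)).
  exact: cvgr_lt small.
near=> t.
have [Ht Mt] : H1 (q t) /\ normv (grad (q t)) <= M by near: t.
have qt : fnorm L2 (q t - q0) < e / (2 * (C + 1)) by near: t.
have Lw : L2v (grad q0 - grad (q t)).
  by apply: (siB S2v); exact: H1_gradL2.
have wM : normv (grad q0 - grad (q t)) <= 2 * M1.
  rewrite mulr_natl mulr2n.
  apply: le_trans (si_normD S2v (H1_gradL2 H0) (siN S2v (H1_gradL2 Ht))) _.
  apply: lerD; first exact: le_trans M0 MM1.
  rewrite -scaleN1r (si_normZ S2v); last exact: H1_gradL2.
  by rewrite normrN1 mul1r; exact: le_trans Mt MM1.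
rewrite -(siBr S2v)//; [|exact: H1_gradL2..].
pose w i (x : E) := (grad q0 - grad (q t)) x 0 i.
have Lwi i : L2 (w i) by exact: Lw.
rewrite ipv_sum//; apply: le_trans (ler_norm_sum _ _ _) _.
have bound i : `|ip (fun x => k x 0 i) (w i)| <= e / (2 * d.+1%:R) +
    fnorm L2 (D i) * (e / (2 * (C + 1))).
  have Lp := test_L2 (tphi i).
  have -> : ip (fun x => k x 0 i) (w i) =
      ip ((fun x => k x 0 i) - phi i) (w i) + ip (phi i) (w i).
    by rewrite (siBl S2)// subrK.
  apply: le_trans (ler_normD _ _) _; apply: lerD.
    apply: le_trans (si_CS S2 (siB S2 (Lk i) Lp) (Lwi i)) _.
    have -> : e / (2 * d.+1%:R) = e1 * (2 * M1) by rewrite /e1; field; rewrite !gt_eqF.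
    apply: ler_pM; rewrite ?sqrtr_ge0//; first exact/ltW/kphi.
    exact: le_trans (L2v_comp mO i Lw) wM.
  have -> : ip (phi i) (w i) = - ip (q0 - q t) (D i).
    rewrite (siBl S2)//; [|exact: H1_L2..].
    have [_ W0] := H1_grad H0; have [_ Wt] := H1_grad Ht.
    rewrite [ip q0 _](W0 i _ (tphi i)) [ip (q t) _](Wt i _ (tphi i)).
    rewrite (semi_innerC S2).
    have -> : w i = (fun x => grad q0 x 0 i) - (fun x => grad (q t) x 0 i).
      by apply/funext => x; rewrite /w !fctE !mxE.
    rewrite (siBl S2)//; [|exact: H1_gradL2..].
    by rewrite opprB opprK addrC.
  rewrite normrN mulrC; have Lq := siB S2 (H1_L2 H0) (H1_L2 Ht).
  apply: le_trans (si_CS S2 Lq (LD i)) _.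
  rewrite ler_wpM2r ?sqrtr_ge0//.
  rewrite -[leLHS]/(fnorm L2 (q0 - q t)) (sm_normC (L2_seminormed mO)) ?ltW//; exact: H1_L2.
apply: le_trans (ler_sum _ (fun i _ => bound i)) _.
rewrite big_split/= sumr_const card_ord -mulr_suml -/C.
have h1 : e / (2 * d.+1%:R) *+ d <= e / 2.
  rewrite -mulr_natr ler_pdivlMr//.
  have -> : e / (2 * d.+1%:R) * d%:R * 2 = e * (d%:R / d.+1%:R) by field; rewrite gt_eqF.
  by rewrite ler_piMr ?(ltW e0)// ler_pdivrMr// mul1r ler_nat.
have h2 : C * (e / (2 * (C + 1))) <= e / 2.
  have C1 : 0 < C + 1 by rewrite ltr_wpDl.
  have -> : C * (e / (2 * (C + 1))) = e / 2 * (C / (C + 1)) by field; rewrite gt_eqF.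
  by rewrite ler_piMr ?divr_ge0 ?(ltW e0)// ler_pdivrMr// mul1r lerDl.
by rewrite [leRHS]splitr; exact: lerD.
Unshelve. all: by end_near. Qed.

End sobolev.

(** * Calculus in the time variable *)

Lemma cvg_dist_le (R : realType) (T : Type) (F : set_system T) {FF : Filter F}
    (f g : T -> R) (l : R) :
  (\forall x \near F, `|f x - l| <= g x) -> g x @[x --> F] --> (0 : R) ->
  f x @[x --> F] --> l.
Proof.
move=> fg g0; apply/cvgrPdist_lt => e e0; near=> x.
rewrite distrC; apply: le_lt_trans (_ : g x < e); first by near: x.
by near: x; exact: cvgr_lt g0 _ e0.
Unshelve. all: by end_near. Qed.

Lemma cvg_sandwich0 (R : realType) (T : Type) (F : set_system T) {FF : Filter F}
    (f g : T -> R) :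
  (\forall x \near F, 0 <= f x <= g x) -> g x @[x --> F] --> (0 : R) ->
  f x @[x --> F] --> (0 : R).
Proof.
move=> fg; apply: cvg_dist_le; apply: filterS fg => x /andP[f0 fg].
by rewrite subr0 ger0_norm.
Qed.

Section cvg0.
Context {R : realType} {T : Type} {F : set_system T} {FF : Filter F}.
Implicit Types f g : T -> R.

Lemma cvg0Ml f g (l : R) : f x @[x --> F] --> (0 : R) ->
  g x @[x --> F] --> l -> f x * g x @[x --> F] --> (0 : R).
Proof. by move=> f0 gl; have := cvgM f0 gl; rewrite mul0r; apply. Qed.

Lemma cvg0Mr f (c : R) : f x @[x --> F] --> (0 : R) ->
  c * f x @[x --> F] --> (0 : R).
Proof.
by move=> f0; have := cvgM (cvg_cst c) f0; rewrite mulr0; apply.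
Qed.

Lemma cvg0D f g : f x @[x --> F] --> (0 : R) -> g x @[x --> F] --> (0 : R) ->
  f x + g x @[x --> F] --> (0 : R).
Proof. by move=> f0 g0; have := cvgD f0 g0; rewrite addr0; apply. Qed.

End cvg0.

Section time_calculus.
Variables (R : realType) (V : lmodType R) (X : fspace V) (T : R).
Hypothesis SX : seminormed X.
Implicit Types (u v : R -> V) (s t a b : R).
Local Notation N := (fnorm X).
Local Notation time t := (within `[0%R, T]%classic (nbhs (t : R))).

Lemma time_segment a b s : a \in `[0, T] -> b \in `[0, T] -> s \in `[a, b] ->
  s \in `[0, T].
Proof.
rewrite !in_itv/= => /andP[a0 _] /andP[_ bT'] /andP[sa sb].
by rewrite (le_trans a0 sa) (le_trans sb bT').
Qed.

Lemma near_time t : \forall s \near time t, s \in `[0, T].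
Proof. exact: withinT. Qed.

Lemma C0_in u t : C0 X T u -> t \in `[0, T] -> X (u t).
Proof. by move=> Cu /Cu[]. Qed.

Lemma C0_dist u t : C0 X T u -> t \in `[0, T] ->
  N (u s - u t) @[s --> time t] --> (0 : R).
Proof. by move=> Cu /Cu[]. Qed.

Lemma C0_norm_cvg u t : C0 X T u -> t \in `[0, T] ->
  N (u s) @[s --> time t] --> N (u t).
Proof.
move=> Cu tT; apply: cvg_dist_le (C0_dist Cu tT); near=> s.
apply: (sm_dist_norm SX); last exact: C0_in.
by apply: (C0_in Cu); near: s; exact: near_time.
Unshelve. all: by end_near. Qed.

Lemma C0_norm_bounded u : C0 X T u ->
  exists K, 0 < K /\ forall t, t \in `[0, T] -> N (u t) <= K.
Proof.
move=> Cu.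
have c : {within `[0, T], continuous (fun t => N (u t))}.
  by apply/subspace_continuousP => t tT; exact: C0_norm_cvg.
have [M [Mr HM]] := compact_bounded (continuous_compact c (@segment_compact R 0 T)).
exists (Num.max 0 M + 1); split; first by rewrite ltr_pwDr// le_max lexx.
move=> t tT; apply: le_trans (ler_norm _) _.
apply: (HM (Num.max 0 M + 1)); last by exists t.
by rewrite ltr_pwDr// le_max lexx orbT.
Qed.

Lemma tderive_near v t (w : V) e : (forall s, s \in `[0, T] -> X (v s)) ->
  t \in `[0, T] -> tderive X T v t w -> 0 < e ->
  exists2 r, 0 < r & forall s, s \in `[0, T] -> `|s - t| < r ->
    N (v s - v t - (s - t) *: w) <= e * `|s - t|.
Proof.
move=> Xv tT [Xw /cvgr0Pnorm_lt/(_ e)] + e0 => /(_ e0).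
rewrite /within/= !near_withinE => /nbhs_ballP[r /= r0 H].
exists r => // s sT sr; have [->|st] := eqVneq s t.
  by rewrite !subrr scale0r subr0 normr0 mulr0 (sm_norm0 SX).
have st0 : s - t != 0 by rewrite subr_eq0.
have /(_ _ st sT) := H s; rewrite /ball/= distrC => /(_ sr).
have Xd : X (v s - v t) by apply: (smB SX); exact: Xv.
have -> : v s - v t - (s - t) *: w = (s - t) *: ((s - t)^-1 *: (v s - v t) - w).
  by rewrite scalerBr scalerA divff// scale1r.
rewrite (seminormedZ SX); last by apply: (smB SX) => //; exact: (smZ SX).
rewrite ger0_norm ?(seminormed_ge0 SX)// mulrC => /ltW.
by move=> h; rewrite ler_wpM2r.
Qed.

(** Neither integration nor completeness of [X] enters: a derivative at every point of the interval
    suffices. The slack [e] in the slope is removed at the end. *)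
Lemma mean_value_le v (v' : R -> V) (K : R) a b :
  (forall s, s \in `[0, T] -> X (v s)) ->
  a \in `[0, T] -> b \in `[0, T] -> a <= b ->
  (forall t, t \in `[a, b] -> tderive X T v t (v' t)) ->
  (forall t, t \in `[a, b] -> N (v' t) <= K) ->
  N (v b - v a) <= K * (b - a).
Proof.
move=> Xv aT bT ab dv vK.
have abT s : s \in `[a, b] -> s \in `[0, T] := time_segment aT bT.
suff H e : 0 < e -> N (v b - v a) <= (K + e) * (b - a).
  apply/ler_addgt0Pr => e e0.
  have ba1 : 0 < b - a + 1 by rewrite ltr_wpDl// subr_ge0.
  apply: le_trans (H (e / (b - a + 1)) (divr_gt0 e0 ba1)) _.
  rewrite mulrDl lerD2l mulrAC -mulrA ler_piMr ?(ltW e0)//.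
  by rewrite ler_pdivrMr// mul1r lerDl.
move=> e0.
(* the largest time up to which the increment has slope at most [K + e] is [b] *)
pose S := [set s | s \in `[a, b] /\ N (v s - v a) <= (K + e) * (s - a)].
have Sa : S a.
  by split; rewrite ?in_itv/= ?lexx// !subrr mulr0 (sm_norm0 SX).
have hS : has_sup S.
  by split; [exists a|exists b => s [/= + _]; rewrite in_itv/= => /andP[]].
pose c := sup S.
have cab : c \in `[a, b].
  rewrite in_itv/= (ub_le_sup hS.2 Sa)/= ge_sup//; first by exists a.
  by move=> s [/= + _]; rewrite in_itv/= => /andP[].
have cT := abT c cab.
have [r r0 Hr] := tderive_near Xv cT (dv c cab) e0.
have step s : s \in `[a, b] -> `|s - c| < r -> N (v s - v c) <= (K + e) * `|s - c|.
  move=> sab sr; have sT := abT s sab; have := Hr s sT sr => h.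
  have Xd : X (v s - v c) by apply: (smB SX); exact: Xv.
  have Xw : X ((s - c) *: v' c) by apply: (smZ SX); exact: (dv c cab).1.
  rewrite -[v s - v c](subrK ((s - c) *: v' c)).
  apply: le_trans (seminormedD SX (smB SX Xd Xw) Xw) _.
  rewrite (seminormedZ SX); last exact: (dv c cab).1.
  have : `|s - c| * N (v' c) <= `|s - c| * K by rewrite ler_wpM2l// vK.
  by rewrite mulrDl; lra.
(* The supremum is attained: a point of [S] close to [c] transfers its bound through the derivative
   at [c]. *)
have Sc : S c.
  split => //; have [s Ss sc] := sup_adherent r0 hS.
  have [sab sK] := Ss.
  have sc' : s <= c by exact: (ub_le_sup hS.2 Ss).
  have scr : `|s - c| < r by rewrite distrC ger0_norm ?subr_ge0//; move: sc; rewrite -/c; lra.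
  apply: le_trans (sm_normBB SX (Xv c cT) (Xv s (abT s sab)) (Xv a aT)) _.
  rewrite (sm_normC SX (Xv c cT) (Xv s (abT s sab))).
  have := step s sab scr; rewrite distrC ger0_norm ?subr_ge0//; lra.
have [cb|bc] := ltP c b; last first.
  have /eqP bcE : b == c by rewrite eq_le bc/=; move: cab; rewrite in_itv/= => /andP[].
  by rewrite bcE; exact: Sc.2.
(* If [c < b], the derivative at [c] carries the bound beyond [c], against the choice of [c]. *)
pose s := Num.min b (c + r / 2).
have r20 : 0 < r / 2 by rewrite divr_gt0.
have cs : c < s by rewrite lt_min cb ltrDl.
have sab : s \in `[a, b].
  rewrite in_itv/= ge_min lexx/= andbT (le_trans _ (ltW cs))//.
  by move: cab; rewrite in_itv/= => /andP[].
have scr : `|s - c| < r.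
  rewrite ger0_norm ?subr_ge0 ?(ltW cs)// ltrBlDl gt_min; apply/orP; right.
  by rewrite ltrD2l ltr_pdivrMr// ltr_pMr// ltr1n.
have : S s.
  split => //.
  apply: le_trans (sm_normBB SX (Xv s (abT s sab)) (Xv c cT) (Xv a aT)) _.
  have := step s sab scr; rewrite ger0_norm ?subr_ge0 ?(ltW cs)//.
  have := Sc.2; lra.
by move=> /(ub_le_sup hS.2); rewrite leNgt cs.
Qed.

Lemma C1_increment u u' K a b : C1 X T u u' -> a \in `[0, T] -> b \in `[0, T] ->
  a <= b -> (forall t, t \in `[0, T] -> N (u' t) <= K) ->
  N (u b - u a) <= K * (b - a).
Proof.
move=> [Cu du Cu'] aT bT ab uK.
have abT s : s \in `[a, b] -> s \in `[0, T] := time_segment aT bT.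
apply: (@mean_value_le u u') => // [s|s /abT|s /abT]; [exact: C0_in|exact: du|exact: uK].
Qed.

(** The mean value inequality for [u s - s *: u' b], whose derivative [u' s - u' b] is at most
    [K * (b - a)]. *)
Lemma C2_backward_increment u u' u'' K a b : C2 X T u u' u'' ->
  a \in `[0, T] -> b \in `[0, T] -> a <= b ->
  (forall t, t \in `[0, T] -> N (u'' t) <= K) ->
  N (u b - u a - (b - a) *: u' b) <= K * (b - a) ^+ 2.
Proof.
move=> [C1u C1u'] aT bT ab uK; have [Cu du Cu'] := C1u.
have abT s : s \in `[a, b] -> s \in `[0, T] := time_segment aT bT.
have Xb : X (u' b) by exact: C0_in Cu' bT.
have K0 : 0 <= K by exact: le_trans (seminormed_ge0 SX _) (uK b bT).
have -> : u b - u a - (b - a) *: u' b = (u b - b *: u' b) - (u a - a *: u' b).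
  by rewrite scalerBl !opprB addrACA [RHS]addrACA; congr (_ + _); rewrite addrC.
rewrite expr2 mulrA.
apply: (@mean_value_le (fun s => u s - s *: u' b) (fun s => u' s - u' b)) => //.
- by move=> s sT; apply: (smB SX); [exact: C0_in sT|exact: (smZ SX)].
- move=> t tab; have tT := abT t tab; have [Xt dt] := du t tT.
  split; first by apply: (smB SX).
  apply: cvg_trans dt; apply: near_eq_cvg; near=> s.
  have st : s - t != 0 by rewrite subr_eq0; near: s; apply: cvg_within; exact: withinT.
  have -> : u s - s *: u' b - (u t - t *: u' b) = u s - u t - (s - t) *: u' b.
    by rewrite scalerBl !opprB addrACA [RHS]addrACA; congr (_ + _); rewrite addrC.
  by rewrite (scalerBr _ (u s - u t)) scalerA mulVf// scale1r opprB addrA subrK.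
- move=> t tab; have tT := abT t tab; rewrite (sm_normC SX (C0_in Cu' tT) Xb).
  move: (tab); rewrite in_itv/= => /andP[ta tb].
  apply: le_trans (C1_increment C1u' tT bT tb uK) _.
  by rewrite ler_wpM2l// lerD2l lerN2.
Unshelve. all: by end_near. Qed.

End time_calculus.

(** A null set contains no interval of positive length. Neighbourhoods relative to [0, T] make this
    valid at the end points, and the last node is [T]. *)
Lemma ae_time_dense (R : realType) (T : R) (P : R -> Prop) : 0 < T ->
  {ae @lebesgue_measure R, forall t, t \in `]0, T[ -> P t} ->
  forall t, t \in `[0, T] -> forall A, within `[0, T] (nbhs t) A ->
  exists s, [/\ s \in `]0, T[, P s & A s].
Proof.
move=> T0 [S [mS S0 PS]] t tT A /nbhs_ballP[e /= e0 eA].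
apply: contrapT => /forallNP nA.
pose a := Num.max 0 (t - e); pose b := Num.min T (t + e).
move: tT; rewrite in_itv/= => /andP[t0 tT].
have ab : a < b.
  by rewrite gt_max !lt_min T0/= (ltr_wpDl t0 e0)/= ; apply/andP; split; lra.
have abS : `]a, b[%classic `<=` S.
  move=> s /=; rewrite in_itv/= gt_max lt_min => /andP[/andP[s0 ts] /andP[sT st]].
  apply: PS => /= Ps; apply: (nA s); split; rewrite ?in_itv/= ?s0//.
    by apply: Ps; rewrite in_itv/= s0.
  apply: eA; last by rewrite in_itv/= !ltW.
  by rewrite /ball/= ltr_norml; apply/andP; split; lra.
have : (lebesgue_measure `]a, b[%classic <= (lebesgue_measure S : \bar R))%E.
  by apply: le_measure; rewrite ?inE.
by rewrite S0 lebesgue_measure_itv/= lte_fin ab leNgt -EFinD lte_fin subr_gt0 ab.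
Qed.

Lemma ae_time_lim0 (R : realType) (T : R) (P : R -> Prop) (F : R -> R) (l : R) t :
  0 < T -> {ae @lebesgue_measure R, forall t, t \in `]0, T[ -> P t} ->
  t \in `[0, T] -> (forall s, s \in `]0, T[ -> P s -> F s = 0) ->
  F s @[s --> within `[0, T] (nbhs t)] --> l -> l = 0.
Proof.
move=> T0 aeP tT F0 Fl; apply/eqP; apply: contraT => l0.
have /cvgrPdist_lt/(_ `|l|) := Fl; rewrite normr_gt0 => /(_ l0) H.
have [s [sT Ps]] := ae_time_dense T0 aeP tT H.
by rewrite /= F0// subr0 ltxx.
Qed.

(** * Continuity in time of the data and of the terms of the equation *)

Section inner_continuity.
Variables (R : realType) (V : lmodType R) (X : fspace V) (T : R) (B : V -> V -> R).
Hypothesis XB : semi_inner X B.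
Hypothesis XN : forall u, fnorm X u = Num.sqrt (B u u).
Local Notation N := (fnorm X).
Local Notation time t := (within `[0%R, T]%classic (nbhs (t : R))).

(** Weak-strong pairing: replacing [a s] by [a t] costs at most [N (a s - a t) * M], after which
    only the weak convergence of [b] against a fixed element is needed. *)
Lemma C0_inner_weak (a b : R -> V) (M : R) t : C0 X T a ->
  (forall s, s \in `[0, T] -> X (b s) /\ N (b s) <= M) -> t \in `[0, T] ->
  B (a t) (b s) @[s --> time t] --> B (a t) (b t) ->
  B (a s) (b s) @[s --> time t] --> B (a t) (b t).
Proof.
move=> Ca Hb tT weak.
have strong : B (a s) (b s) - B (a t) (b s) @[s --> time t] --> (0 : R).
  apply: (@cvg_dist_le _ _ _ _ _ (fun s => N (a s - a t) * M)); last first.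
    by apply: cvg0Ml (C0_dist Ca tT) (cvg_cst M).
  near=> s; have sT : s \in `[0, T] by near: s; exact: near_time.
  have [Xbs NM] := Hb s sT; have Xas := C0_in Ca sT; have Xat := C0_in Ca tT.
  rewrite subr0 -(siBl XB)//.
  apply: le_trans (si_CS XB (siB XB Xas Xat) Xbs) _.
  by rewrite -!XN ler_wpM2l// XN sqrtr_ge0.
have -> : (fun s => B (a s) (b s)) =
    (fun s => B (a s) (b s) - B (a t) (b s)) \+ (fun s => B (a t) (b s)).
  by apply/funext => s; rewrite /= subrK.
by have := cvgD strong weak; rewrite add0r; apply.
Unshelve. all: by end_near. Qed.

Lemma C0_inner (a b : R -> V) t : C0 X T a -> C0 X T b -> t \in `[0, T] ->
  B (a s) (b s) @[s --> time t] --> B (a t) (b t).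
Proof.
move=> Ca Cb tT; have SX := semi_inner_seminormed XB XN.
have [M [_ bM]] := C0_norm_bounded SX Cb.
apply: (@C0_inner_weak a b M) => //.
  by move=> s sT; split; [exact: C0_in Cb sT|exact: bM].
apply: (@cvg_dist_le _ _ _ _ _ (fun s => N (a t) * N (b s - b t))); last first.
  exact: cvg0Mr (C0_dist Cb tT).
near=> s; have sT : s \in `[0, T] by near: s; exact: near_time.
have Xat := C0_in Ca tT; have Xbs := C0_in Cb sT; have Xbt := C0_in Cb tT.
rewrite -(siBr XB)// !XN; exact: (si_CS XB Xat (siB XB Xbs Xbt)).
Unshelve. all: by end_near. Qed.

End inner_continuity.

Section data_continuity.
Variables (R : realType) (d : nat) (Omega : set 'rV[R]_d) (T : R).
Hypothesis oO : open Omega.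
Hypothesis bO : bounded_set Omega.
Local Notation E := 'rV[R]_d.
Local Notation mu := (lebesgue_rV R d).
Local Notation ip := (ip Omega).
Local Notation ipv := (ipv Omega).
Local Notation L2 := (L2 Omega).
Local Notation L2v := (L2v Omega).
Local Notation Linf := (Linf Omega).
Local Notation H1 := (H1 Omega).
Local Notation H10 := (H10 Omega).
Local Notation grad := (grad Omega).
Local Notation normv := (normv Omega).
Local Notation time t := (within `[0%R, T]%classic (nbhs (t : R))).

Let mO : measurable Omega. Proof. exact: open_measurable_rV. Qed.
Let S2 := ip_semi_inner mO.
Let S2v := ipv_semi_inner mO.
Let N2 := L2_seminormed mO.
Let Ninf := Linf_seminormed Omega.

Definition L2v_space : fspace (E -> E) := FSpace L2v normv.

Lemma L2v_seminormed : seminormed L2v_space.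
Proof. exact: (@semi_inner_seminormed _ _ L2v_space _ S2v). Qed.

Lemma Linf_L2_dist (a b u v : E -> R) : Linf a -> Linf b -> L2 u -> L2 v ->
  fnorm L2 (a \* u - b \* v) <=
  fnorm Linf (a - b) * fnorm L2 u + fnorm Linf b * fnorm L2 (u - v).
Proof.
move=> La Lb Lu Lv.
have -> : a \* u - b \* v = ((a - b) \* u) + (b \* (u - v)).
  apply/funext => x.
  by rewrite -[LHS]/(a x * u x - b x * v x) -[RHS]/((a x - b x) * u x + b x * (u x - v x)); ring.
have [L1 H1] := Linf_L2 mO (smB Ninf La Lb) Lu.
have [L2' H2] := Linf_L2 mO Lb (smB N2 Lu Lv).
by apply: le_trans (seminormedD N2 L1 L2') _; exact: lerD.
Qed.

Lemma Linf_L2v_dist (a b : E -> R) (g k : E -> E) :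
  Linf a -> Linf b -> L2v g -> L2v k ->
  normv (scalev a g - scalev b k) <=
  fnorm Linf (a - b) * normv g + fnorm Linf b * normv (g - k).
Proof.
move=> La Lb Lg Lk.
have -> : scalev a g - scalev b k = scalev (a - b) g + scalev b (g - k).
  apply/funext => x; rewrite -[LHS]/(a x *: g x - b x *: k x).
  rewrite -[RHS]/((a x - b x) *: g x + b x *: (g x - k x)).
  by rewrite scalerBl scalerBr addrA subrK.
have [L1 H1] := Linf_L2v mO (smB Ninf La Lb) Lg.
have [L2' H2] := Linf_L2v mO Lb (siB S2v Lg Lk).
by apply: le_trans (si_normD S2v L1 L2') _; exact: lerD.
Qed.

Lemma product_dist_cvg0 (Y : lmodType R) (X : fspace Y) (a : R -> E -> R)
    (u : R -> Y) t : seminormed X -> C0 Linf T a -> C0 X T u -> t \in `[0, T] ->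
  fnorm Linf (a s - a t) * fnorm X (u s) + fnorm Linf (a t) * fnorm X (u s - u t)
    @[s --> time t] --> (0 : R).
Proof.
move=> SX Ca Cu tT.
by apply: cvg0D; [exact: cvg0Ml (C0_dist Ca tT) (C0_norm_cvg SX Cu tT)
  |exact: cvg0Mr (C0_dist Cu tT)].
Qed.

Lemma C0_mul (a u : R -> E -> R) : C0 Linf T a -> C0 L2 T u ->
  C0 L2 T (fun t => a t \* u t).
Proof.
move=> Ca Cu t tT; split.
  exact: (Linf_L2 mO (C0_in Ca tT) (C0_in Cu tT)).1.
apply: (cvg_sandwich0 _ (product_dist_cvg0 N2 Ca Cu tT)).
near=> s; have sT : s \in `[0, T] by near: s; exact: near_time.
rewrite (seminormed_ge0 N2)/=.
by apply: Linf_L2_dist; [exact: C0_in sT|exact: C0_in tT|exact: C0_in sT|exact: C0_in tT].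
Unshelve. all: by end_near. Qed.

Lemma C0_scalev (a : R -> E -> R) (g : R -> E -> E) : C0 Linf T a ->
  C0 L2v_space T g -> C0 L2v_space T (fun t => scalev (a t) (g t)).
Proof.
move=> Ca Cg t tT; split.
  exact: (Linf_L2v mO (C0_in Ca tT) (C0_in Cg tT)).1.
apply: (cvg_sandwich0 _ (product_dist_cvg0 L2v_seminormed Ca Cg tT)).
near=> s; have sT : s \in `[0, T] by near: s; exact: near_time.
rewrite (seminormed_ge0 L2v_seminormed)/=.
by apply: Linf_L2v_dist; [exact: C0_in sT|exact: C0_in tT
  |exact: (C0_in Cg sT)|exact: (C0_in Cg tT)].
Unshelve. all: by end_near. Qed.

Lemma C0_H10_L2 (u : R -> E -> R) : C0 H10 T u -> C0 L2 T u.
Proof.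
move=> Cu t tT; have /H10_H1 Ht := C0_in Cu tT; split; first exact: H1_L2.
apply: (cvg_sandwich0 _ (C0_dist Cu tT)).
near=> s; have sT : s \in `[0, T] by near: s; exact: near_time.
have /H10_H1 Hs := C0_in Cu sT; rewrite (seminormed_ge0 N2)/=.
by apply: L2_le_H1norm => //; apply: (smB (H1_seminormed oO bO)).
Unshelve. all: by end_near. Qed.

Lemma gradB (u v : E -> R) : H1 u -> H1 v ->
  normv (grad u - grad v) = normv (grad (u - v)).
Proof.
move=> Hu Hv; have Huv : H1 (u - v) by exact: (smB (H1_seminormed oO bO)).
have := gradP oO bO (-1) Hv Hu; rewrite !scaleN1r ![- _ + _]addrC => g0.
have Lg := H1_gradL2 Hu; have Lh := H1_gradL2 Hv; have Lk := H1_gradL2 Huv.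
have Lgh := siB S2v Lg Lh.
apply/eqP; rewrite eq_le; apply/andP; split.
  have := sm_dist_norm L2v_seminormed Lk Lgh; rewrite /fnorm/= g0 normr_le0 subr_eq0.
  by move=> /eqP ->.
have := sm_dist_norm L2v_seminormed Lk Lgh; rewrite /fnorm/= g0 normr_le0 subr_eq0.
by move=> /eqP ->.
Qed.

Lemma C0_grad (u : R -> E -> R) : C0 H10 T u ->
  C0 L2v_space T (fun t => grad (u t)).
Proof.
move=> Cu t tT; have /H10_H1 Ht := C0_in Cu tT; split; first exact: H1_gradL2.
apply: (cvg_sandwich0 _ (C0_dist Cu tT)).
near=> s; have sT : s \in `[0, T] by near: s; exact: near_time.
have /H10_H1 Hs := C0_in Cu sT; rewrite (seminormed_ge0 L2v_seminormed)/=.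
rewrite [leLHS]gradB//.
by apply: grad_le_H1norm => //; apply: (smB (H1_seminormed oO bO)).
Unshelve. all: by end_near. Qed.

Section lipschitz.
Variables (f : R -> R) (Lf : R).
Hypothesis fL : forall a b, `|f a - f b| <= Lf * `|a - b|.

Lemma lipschitz_dist (u v : E -> R) : L2 u -> L2 v ->
  L2 ((f \o u) - (f \o v)) /\ fnorm L2 ((f \o u) - (f \o v)) <= `|Lf| * fnorm L2 (u - v).
Proof.
have cf : continuous f.
  move=> x; apply: (@cvg_dist_le _ _ _ _ _ (fun y => `|Lf| * `|y - x|)).
    apply: nearW => y; apply: le_trans (fL _ _) _.
    by rewrite ler_wpM2r// ler_norm.
  apply: cvg0Mr; have : `|y - x| @[y --> x] --> `|x - x|.
    by apply: cvg_norm; apply: cvgB; [exact: cvg_id|exact: cvg_cst].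
  by rewrite subrr normr0.
have mf w : L2 w -> measurable_fun Omega (f \o w).
  move=> /L2_meas mw; apply: measurableT_comp => //.
  exact: continuous_measurable_fun.
move=> Lu Lv; apply: L2_bounded => //.
- exact: (siB S2).
- by apply: measurable_funB; exact: mf.
- apply: aeW => x _; apply: le_trans (fL _ _) _.
  by rewrite ler_wpM2r// ler_norm.
Qed.

Lemma L2_lipschitz (u : E -> R) : L2 u -> L2 (f \o u).
Proof.
move=> Lu; have [L0 _] := lipschitz_dist Lu (L20 mO).
have := siD S2 L0 (L2_cst oO bO (f 0)).
by congr (L2 _); apply/funext => x; rewrite !fctE/= subrK.
Qed.

Lemma C0_lipschitz (u : R -> E -> R) : C0 L2 T u -> C0 L2 T (fun t => f \o u t).
Proof.
move=> Cu t tT; have Lt := C0_in Cu tT; split; first exact: L2_lipschitz.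
apply: (@cvg_sandwich0 _ _ _ _ _ (fun s => `|Lf| * fnorm L2 (u s - u t))); last first.
  exact: cvg0Mr (C0_dist Cu tT).
near=> s; have sT : s \in `[0, T] by near: s; exact: near_time.
rewrite (seminormed_ge0 N2)/=.
exact: (lipschitz_dist (C0_in Cu sT) Lt).2.
Unshelve. all: by end_near. Qed.

End lipschitz.

Section quotient.
Variables (rho : R -> E -> R) (omega : E -> R) (rho_0 : R).
Hypothesis Crho : C0 Linf T rho.
Hypothesis rho_00 : 0 < rho_0.
Hypothesis rho_ge : forall t, t \in `[0, T] ->
  {ae mu, forall x, Omega x -> rho_0 <= rho t x}.
Hypothesis Lomega : L2 omega.
Hypothesis Lq : forall t, t \in `[0, T] -> L2 (fdiv omega (rho t)).

Lemma quotient_norm_le t : t \in `[0, T] ->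
  fnorm L2 (fdiv omega (rho t)) <= rho_0^-1 * fnorm L2 omega.
Proof.
move=> tT; apply: (L2_bounded mO Lomega _ _ _).2.
- exact: L2_meas (Lq tT).
- by rewrite invr_ge0 ltW.
- apply: filterS (rho_ge tT) => x /[apply] rx.
  have rx0 : 0 < rho t x by exact: lt_le_trans rx.
  rewrite /fdiv normrM normfV (gtr0_norm rx0) mulrC ler_wpM2r//.
  by rewrite lef_pV2// ?posrE.
Qed.

(** The difference of two reciprocals of the density is at most rho_0^(-2) times the difference of
    the densities. Together with a uniform bound on the gradients, this gives the weak continuity of
    grad (omega / rho(t)). *)
Lemma C0_quotient : C0 L2 T (fun t => fdiv omega (rho t)).
Proof.
move=> t tT; split; first exact: Lq.
apply: (@cvg_sandwich0 _ _ _ _ _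
    (fun s => fnorm Linf (rho s - rho t) * (rho_0 ^- 2 * fnorm L2 omega))); last first.
  exact: cvg0Ml (C0_dist Crho tT) (cvg_cst _).
near=> s; have sT : s \in `[0, T] by near: s; exact: near_time.
rewrite (seminormed_ge0 N2)/= mulrA.
have Ld := smB Ninf (C0_in Crho sT) (C0_in Crho tT).
apply: (L2_bounded mO Lomega _ _ _).2.
- apply: measurable_funB; exact: L2_meas (Lq _).
- by rewrite mulr_ge0 ?invr_ge0 ?sqr_ge0// Linf_norm_ge0.
- apply: filterS3 (rho_ge tT) (rho_ge sT) (Linf_ae Ld) => x H1 H2 H3 Ox.
  have rt := H1 Ox; have rs := H2 Ox; have dr := H3 Ox.
  have rt0 : 0 < rho t x by exact: lt_le_trans rt.
  have rs0 : 0 < rho s x by exact: lt_le_trans rs.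
  have -> : (fdiv omega (rho s) - fdiv omega (rho t)) x =
      - ((rho s - rho t) x) * (rho s x * rho t x)^-1 * omega x.
    by rewrite !fctE /fdiv; field; rewrite !gt_eqF.
  rewrite !normrM ler_wpM2r// normrN ler_pM// normfV gtr0_norm ?mulr_gt0//.
  by rewrite lef_pV2 ?posrE ?exprn_gt0 ?mulr_gt0// expr2 ler_pM// ltW.
Unshelve. all: by end_near. Qed.

End quotient.

Lemma tderive_mul (rho rho' u u' : R -> E -> R) t : C1 Linf T rho rho' ->
  C0 H10 T u -> H10 (u' t) -> tderive H10 T u t (u' t) -> t \in `[0, T] ->
  tderive L2 T (fun s => rho s \* u s) t (rho' t \* u t + rho t \* u' t).
Proof.
move=> [Crho drho Crho'] Cu Hu' du tT.
have Cu2 := C0_H10_L2 Cu.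
have Lr := C0_in Crho tT; have Lr' := C0_in Crho' tT.
have Lu := C0_in Cu2 tT; have Lu' := H1_L2 (H10_H1 Hu').
have L1 := (Linf_L2 mO Lr' Lu).1; have L2' := (Linf_L2 mO Lr Lu').1.
split; first exact: (siD S2).
have dwithin : within `[0, T]%classic (dnbhs t) `=>` time t.
  by move=> A tA; exact: (@cvg_within _ (nbhs t) _ _ _ tA).
(* The three errors of the product rule: difference quotient of [rho], continuity of [u], difference
   quotient of [u]. *)
pose b s := fnorm Linf ((s - t)^-1 *: (rho s - rho t) - rho' t) * fnorm L2 (u s)
  + fnorm Linf (rho' t) * fnorm L2 (u s - u t)
  + fnorm Linf (rho t) * fnorm H10 ((s - t)^-1 *: (u s - u t) - u' t).
have b0 : b s @[s --> within `[0, T]%classic (dnbhs t)] --> (0 : R).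
  apply: cvg0D; [apply: cvg0D|].
  - apply: cvg0Ml; first exact: (drho t tT).2.
    by apply: cvg_trans (C0_norm_cvg N2 Cu2 tT); exact: cvg_app.
  - apply: cvg0Mr.
    by apply: cvg_trans (C0_dist Cu2 tT); exact: cvg_app.
  - by apply: cvg0Mr; exact: du.2.
apply: cvg_sandwich0 b0.
near=> s; have sT : s \in `[0, T] by near: s; exact: withinT.
rewrite (seminormed_ge0 N2)/=.
have Lrs := C0_in Crho sT; have Lus := C0_in Cu2 sT.
have Hus := C0_in Cu sT; have Hut := C0_in Cu tT.
set r := (s - t)^-1.
have -> : r *: (rho s \* u s - rho t \* u t) - (rho' t \* u t + rho t \* u' t) =
   ((r *: (rho s - rho t) - rho' t) \* u s) + (rho' t \* (u s - u t))
   + (rho t \* (r *: (u s - u t) - u' t)).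
  apply/funext => x.
  rewrite -[LHS]/(r * (rho s x * u s x - rho t x * u t x) -
    (rho' t x * u t x + rho t x * u' t x)).
  rewrite -[RHS]/((r * (rho s x - rho t x) - rho' t x) * u s x +
    rho' t x * (u s x - u t x) + rho t x * (r * (u s x - u t x) - u' t x)).
  by ring.
have SH := H1_seminormed oO bO.
have Hd : H1 (r *: (u s - u t) - u' t).
  by apply: (smB SH); [apply: (smZ SH); apply: (smB SH)|]; exact: H10_H1.
have [La Ha] := Linf_L2 mO (smB Ninf (smZ Ninf r (smB Ninf Lrs Lr)) Lr') Lus.
have [Lb Hb] := Linf_L2 mO Lr' (smB N2 Lus Lu).
have [Lc Hc] := Linf_L2 mO Lr (H1_L2 Hd).
apply: le_trans (seminormedD N2 (smD N2 La Lb) Lc) _.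
apply: lerD.
  by apply: le_trans (seminormedD N2 La Lb) _; exact: lerD.
apply: le_trans Hc _; rewrite ler_wpM2l ?Linf_norm_ge0//.
exact: L2_le_H1norm.
Unshelve. all: by end_near. Qed.

(** Identifies the derivative of rho u supplied by the weak formulation with the one computed by the
    product rule. *)
Lemma tderive_uniq (Y : lmodType R) (X : fspace Y) (v : R -> Y) t (w w' : Y) :
  seminormed X -> t \in `]0, T[ -> (forall s, s \in `[0, T] -> X (v s)) ->
  tderive X T v t w -> tderive X T v t w' -> fnorm X (w - w') = 0.
Proof.
move=> SX tT Xv dw dw'.
have Xw := dw.1; have Xw' := dw'.1.
have tT' : t \in `[0, T] by move: tT; rewrite !in_itv/= => /andP[/ltW -> /ltW ->].
apply/eqP; rewrite eq_le (seminormed_ge0 SX) andbT.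
apply/ler_addgt0Pr => e e0; rewrite add0r.
have e20 : 0 < e / 2 by rewrite divr_gt0.
have [r r0 Hr] := tderive_near SX Xv tT' dw e20.
have [r' r'0 Hr'] := tderive_near SX Xv tT' dw' e20.
(* A common increment to the right of [t], inside [0, T] and small enough for both linear
   approximations. *)
pose k := Num.min (T - t) (Num.min (r / 2) (r' / 2)).
have [t0 tlT] : 0 < t /\ t < T by move: tT; rewrite in_itv/= => /andP[].
have k0 : 0 < k by rewrite !lt_min subr_gt0 tlT !divr_gt0.
have sT : t + k \in `[0, T].
  have kT : k <= T - t by rewrite ge_min lexx.
  by rewrite in_itv/=; apply/andP; split; lra.
have kE : t + k - t = k by rewrite addrC addKr.
have kr : `|t + k - t| < r.
  rewrite kE gtr0_norm// !gt_min; apply/orP; right; apply/orP; left; lra.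
have kr' : `|t + k - t| < r'.
  rewrite kE gtr0_norm// !gt_min; apply/orP; right; apply/orP; right; lra.
have := Hr _ sT kr; have := Hr' _ sT kr'; rewrite kE (gtr0_norm k0).
have Xd : X (v (t + k) - v t) by apply: (smB SX); exact: Xv.
move: Xd; set D := _ - _ => Xd h1 h2.
have X1 : X (D - k *: w') by apply: (smB SX) => //; exact: (smZ SX).
have X2 : X (D - k *: w) by apply: (smB SX) => //; exact: (smZ SX).
rewrite -(ler_pM2l k0) -[X in X * fnorm _ _](gtr0_norm k0) -(seminormedZ SX); last exact: (smB SX).
have -> : k *: (w - w') = (D - k *: w') - (D - k *: w).
  by rewrite scalerBr opprB [RHS]addrC addrA subrK.
apply: le_trans (sm_normB SX X1 X2) _; lra.
Qed.

End data_continuity.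

Lemma C0_cst (R : realType) (V : lmodType R) (X : fspace V) (T : R) (v : V) :
  seminormed X -> X v -> C0 X T (fun=> v).
Proof.
move=> SX Xv t tT; split => //.
by under eq_fun do rewrite subrr (sm_norm0 SX); exact: cvg_cst.
Qed.

Lemma C0_add (R : realType) (V : lmodType R) (X : fspace V) (T : R) (u v : R -> V) :
  seminormed X -> C0 X T u -> C0 X T v -> C0 X T (fun t => u t + v t).
Proof.
move=> SX Cu Cv t tT; have Xu := C0_in Cu tT; have Xv := C0_in Cv tT.
split; first exact: (smD SX).
apply: cvg_sandwich0 (cvg0D (C0_dist Cu tT) (C0_dist Cv tT)).
near=> s; have sT : s \in `[0, T] by near: s; exact: near_time.
rewrite (seminormed_ge0 SX)/= opprD addrACA.
by apply: (seminormedD SX); apply: (smB SX) => //; [exact: C0_in Cu sT|exact: C0_in Cv sT].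
Unshelve. all: by end_near. Qed.

Lemma C0_Rspace (R : realType) (T : R) (m : R -> R) t : C0 (Rspace R) T m ->
  t \in `[0, T] -> m s @[s --> within `[0, T] (nbhs t)] --> m t.
Proof.
move=> Cm tT; apply: cvg_dist_le (C0_dist Cm tT).
by apply: nearW => s.
Qed.

Section problem.
Variables (R : realType) (d : nat) (Omega : set 'rV[R]_d) (T : R).
Hypothesis oO : open Omega.
Hypothesis bO : bounded_set Omega.
Local Notation E := 'rV[R]_d.
Local Notation mu := (lebesgue_rV R d).
Local Notation ip := (ip Omega).
Local Notation ipv := (ipv Omega).
Local Notation L2 := (L2 Omega).
Local Notation L2v := (L2v Omega).
Local Notation Linf := (Linf Omega).
Local Notation H1 := (H1 Omega).
Local Notation H10 := (H10 Omega).
Local Notation grad := (grad Omega).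
Local Notation normv := (normv Omega).
Local Notation time t := (within `[0%R, T]%classic (nbhs (t : R))).

Let mO : measurable Omega. Proof. exact: open_measurable_rV. Qed.
Let S2 := ip_semi_inner mO.
Let S2v := ipv_semi_inner mO.
Let N2 := L2_seminormed mO.
Let Ninf := Linf_seminormed Omega.
Let NH1 := H1_seminormed oO bO.
Let NH10 := H10_seminormed oO bO.

Lemma fdiv_mul (omega r rho : E -> R) :
  fdiv (omega \* r) rho = r \* fdiv omega rho.
Proof. by apply/funext => x; rewrite /fdiv/= mulrAC mulrC. Qed.

Section everywhere.
Variables (rho rho' eta kappa p u u' : R -> E -> R) (omega : E -> R).
Variables (f m' wbar h : R -> R) (rho_0 Lf M : R).
Let q t := fdiv omega (rho t).
Hypothesis T0 : 0 < T.
Hypothesis C1rho : C1 Linf T rho rho'.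
Hypothesis rho_00 : 0 < rho_0.
Hypothesis rho_ge : forall t, t \in `[0, T] ->
  {ae mu, forall x, Omega x -> rho_0 <= rho t x}.
Hypothesis Ceta : C0 Linf T eta.
Hypothesis Ckappa : C0 Linf T kappa.
Hypothesis fL : forall a b, `|f a - f b| <= Lf * `|a - b|.
Hypothesis Lomega : L2 omega.
Hypothesis Cp : C0 L2 T p.
Hypothesis Cwbar : {within `[0, T], continuous wbar}.
Hypothesis wbar0 : forall t, t \in `[0, T] -> wbar t != 0.
Hypothesis H1q : forall t, t \in `[0, T] -> H1 (q t) /\ normv (grad (q t)) <= M.
Hypothesis Cm' : C0 (Rspace R) T m'.
Hypothesis C1u : C1 H10 T u u'.
Hypothesis Cu' : C0 H10 T u'.

Let hs t := source Omega f omega (wbar t) (m' t) (rho t) (rho' t)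
             (eta t) (kappa t) (u' t) (u t).

Let Crho : C0 Linf T rho. Proof. by case: C1rho. Qed.
Let Crho' : C0 Linf T rho'. Proof. by case: C1rho. Qed.
Let Cu : C0 H10 T u. Proof. by case: C1u. Qed.
Let Cu2 : C0 L2 T u. Proof. exact: C0_H10_L2. Qed.
Let Cq : C0 L2 T q.
Proof.
by apply: (C0_quotient oO Crho rho_00 rho_ge Lomega) => t /H1q[/H1_L2].
Qed.

(** The two terms with [grad (q s)] pair a strongly continuous field with a bounded, weakly
    continuous one; all the others are products of strongly continuous factors. *)
Lemma source_cvg t : t \in `[0, T] -> hs s @[s --> time t] --> hs t.
Proof.
move=> tT; rewrite /hs /source.
have [Hqt Mt] := H1q tT.
have ipC (a b : R -> E -> R) : C0 L2 T a -> C0 L2 T b ->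
    ip (a s) (b s) @[s --> time t] --> ip (a t) (b t).
  by move=> Ca Cb; exact: (@C0_inner R _ L2 T ip S2 (fun=> erefl) a b t Ca Cb tT).
have weak k : L2v k -> ipv k (grad (q s)) @[s --> time t] --> ipv k (grad (q t)).
  move=> Lk; apply: (@grad_weak_cvg _ _ _ oO bO _ _ _ _ _ M) => //; last exact: C0_dist.
  near=> s; apply: H1q; near: s; exact: near_time.
have ipvq (g : R -> E -> E) : C0 (L2v_space Omega) T g ->
    ipv (g s) (grad (q s)) @[s --> time t] --> ipv (g t) (grad (q t)).
  move=> Cg.
  have Lq s : s \in `[0, T] -> L2v_space Omega (grad (q s)) /\
      fnorm (L2v_space Omega) (grad (q s)) <= M.
    by move=> sT; have [Hs Ms] := H1q sT; split => //; exact: H1_gradL2.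
  exact: (@C0_inner_weak R _ (L2v_space Omega) T ipv S2v (fun=> erefl) g
    (fun s => grad (q s)) M t Cg Lq tT (weak _ (C0_in Cg tT))).
apply: cvgM.
  apply: cvgV; first exact: wbar0.
  by move/subspace_continuousP : Cwbar; apply.
apply: cvgB; last first.
  exact: (ipC _ _ (C0_lipschitz oO bO fL Cu2) Cq).
apply: cvgD; last first.
  exact: (ipvq _ (C0_scalev oO Ckappa (C0_grad oO bO Cu))).
apply: cvgD; last first.
  exact: (ipvq _ (C0_scalev oO Ceta (C0_grad oO bO Cu'))).
apply: cvgD; first exact: C0_Rspace.
under eq_fun do rewrite fdiv_mul; rewrite fdiv_mul.
exact: (ipC _ _ Cu2 (C0_mul oO Crho' Cq)).
Unshelve. all: by end_near. Qed.

(** For a fixed [phi] the residual [F] is continuous in time and vanishes on a dense set of times.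
    The exceptional null set does not depend on [phi]. *)
Lemma equation_everywhere :
  {ae @lebesgue_measure R, forall t, t \in `]0, T[ ->
     exists2 w, tderive L2 T (fun s => rho s \* u s) t w &
       variational Omega (eta t) (kappa t) w (u' t) (u t)
         (h t) (p t) (f \o u t)} ->
  (forall t, t \in `[0, T] -> h t = hs t) ->
  forall t, t \in `[0, T] ->
  variational Omega (eta t) (kappa t) (rho' t \* u t + rho t \* u' t)
    (u' t) (u t) (h t) (p t) (f \o u t).
Proof.
move=> aeq hE t tT phi Hphi.
have Lphi := H1_L2 (H10_H1 Hphi); have Lgphi := H1_gradL2 (H10_H1 Hphi).
pose w s := rho' s \* u s + rho s \* u' s.
have Cw : C0 L2 T w.
  by apply: C0_add => //; apply: C0_mul => //; exact: C0_H10_L2.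
pose F s := ip (w s) phi + ipv (scalev (eta s) (grad (u' s))) (grad phi)
  + ipv (scalev (kappa s) (grad (u s))) (grad phi)
  - (h s * ip (p s) phi + ip (f \o u s) phi).
apply/eqP; rewrite -subr_eq0; apply/eqP; rewrite -[LHS]/(F t).
apply: (ae_time_lim0 T0 aeq tT (F := F)).
  move=> s sT [w' dw' eqw'].
  have sT' : s \in `[0, T] by move: sT; rewrite !in_itv/= => /andP[/ltW -> /ltW ->].
  have dw := tderive_mul oO bO C1rho Cu (C0_in Cu' sT') (let: And3 _ du _ := C1u in du s sT') sT'.
  (* The derivative in the equation is determined only up to norm zero, which does not affect its
     product with [phi]. *)
  have ww' : fnorm L2 (w s - w') = 0.
    apply: (tderive_uniq N2 sT _ dw dw') => r rT.
    by have := C0_mul oO Crho Cu2 rT => -[].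
  rewrite /F (si_norm_eq0 S2 dw.1 dw'.1 Lphi ww').
  by apply/eqP; rewrite subr_eq0; apply/eqP; exact: (eqw' phi Hphi).
have Cphi : C0 L2 T (fun=> phi) by exact: C0_cst.
have Cgphi : C0 (L2v_space Omega) T (fun=> grad phi).
  by apply: C0_cst => //; exact: L2v_seminormed.
have ip_cvg a : C0 L2 T a -> ip (a s) phi @[s --> time t] --> ip (a t) phi.
  by move=> Ca; exact: (@C0_inner R _ L2 T ip S2 (fun=> erefl) a _ t Ca Cphi tT).
have ipv_cvg a : C0 (L2v_space Omega) T a ->
    ipv (a s) (grad phi) @[s --> time t] --> ipv (a t) (grad phi).
  by move=> Ca; exact: (@C0_inner R _ (L2v_space Omega) T ipv S2v (fun=> erefl) a _ t Ca Cgphi tT).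
rewrite /F; apply: cvgB.
  apply: cvgD; first apply: cvgD.
  - exact: (ip_cvg _ Cw).
  - exact: (ipv_cvg _ (C0_scalev oO Ceta (C0_grad oO bO Cu'))).
  - exact: (ipv_cvg _ (C0_scalev oO Ckappa (C0_grad oO bO Cu))).
apply: cvgD; last exact: (ip_cvg _ (C0_lipschitz oO bO fL Cu2)).
apply: cvgM; last exact: (ip_cvg _ Cp).
rewrite (hE t tT); apply: cvg_trans (source_cvg tT).
by apply: near_eq_cvg; near=> s; rewrite hE//; near: s; exact: near_time.
Unshelve. all: by end_near. Qed.

End everywhere.

End problem.

(** * Error estimate for one step *)

(* [x] and [y] stand for the norms of the gradient and of the function. *)
Lemma coercive_bound (R : realType) (r0 e0 A theta c x y : R) :
  0 < r0 -> 0 < e0 -> 0 <= theta < 1 -> 0 <= A -> 0 <= x -> 0 <= y -> 0 <= c ->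
  A ^+ 2 <= theta ^+ 2 * (4 * (e0 * r0)) ->
  r0 * y ^+ 2 + e0 * x ^+ 2 <= A * (x * y) + c * (x + y) ->
  x + y <= 2 * c / ((1 - theta) * Num.min r0 e0).
Proof.
move=> r00 e00 /andP[th0 th1] A0 x0 y0 c0 A2 H.
have m0 : 0 < Num.min r0 e0 by rewrite lt_min r00 e00.
have mr : Num.min r0 e0 <= r0 by rewrite ge_min lexx.
have me : Num.min r0 e0 <= e0 by rewrite ge_min lexx orbT.
set m := Num.min r0 e0 in m0 mr me *.
have Q0 : 0 <= r0 * y ^+ 2 + e0 * x ^+ 2.
  by rewrite addr_ge0// mulr_ge0 ?sqr_ge0// ltW.
(* Young's inequality, compared after squaring: 4 a b is at most (a + b)^2 with a = r0 y^2 and b =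
   e0 x^2. The coercive part keeps the fraction [1 - theta]. *)
have AM : A * (x * y) <= theta * (r0 * y ^+ 2 + e0 * x ^+ 2).
  rewrite -(@ler_pXn2r _ 2)// ?nnegrE ?mulr_ge0//.
  rewrite !exprMn; apply: (@le_trans _ _ (theta ^+ 2 * (4 * (e0 * r0)) * (x ^+ 2 * y ^+ 2))).
    by rewrite ler_wpM2r// mulr_ge0 ?sqr_ge0.
  rewrite -mulrA ler_wpM2l ?sqr_ge0//.
  have := sqr_ge0 (r0 * y ^+ 2 - e0 * x ^+ 2).
  rewrite -subr_ge0 => h; rewrite -subr_ge0.
  by apply: le_trans h _; rewrite le_eqVlt; apply/orP; left; apply/eqP; ring.
have th : 0 < 1 - theta by rewrite subr_gt0.
have H2 : (1 - theta) * (r0 * y ^+ 2 + e0 * x ^+ 2) <= c * (x + y).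
  rewrite mulrBl mul1r; lra.
have H3 : m * ((x + y) ^+ 2 / 2) <= r0 * y ^+ 2 + e0 * x ^+ 2.
  have a1 : m * y ^+ 2 <= r0 * y ^+ 2 by rewrite ler_wpM2r// sqr_ge0.
  have a2 : m * x ^+ 2 <= e0 * x ^+ 2 by rewrite ler_wpM2r// sqr_ge0.
  have a3 : (x + y) ^+ 2 / 2 <= y ^+ 2 + x ^+ 2.
    have := sqr_ge0 (x - y); rewrite sqrrB sqrrD; lra.
  apply: le_trans (ler_wpM2l (ltW m0) a3) _; rewrite mulrDr; exact: lerD.
have [xy0|xy0] := eqVneq (x + y) 0.
  by rewrite xy0 divr_ge0// mulr_ge0// ltW.
have xyp : 0 < x + y by rewrite lt_def xy0 addr_ge0.
rewrite ler_pdivlMr ?mulr_gt0// -(ler_pM2r xyp).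
have := le_trans (ler_wpM2l (ltW th) H3) H2.
have -> : (1 - theta) * (m * ((x + y) ^+ 2 / 2)) =
  (x + y) * ((1 - theta) * m) * (x + y) / 2 by field.
by lra.
Qed.

Lemma affine_eqB (R : comRingType) (a1 a2 b1 b2 c1 c2 h1 h2 p g1 g2 : R) :
  a1 + b1 + c1 = h1 * p + g1 -> a2 + b2 + c2 = h2 * p + g2 ->
  a1 - a2 + (b1 - b2) + (c1 - c2) = (h1 - h2) * p + (g1 - g2).
Proof.
move=> e1 e2; have -> : a1 - a2 + (b1 - b2) + (c1 - c2) =
  a1 + b1 + c1 - (a2 + b2 + c2) by ring.
by rewrite e1 e2; ring.
Qed.

Lemma source_norm_le (R : realDomainType)
    (m a1 a2 b1 b2 c1 c2 g1 g2 A B C G : R) :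
  `|a1 - a2| <= A -> `|b1 - b2| <= B -> `|c1 - c2| <= C -> `|g1 - g2| <= G ->
  `|m + a1 + b1 + c1 - g1 - (m + a2 + b2 + c2 - g2)| <= B + (A + C + G).
Proof.
rewrite !ler_norml => /andP[? ?] /andP[? ?] /andP[? ?] /andP[? ?].
by apply/andP; split; lra.
Qed.

Section step.
Variables (R : realType) (d : nat) (Omega : set 'rV[R]_d).
Hypothesis oO : open Omega.
Hypothesis bO : bounded_set Omega.
Local Notation E := 'rV[R]_d.
Local Notation mu := (lebesgue_rV R d).
Local Notation ip := (ip Omega).
Local Notation ipv := (ipv Omega).
Local Notation L2 := (L2 Omega).
Local Notation L2v := (L2v Omega).
Local Notation Linf := (Linf Omega).
Local Notation H1 := (H1 Omega).
Local Notation H10 := (H10 Omega).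
Local Notation grad := (grad Omega).
Local Notation normv := (normv Omega).
Local Notation H1norm := (H1norm Omega).

Let mO : measurable Omega. Proof. exact: open_measurable_rV. Qed.
Let S2 := ip_semi_inner mO.
Let S2v := ipv_semi_inner mO.
Let N2 := L2_seminormed mO.
Let Ninf := Linf_seminormed Omega.
Let NH1 := H1_seminormed oO bO.
Let NH10 := H10_seminormed oO bO.

Lemma ip_weight_ge (a u : E -> R) (c : R) : Linf a -> L2 u ->
  {ae mu, forall x, Omega x -> c <= a x} -> c * ip u u <= ip (a \* u) u.
Proof.
move=> La Lu ca.
have Lau := (Linf_L2 mO La Lu).1.
(* truncated from below, the weight only changes on a null set *)
pose b x := Num.max (a x) c.
have mb : measurable_fun Omega b.
  by apply: measurable_maxr; [exact: Linf_meas|exact: measurable_cst].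
have mbu : measurable_fun Omega (b \* u).
  by apply: measurable_funM => //; exact: L2_meas.
have aeb : {ae mu, forall x, Omega x -> b x = a x}.
  by apply: filterS ca => x cx Ox; rewrite /b max_l// cx.
have Lbu : L2 (b \* u).
  apply: (L2_bounded mO (c := 1) Lau mbu ler01 _).1.
  by apply: filterS aeb => x bx Ox; rewrite mul1r /= bx.
have /= eqn : fnorm L2 (b \* u - a \* u) <= 0 * fnorm L2 (a \* u).
  apply: (L2_bounded mO Lau _ (lexx 0) _).2; first exact: L2_meas (smB N2 Lbu Lau).
  apply: filterS aeb => x bx Ox; rewrite mul0r.
  by rewrite -[X in `|X|]/(b x * u x - a x * u x) bx// subrr normr0.
have {}eqn : fnorm L2 (b \* u - a \* u) = 0.
  by apply/eqP; rewrite eq_le (seminormed_ge0 N2) andbT (le_trans eqn)// mul0r.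
rewrite -(si_norm_eq0 S2 Lbu Lau Lu eqn) -(siZl S2)//.
apply: le_Rintegral => //.
- by apply: L2_integrableM => //; exact: (siZ S2).
- exact: L2_integrableM.
- move=> x _; rewrite -[X in X * _ <= _]/(c * u x) -!mulrA.
  by rewrite ler_wpM2r ?le_max ?lexx ?orbT// -expr2 sqr_ge0.
Qed.

Lemma ipv_weight_ge (a : E -> R) (g : E -> E) (c : R) : Linf a -> L2v g ->
  {ae mu, forall x, Omega x -> c <= a x} -> c * ipv g g <= ipv (scalev a g) g.
Proof.
move=> La Lg ca; have Lag := (Linf_L2v mO La Lg).1.
rewrite !ipv_sum// mulr_sumr; apply: ler_sum => i _.
apply: le_trans (ip_weight_ge La (Lg i) ca) _.
rewrite le_eqVlt; apply/orP; left; apply/eqP; congr ip.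
by apply/funext => x; rewrite !mxE.
Qed.

(** Here the gradients may be subtracted exactly, because their defect of linearity has norm zero
    and [a] is bounded. *)
Lemma ipv_scalev_gradB (a u v : E -> R) (k : E -> E) : Linf a -> H1 u -> H1 v ->
  L2v k -> ipv (scalev a (grad u)) k - ipv (scalev a (grad v)) k =
  ipv (scalev a (grad (u - v))) k.
Proof.
move=> La Hu Hv Lk.
have Lg := H1_gradL2 Hu; have Lh := H1_gradL2 Hv.
have Luv := H1_gradL2 (smB NH1 Hu Hv).
have Lag := (Linf_L2v mO La Lg).1; have Lah := (Linf_L2v mO La Lh).1.
have Lauv := (Linf_L2v mO La Luv).1.
rewrite -(siBl S2v)//; apply: (si_norm_eq0 S2v) => //; first exact: (siB S2v).
have -> : scalev a (grad u) - scalev a (grad v) - scalev a (grad (u - v)) =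
    scalev a (grad u - grad v - grad (u - v)).
  apply/funext => x; rewrite -[LHS]/(a x *: grad u x - a x *: grad v x - a x *: grad (u - v) x).
  by rewrite -!scalerBr.
have Ld : L2v (grad u - grad v - grad (u - v)).
  by apply: (siB S2v) => //; exact: (siB S2v).
have := (Linf_L2v mO La Ld).2.
have -> : normv (grad u - grad v - grad (u - v)) = 0.
  have := gradP oO bO (-1) Hv Hu; rewrite !scaleN1r ![- _ + _]addrC => g0.
  have := sm_normN (L2v_seminormed oO) Ld; rewrite /fnorm/= opprB => <-.
  exact: g0.
by rewrite mulr0 => h; apply/eqP; rewrite -normr_le0 ger0_norm ?sqrtr_ge0.
Qed.

Lemma variationalB (eta kappa w1 w2 v1 v2 u1 u2 : E -> R) (h1 h2 : R)
    (p g1 g2 phi : E -> R) :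
  Linf eta -> Linf kappa -> L2 w1 -> L2 w2 -> H1 v1 -> H1 v2 -> H1 u1 -> H1 u2 ->
  L2 g1 -> L2 g2 ->
  variational Omega eta kappa w1 v1 u1 h1 p g1 ->
  variational Omega eta kappa w2 v2 u2 h2 p g2 ->
  H10 phi ->
  ip (w1 - w2) phi + ipv (scalev eta (grad (v1 - v2))) (grad phi)
    + ipv (scalev kappa (grad (u1 - u2))) (grad phi)
  = (h1 - h2) * ip p phi + ip (g1 - g2) phi.
Proof.
move=> Le Lk Lw1 Lw2 Hv1 Hv2 Hu1 Hu2 Lg1 Lg2 /(_ phi) + /(_ phi) + Hphi.
move=> /(_ Hphi) E1 /(_ Hphi) E2.
have Lphi := H1_L2 (H10_H1 Hphi); have Lgphi := H1_gradL2 (H10_H1 Hphi).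
rewrite -(ipv_scalev_gradB Le Hv1 Hv2 Lgphi) -(ipv_scalev_gradB Lk Hu1 Hu2 Lgphi).
rewrite (siBl S2 Lw1 Lw2 Lphi) (siBl S2 Lg1 Lg2 Lphi).
exact: affine_eqB E1 E2.
Qed.

(** * Distance between the exact and the discrete source *)

Section source_estimate.
Variables (f : R -> R) (Lf : R).
Hypothesis fL : forall a b, `|f a - f b| <= Lf * `|a - b|.
Variables (omega rho eta kappa r dr v w u z : E -> R) (wbar m' : R).
Variables (e1 Kk Kr Kd Ku M Q a wm : R).
Let q := fdiv omega rho.
Hypothesis (Lr : Linf r) (Ldr : Linf dr) (Leta : Linf eta) (Lkappa : Linf kappa).
Hypothesis (H1q : H1 q) (H1v : H1 v) (H1w : H1 w) (H1u : H1 u) (H1z : H1 z).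
Hypothesis e10 : 0 <= e1.
Hypothesis eta_le : {ae mu, forall x, Omega x -> `|eta x| <= e1}.
Hypothesis kappa_le : fnorm Linf kappa <= Kk.
Hypothesis dr_le : fnorm Linf dr <= Kr.
Hypothesis rdr_le : fnorm Linf (r - dr) <= Kd.
Hypothesis u_le : fnorm L2 u <= Ku.
Hypothesis uz_le : H1norm (u - z) <= a.
Hypothesis gq_le : normv (grad q) <= M.
Hypothesis q_le : fnorm L2 q <= Q.
Hypothesis wm0 : 0 < wm.
Hypothesis wm_le : wm <= `|wbar|.

Let Lq : L2 q. Proof. exact: H1_L2. Qed.
Let Lgq : L2v (grad q). Proof. exact: H1_gradL2. Qed.
Let Lu : L2 u. Proof. exact: H1_L2. Qed.
Let Lz : L2 z. Proof. exact: H1_L2. Qed.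
Let H1uz : H1 (u - z). Proof. exact: (smB NH1). Qed.
Let Luz_le : fnorm L2 (u - z) <= a.
Proof. exact: le_trans (L2_le_H1norm oO H1uz) uz_le. Qed.
Let a0 : 0 <= a. Proof. exact: le_trans (seminormed_ge0 NH1 _) uz_le. Qed.
Let Kd0 : 0 <= Kd. Proof. exact: le_trans (Linf_norm_ge0 _ _) rdr_le. Qed.
Let Kr0 : 0 <= Kr. Proof. exact: le_trans (Linf_norm_ge0 _ _) dr_le. Qed.
Let Kk0 : 0 <= Kk. Proof. exact: le_trans (Linf_norm_ge0 _ _) kappa_le. Qed.
Let M0 : 0 <= M. Proof. exact: le_trans (sqrtr_ge0 _) gq_le. Qed.
Let Q0 : 0 <= Q. Proof. exact: le_trans (sqrtr_ge0 _) q_le. Qed.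

Lemma weighted_product_dist (k : E -> R) : L2 k ->
  `|ip (r \* u - dr \* z) k| <= (Kd * Ku + Kr * a) * fnorm L2 k.
Proof.
move=> Lk.
have Lru := (Linf_L2 mO Lr Lu).1; have Ldz := (Linf_L2 mO Ldr Lz).1.
apply: le_trans (si_CS S2 (siB S2 Lru Ldz) Lk) _.
apply: ler_wpM2r; first exact: sqrtr_ge0.
apply: le_trans (Linf_L2_dist oO Lr Ldr Lu Lz) _.
by apply: lerD; apply: ler_pM => //; rewrite ?Linf_norm_ge0// sqrtr_ge0.
Qed.

Lemma ipv_eta_le (g k : E -> E) : L2v g -> L2v k ->
  `|ipv (scalev eta g) k| <= e1 * normv g * normv k.
Proof.
move=> Lg Lk; have Leg := (Linf_L2v mO Leta Lg).1.
apply: le_trans (si_CS S2v Leg Lk) _; apply: ler_wpM2r; first exact: sqrtr_ge0.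
apply: (L2v_bounded mO Lg _ e10 _).2.
  by move=> i; exact: L2_meas (Leg i).
apply: filterS eta_le => x ex Ox i.
by rewrite mxE normrM ler_wpM2r// ex.
Qed.

Lemma ipv_kappa_le (y : E -> R) (b : R) (k : E -> E) : H1 y -> H1norm y <= b ->
  L2v k -> `|ipv (scalev kappa (grad y)) k| <= Kk * b * normv k.
Proof.
move=> Hy yb Lk; have Lg := H1_gradL2 Hy.
have [Lkg kg] := Linf_L2v mO Lkappa Lg.
apply: le_trans (si_CS S2v Lkg Lk) _; apply: ler_wpM2r; first exact: sqrtr_ge0.
apply: le_trans kg _; apply: ler_pM; rewrite ?Linf_norm_ge0 ?sqrtr_ge0//.
exact: le_trans (grad_le_H1norm oO Hy) yb.
Qed.

Lemma ip_lipschitz_le (k : E -> R) : L2 k ->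
  `|ip ((f \o u) - (f \o z)) k| <= `|Lf| * a * fnorm L2 k.
Proof.
move=> Lk; have [Lfd fd] := lipschitz_dist oO fL Lu Lz.
apply: le_trans (si_CS S2 Lfd Lk) _; apply: ler_wpM2r; first exact: sqrtr_ge0.
by apply: le_trans fd _; rewrite ler_wpM2l.
Qed.

Lemma source_dist :
  `|source Omega f omega wbar m' rho r eta kappa v u
    - source Omega f omega wbar m' rho dr eta kappa w z| <=
  wm^-1 * (e1 * M * normv (grad (v - w))
    + ((Kd * Ku + Kr * a) * Q + Kk * a * M + `|Lf| * a * Q)).
Proof.
rewrite /source -mulrBr normrM normfV.
have wbar0 : 0 < `|wbar| by exact: lt_le_trans wm_le.
apply: ler_pM; rewrite ?invr_ge0 ?normr_ge0//; first by rewrite lef_pV2 ?posrE.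
rewrite !fdiv_mul -/q.
have Luv := H1_gradL2 (smB NH1 H1v H1w).
have Lru := (Linf_L2 mO Lr Lu).1; have Ldz := (Linf_L2 mO Ldr Lz).1.
(* The density factor is moved from [q] to the unknown, so that the two terms differ by
   [r \* u - dr \* z]. *)
have -> : ip u (r \* q) = ip (r \* u) q.
  by apply: eq_Rintegral => x _ /=; rewrite mulrCA mulrA.
have -> : ip z (dr \* q) = ip (dr \* z) q.
  by apply: eq_Rintegral => x _ /=; rewrite mulrCA mulrA.
have B1 := weighted_product_dist Lq.
rewrite (siBl S2 Lru Ldz Lq) in B1.
have B2 := ipv_eta_le Luv Lgq.
rewrite -(ipv_scalev_gradB Leta H1v H1w Lgq) in B2.
have B3 := ipv_kappa_le H1uz uz_le Lgq.
rewrite -(ipv_scalev_gradB Lkappa H1u H1z Lgq) in B3.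
have B4 := ip_lipschitz_le Lq.
rewrite (siBl S2 (L2_lipschitz oO bO fL Lu) (L2_lipschitz oO bO fL Lz) Lq) in B4.
have C1 : (Kd * Ku + Kr * a) * fnorm L2 q <= (Kd * Ku + Kr * a) * Q.
  rewrite ler_wpM2l// addr_ge0// mulr_ge0//.
  exact: le_trans (sqrtr_ge0 _) u_le.
have C2 : e1 * normv (grad (v - w)) * normv (grad q) <= e1 * M * normv (grad (v - w)).
  rewrite [leRHS]mulrAC; apply: ler_wpM2l gq_le.
  exact: mulr_ge0 e10 (sqrtr_ge0 _).
have C3 : Kk * a * normv (grad q) <= Kk * a * M := ler_wpM2l (mulr_ge0 Kk0 a0) gq_le.
have C4 : `|Lf| * a * fnorm L2 q <= `|Lf| * a * Q :=
  ler_wpM2l (mulr_ge0 (normr_ge0 Lf) a0) q_le.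
exact: source_norm_le (le_trans B1 C1) (le_trans B2 C2) (le_trans B3 C3) (le_trans B4 C4).
Qed.

End source_estimate.

End step.

(** * Constants and the discrete Gronwall inequality *)

(** [x] and [y] are the norms of the gradient of [D] and of [D]; [a] bounds u(t_i) - u_(i-1), [b]
    bounds u(t_i) - u_i, and [k] the consistency error of the density. [C] is chosen before all of
    them and hence serves for every step and every [n]. *)
Lemma step_constant (R : realType)
    (r0 e0 e1 P M wm Q Kk Kr Ku L theta : R) :
  0 < r0 -> 0 < e0 -> 0 <= e1 -> 0 <= P -> 0 <= M -> 0 < wm -> 0 <= Q ->
  0 <= Kk -> 0 <= Kr -> 0 <= Ku -> 0 <= L -> 0 <= theta < 1 ->
  (wm^-1 * (e1 * M) * P) ^+ 2 <= theta ^+ 2 * (4 * (e0 * r0)) ->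
  exists2 C, 0 < C & forall x y a b k, 0 <= x -> 0 <= y -> 0 <= a -> 0 <= b ->
    0 <= k ->
    let G := wm^-1 * (e1 * M * x
      + ((k * Ku + Kr * a) * Q + Kk * a * M + L * a * Q)) in
    r0 * y ^+ 2 + e0 * x ^+ 2 <=
      G * (P * y) + L * a * y + (k * Ku + Kr * a) * y + Kk * b * x ->
    x + y <= C * (a + b + k) /\ G <= C * (a + b + k).
Proof.
move=> r00 e00 e10 P0 M0 wm0 Q0 Kk0 Kr0 Ku0 L0 th small.
have wi0 : 0 <= wm^-1 by rewrite invr_ge0 ltW.
(* [c1] collects the lower order part of [G], [c2] all the terms that are linear in [x] and [y], and
   [c3] is what [coercive_bound] makes of [c2]. *)
pose c1 := wm^-1 * ((Ku + Kr) * Q + Kk * M + L * Q).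
pose c2 := c1 * P + L + (Ku + Kr) + Kk.
have c10 : 0 <= c1 by rewrite mulr_ge0 ?addr_ge0 ?mulr_ge0 ?addr_ge0.
have c20 : 0 <= c2 by have := mulr_ge0 c10 P0; rewrite /c2; lra.
have m0 : 0 < Num.min r0 e0 by rewrite lt_min r00 e00.
have th1 : 0 < 1 - theta by case/andP: th => _; rewrite subr_gt0.
pose c3 := 2 * c2 / ((1 - theta) * Num.min r0 e0).
have c30 : 0 <= c3 by rewrite divr_ge0 ?mulr_ge0// ltW.
have w0 : 0 <= wm^-1 * (e1 * M) by rewrite !mulr_ge0.
(* [c3] is for [x + y], the next two summands are for [G], and 1 makes the constant positive. *)
exists (c3 + wm^-1 * (e1 * M) * c3 + c1 + 1).
  by have := mulr_ge0 w0 c30; lra.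
move=> x y a b k x0 y0 a0 b0 k0 G H.
set dl := a + b + k.
have dl0 : 0 <= dl by rewrite /dl; lra.
have [ad bd kd] : [/\ a <= dl, b <= dl & k <= dl].
  by rewrite /dl; split; lra.
have kK : k * Ku + Kr * a <= (Ku + Kr) * dl.
  by rewrite mulrDl (mulrC k) lerD// ler_wpM2l.
have inner : (k * Ku + Kr * a) * Q + Kk * a * M + L * a * Q <=
    ((Ku + Kr) * Q + Kk * M + L * Q) * dl.
  rewrite [leRHS]mulrDl [X in _ <= X + _]mulrDl; apply: lerD; first apply: lerD.
  - by rewrite mulrAC ler_wpM2r.
  - by rewrite mulrAC ler_wpM2l ?mulr_ge0.
  - by rewrite mulrAC ler_wpM2l ?mulr_ge0.
have GB : G <= wm^-1 * (e1 * M) * x + c1 * dl.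
  rewrite /G mulrDr mulrA lerD2l /c1 -[leRHS]mulrA.
  by rewrite ler_wpM2l.
have xy : x + y <= c3 * dl.
  have -> : c3 * dl = 2 * (c2 * dl) / ((1 - theta) * Num.min r0 e0).
    by rewrite /c3; ring.
  apply: (coercive_bound r00 e00 th (A := wm^-1 * (e1 * M) * P)) => //.
  - by rewrite mulr_ge0.
  - by rewrite mulr_ge0.
  apply: le_trans H _.
  have t1 : G * (P * y) <= (wm^-1 * (e1 * M) * x + c1 * dl) * (P * y).
    by rewrite ler_wpM2r// mulr_ge0.
  have t2 : L * a * y <= L * dl * y by rewrite ler_wpM2r// ler_wpM2l.
  have t3 : (k * Ku + Kr * a) * y <= (Ku + Kr) * dl * y by rewrite ler_wpM2r.
  have t4 : Kk * b * x <= Kk * dl * x by rewrite ler_wpM2r// ler_wpM2l.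
  apply: le_trans (lerD (lerD (lerD t1 t2) t3) t4) _.
  rewrite -subr_ge0.
  have -> : wm^-1 * (e1 * M) * P * (x * y) + c2 * dl * (x + y) -
    ((wm^-1 * (e1 * M) * x + c1 * dl) * (P * y) + L * dl * y +
     (Ku + Kr) * dl * y + Kk * dl * x) =
    (c1 * P + L + (Ku + Kr)) * dl * x + Kk * dl * y by rewrite /c2; ring.
  have cc : 0 <= c1 * P + L + (Ku + Kr) by have := mulr_ge0 c10 P0; lra.
  by apply: addr_ge0; [exact: mulr_ge0 (mulr_ge0 cc dl0) x0|exact: mulr_ge0 (mulr_ge0 Kk0 dl0) y0].
have wc : 0 <= wm^-1 * (e1 * M) * c3 * dl by rewrite mulr_ge0// mulr_ge0.
have c1d : 0 <= c1 * dl by rewrite mulr_ge0.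
have c3d : 0 <= c3 * dl by rewrite mulr_ge0.
split.
  apply: le_trans xy _; rewrite !mulrDl mul1r; lra.
apply: le_trans GB _.
have : wm^-1 * (e1 * M) * x <= wm^-1 * (e1 * M) * c3 * dl.
  rewrite -[leRHS]mulrA ler_wpM2l//; apply: le_trans xy; lra.
rewrite !mulrDl mul1r; lra.
Qed.

(** With y = C tau at most 1/2, the implicit term is absorbed through (1 + y) / (1 - y) <= 1 + 4 y.
    The resulting recursion is dominated by ((1 + 4 y)^i - 1) tau, and (1 + 4 y)^i is at most exp(4
    C T). *)
Lemma discrete_gronwall (R : realType) (C T tau : R) (n : nat) (e : nat -> R) :
  0 < C -> 0 < tau -> n%:R * tau = T -> tau <= (2 * C)^-1 -> e 0%N = 0 ->
  (forall i, 0 <= e i) ->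
  (forall i, (1 <= i <= n)%N -> e i <= e i.-1 + C * tau * (e i.-1 + e i + tau)) ->
  forall i, (i <= n)%N -> e i <= expR (4 * C * T) * tau.
Proof.
move=> C0 tau0 nT small e0 ege0 rec.
have y0 : 0 < C * tau by rewrite mulr_gt0.
have y2 : C * tau <= 2^-1.
  by move: small; rewrite invfM ler_pdivlMr// mulrC.
have step i : (i < n)%N -> e i.+1 <= (1 + 4 * (C * tau)) * e i + 2 * (C * tau) * tau.
  move=> ilt; have := rec i.+1 ilt; rewrite /=.
  have := ege0 i; set y := C * tau in y0 y2 *; set d := e i; set g := e i.+1.
  move=> d0 H.
  have H1 : (1 - y) * g <= (1 + y) * d + y * tau by lra.
  have y1 : 0 < 1 - y by lra.
  rewrite -(ler_pM2l y1); apply: le_trans H1 _.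
  have yy : y * y <= y / 2 by rewrite ler_wpM2l// ltW.
  have a1 : y * y * d <= y / 2 * d by rewrite ler_wpM2r.
  have a2 : y * y * tau <= y / 2 * tau by rewrite ler_wpM2r// ltW.
  have yd : 0 <= y * d by rewrite mulr_ge0// ltW.
  have yt : 0 <= y * tau by rewrite mulr_ge0// ltW.
  lra.
have main i : (i <= n)%N -> e i <= ((1 + 4 * (C * tau)) ^+ i - 1) * tau.
  elim: i => [|i IH] ilt; first by rewrite e0 expr0 subrr mul0r.
  apply: le_trans (step i ilt) _.
  have c0 : 0 <= 1 + 4 * (C * tau) by lra.
  apply: le_trans (lerD (ler_wpM2l c0 (IH (ltnW ilt))) (lexx _)) _.
  rewrite exprS.
  have yt : 0 <= C * tau * tau by rewrite mulr_ge0// ltW.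
  set z := (_ ^+ i); rewrite -subr_ge0.
  have -> : ((1 + 4 * (C * tau)) * z - 1) * tau -
    ((1 + 4 * (C * tau)) * ((z - 1) * tau) + 2 * (C * tau) * tau) =
    2 * (C * tau * tau) by ring.
  by rewrite mulr_ge0.
move=> i ilt; apply: le_trans (main i ilt) _.
rewrite ler_wpM2r ?(ltW tau0)//; apply: (@le_trans _ _ ((1 + 4 * (C * tau)) ^+ i)).
  by rewrite gerBl.
have c0 : 0 <= 1 + 4 * (C * tau) by lra.
apply: (@le_trans _ _ (expR (4 * (C * tau)) ^+ i)).
  by rewrite lerXn2r ?nnegrE ?expR_ge0// expR_ge1Dx.
rewrite -expRM_natl ler_expR -nT.
have : i%:R * (C * tau) <= n%:R * (C * tau) by rewrite ler_wpM2r ?(ltW y0)// ler_nat.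
lra.
Qed.

Lemma coercive_combine (R : realDomainType) (A B C D F H r e c3 c4 c5 c6 : R) :
  A + B + C + D = H + F -> r <= B -> e <= C -> `|A| <= c3 -> `|D| <= c4 ->
  `|F| <= c5 -> `|H| <= c6 -> r + e <= c6 + c5 + c3 + c4.
Proof.
rewrite !ler_norml => HH rB eC /andP[? ?] /andP[? ?] /andP[? ?] /andP[? ?].
lra.
Qed.

(** * Energy inequality for one step *)

Section step.
Variables (R : realType) (d : nat) (Omega : set 'rV[R]_d).
Hypothesis oO : open Omega.
Hypothesis bO : bounded_set Omega.
Local Notation E := 'rV[R]_d.
Local Notation mu := (lebesgue_rV R d).
Local Notation ip := (ip Omega).
Local Notation ipv := (ipv Omega).
Local Notation L2 := (L2 Omega).
Local Notation L2v := (L2v Omega).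
Local Notation Linf := (Linf Omega).
Local Notation H1 := (H1 Omega).
Local Notation H10 := (H10 Omega).
Local Notation grad := (grad Omega).
Local Notation normv := (normv Omega).
Local Notation H1norm := (H1norm Omega).

Let mO : measurable Omega. Proof. exact: open_measurable_rV. Qed.
Let S2 := ip_semi_inner mO.
Let S2v := ipv_semi_inner mO.
Let NH10 := H10_seminormed oO bO.

(** The difference of the two equations tested with [v - w]. Any bound [G] on the difference of the
    sources is allowed, so that the same [G] is estimated afterwards together with [v - w]. *)
Lemma step_coercive (f : R -> R) (Lf : R) (rho eta kappa r dr v w u y z p : E -> R)
    (h1 h2 rho_0 eta_0 Kk Kr Kd Ku P a b G : R) :
  (forall a b, `|f a - f b| <= Lf * `|a - b|) ->
  Linf rho -> Linf eta -> Linf kappa -> Linf r -> Linf dr ->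
  H10 v -> H10 w -> H10 u -> H10 y -> H10 z -> L2 p ->
  {ae mu, forall x, Omega x -> rho_0 <= rho x} ->
  {ae mu, forall x, Omega x -> eta_0 <= eta x} ->
  fnorm Linf kappa <= Kk -> fnorm Linf dr <= Kr -> fnorm Linf (r - dr) <= Kd ->
  fnorm L2 u <= Ku -> H1norm (u - z) <= a -> H1norm (u - y) <= b ->
  fnorm L2 p <= P -> `|h1 - h2| <= G ->
  variational Omega eta kappa (r \* u + rho \* v) v u h1 p (f \o u) ->
  variational Omega eta kappa (rho \* w + dr \* z) w y h2 p (f \o z) ->
  rho_0 * fnorm L2 (v - w) ^+ 2 + eta_0 * normv (grad (v - w)) ^+ 2 <=
    G * (P * fnorm L2 (v - w)) + `|Lf| * a * fnorm L2 (v - w)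
    + (Kd * Ku + Kr * a) * fnorm L2 (v - w) + Kk * b * normv (grad (v - w)).
Proof.
move=> fL Lrho Leta Lkappa Lr Ldr Hv Hw Hu Hy Hz Lp rho_ge eta_ge
  kappa_le dr_le rdr_le u_le uz_le uy_le p_le hG E1 E2.
have HD : H10 (v - w) := smB NH10 Hv Hw.
have Lv := H1_L2 (H10_H1 Hv); have Lw := H1_L2 (H10_H1 Hw).
have Lu := H1_L2 (H10_H1 Hu); have Lz := H1_L2 (H10_H1 Hz).
have LD := H1_L2 (H10_H1 HD); have LgD := H1_gradL2 (H10_H1 HD).
have Lru := (Linf_L2 mO Lr Lu).1; have Ldz := (Linf_L2 mO Ldr Lz).1.
have Lrv := (Linf_L2 mO Lrho Lv).1; have Lrw := (Linf_L2 mO Lrho Lw).1.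
have LrD := (Linf_L2 mO Lrho LD).1.
have := variationalB oO bO Leta Lkappa (siD S2 Lru Lrv) (siD S2 Lrw Ldz)
  (H10_H1 Hv) (H10_H1 Hw) (H10_H1 Hu) (H10_H1 Hy)
  (L2_lipschitz oO bO fL Lu) (L2_lipschitz oO bO fL Lz) E1 E2 HD.
(* Both derivatives of rho u carry [rho] at the same node; its product with [v - w] is the coercive
   term and the remainder is a consistency error. *)
have -> : r \* u + rho \* v - (rho \* w + dr \* z) =
    (r \* u - dr \* z) + rho \* (v - w).
  apply/funext => x.
  rewrite -[LHS]/(r x * u x + rho x * v x - (rho x * w x + dr x * z x)).
  rewrite -[RHS]/(r x * u x - dr x * z x + rho x * (v x - w x)).
  by ring.
rewrite (siDl S2 (siB S2 Lru Ldz) LrD LD) => key.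
have b1 := ip_weight_ge oO Lrho LD rho_ge.
have b2 := ipv_weight_ge oO Leta LgD eta_ge.
rewrite -(si_normsq S2 LD) in b1.
rewrite -(si_normsq S2v LgD) in b2.
have b3 := weighted_product_dist oO bO Lr Ldr (H10_H1 Hu) (H10_H1 Hz)
  dr_le rdr_le u_le uz_le LD.
have b4 := ipv_kappa_le oO Lkappa kappa_le (smB (H1_seminormed oO bO) (H10_H1 Hu) (H10_H1 Hy)) uy_le LgD.
have b5 := ip_lipschitz_le oO bO fL (H10_H1 Hu) (H10_H1 Hz) uz_le LD.
have b6 : `|(h1 - h2) * ip p (v - w)| <= G * (P * fnorm L2 (v - w)).
  rewrite normrM; apply: ler_pM hG _ => //.
  apply: le_trans (si_CS S2 Lp LD) _.
  exact: ler_wpM2r (sqrtr_ge0 _) _ _ p_le.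
exact: coercive_combine key b1 b2 b3 b4 b5 b6.
Qed.

End step.

(** * Stability and consistency of backward differences *)

Section backward_difference.
Variables (R : realType) (V : lmodType R) (X : fspace V) (T : R).
Hypothesis SX : seminormed X.
Variables (u u' u'' : R -> V) (K a b tau : R).
Hypotheses (aT : a \in `[0, T]) (bT : b \in `[0, T]).
Hypotheses (tau0 : 0 < tau) (abE : b - a = tau).

Let ab : a <= b. Proof. by rewrite -subr_ge0 abE ltW. Qed.

Lemma backward_difference_le : C1 X T u u' ->
  (forall t, t \in `[0, T] -> fnorm X (u' t) <= K) ->
  fnorm X (tau^-1 *: (u b - u a)) <= K.
Proof.
move=> C1u uK; have [Cu _ _] := C1u.
rewrite (seminormedZ SX); last by apply: (smB SX); [exact: C0_in Cu bT|exact: C0_in Cu aT].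
rewrite ger0_norm ?invr_ge0 ?(ltW tau0)// mulrC ler_pdivrMr// -abE.
exact: (C1_increment SX C1u).
Qed.

Lemma backward_difference_dist : C2 X T u u' u'' ->
  (forall t, t \in `[0, T] -> fnorm X (u'' t) <= K) ->
  fnorm X (u' b - tau^-1 *: (u b - u a)) <= K * tau.
Proof.
move=> C2u uK; have [[Cu _ Cu'] _] := C2u.
have Xd : X (u b - u a) by apply: (smB SX); [exact: C0_in Cu bT|exact: C0_in Cu aT].
have Xb := C0_in Cu' bT.
have Xr : X (u b - u a - tau *: u' b) by apply: (smB SX) => //; exact: (smZ SX).
have -> : u' b - tau^-1 *: (u b - u a) = - (tau^-1 *: (u b - u a - tau *: u' b)).
  by rewrite (scalerBr _ (u b - u a)) scalerA mulVf ?gt_eqF// scale1r opprB.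
rewrite (sm_normN SX); last exact: (smZ SX).
rewrite (seminormedZ SX)// ger0_norm ?invr_ge0 ?(ltW tau0)// mulrC ler_pdivrMr//.
rewrite -mulrA -expr2 -[in leLHS]abE -[in leRHS]abE.
exact: (C2_backward_increment SX C2u).
Qed.

End backward_difference.

Lemma eq_dist_le (R : realDomainType) (x y x' y' c : R) :
  x = x' -> y = y' -> `|x' - y'| <= c -> `|x - y| <= c.
Proof. by move=> -> ->. Qed.

(** [e'] and [e] are the errors at two consecutive nodes. A single constant serves the recursion for
    the error and the bound [g] of the source error. *)
Lemma step_arith (R : realDomainType) (C K1 Kd K2 tau e e' D g : R) :
  0 < C -> 0 < K1 -> 0 < Kd -> 0 < K2 -> 0 < tau -> 0 <= e -> 0 <= e' ->
  D <= C * (K1 * tau + e' + e + Kd * tau) ->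
  g <= C * (K1 * tau + e' + e + Kd * tau) ->
  e <= e' + K2 * tau ^+ 2 + tau * D ->
  e <= e' + (C * (1 + K1 + Kd) + K2) * tau * (e' + e + tau) /\
  g <= (C * (1 + K1 + Kd) + K2) * (e' + e + tau).
Proof.
move=> C0 K10 Kd0 K20 t0 e0 e'0 D_le g_le e_le.
set S := e' + e + tau.
have S0 : 0 <= S by rewrite !addr_ge0// ltW.
have tS : tau <= S by rewrite lerDr addr_ge0.
have eS : K1 * tau + e' + e + Kd * tau <= (1 + K1 + Kd) * S.
  have h1 : K1 * tau <= K1 * S by rewrite ler_wpM2l// ltW.
  have h2 : Kd * tau <= Kd * S by rewrite ler_wpM2l// ltW.
  have : e' + e <= S by rewrite lerDl ltW.
  lra.
have CS : C * (K1 * tau + e' + e + Kd * tau) <= C * (1 + K1 + Kd) * S.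
  by rewrite -mulrA ler_wpM2l// ltW.
have K2S : 0 <= K2 * S by rewrite mulr_ge0// ltW.
split; last by rewrite mulrDl; lra.
apply: le_trans e_le _; rewrite -addrA lerD2l.
have h1 : tau * D <= tau * (C * (1 + K1 + Kd) * S).
  by rewrite ler_wpM2l ?(ltW t0)// (le_trans D_le).
have h2 : K2 * tau ^+ 2 <= K2 * (tau * S).
  by rewrite expr2 !ler_wpM2l// ltW.
lra.
Qed.

Lemma sqrt_sum_le (R : rcfType) (T K : R) (n : nat) (g : nat -> R) : (0 < n)%N ->
  0 < T -> 0 <= K ->
  (forall i, (1 <= i <= n)%N -> `|g i| <= K * (T / n%:R)) ->
  Num.sqrt (\sum_(1 <= i < n.+1) `|g i| ^+ 2 * (T / n%:R)) <=
    Num.sqrt T * K * (T / n%:R).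
Proof.
move=> n0 T0 K0 gK.
have nR : 0 < n%:R :> R by rewrite ltr0n.
have tau0 : 0 < T / n%:R by rewrite divr_gt0.
have KT : 0 <= K * (T / n%:R) by rewrite mulr_ge0// ltW.
rewrite -mulrA -[X in _ <= _ * X](ger0_norm KT) -sqrtr_sqr -sqrtrM ?(ltW T0)//.
apply: ler_wsqrtr.
apply: (@le_trans _ _ (\sum_(1 <= i < n.+1) (K * (T / n%:R)) ^+ 2 * (T / n%:R))).
  rewrite !big_nat; apply: ler_sum => i ni.
  by rewrite ler_wpM2r ?(ltW tau0)// ler_pXn2r ?nnegrE// gK.
have nT : T / n%:R *+ n = T by rewrite -[LHS]mulr_natr divfK ?gt_eqF.
by rewrite sumr_const_nat subSS subn0 -mulrnAr nT mulrC.
Qed.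

Lemma H1norm_le_sum (R : realType) (d : nat) (Omega : set 'rV[R]_d) v :
  open Omega -> bounded_set Omega -> H1 Omega v ->
  H1norm Omega v <= normv Omega (grad Omega v) + fnorm (L2 Omega) v.
Proof.
move=> oO bO Hv.
rewrite -(@ler_pXn2r _ 2)// ?nnegrE ?addr_ge0 ?sqrtr_ge0//.
rewrite (H1norm_sqr oO bO Hv) sqrrD.
set x := fnorm _ _; set y := normv _ _.
have : 0 <= y * x by rewrite mulr_ge0// sqrtr_ge0.
lra.
Qed.

Section node.
Variables (R : realType) (T : R) (n : nat).
Hypotheses (T0 : 0 < T) (n0 : (0 < n)%N).

Let nR : 0 < n%:R :> R. Proof. by rewrite ltr0n. Qed.

Lemma node0 : node T n 0 = 0. Proof. by rewrite /node mul0r. Qed.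

Lemma node_in i : (i <= n)%N -> node T n i \in `[0, T].
Proof.
move=> ilt; rewrite in_itv/= /node; apply/andP; split.
  by rewrite mulr_ge0// divr_ge0// ltW.
rewrite -[leRHS](divfK (lt0r_neq0 nR)) mulrC ler_wpM2l ?ler_nat//.
by rewrite divr_ge0// ltW.
Qed.

Lemma node_sub i : (0 < i)%N -> node T n i - node T n i.-1 = T / n%:R.
Proof.
case: i => // i _; rewrite /node/= -mulrBl -[X in X - _]natr1.
by rewrite addrAC subrr add0r mul1r.
Qed.

End node.

(** * First-order convergence of the solution and of the source *)

Theorem theorem4p2 (R : realType) (d : nat) (Omega : set 'rV[R]_d) (T : R)
    (rho rho' rho'' eta kappa kappa' : R -> 'rV[R]_d -> R)
    (rho_0 rho_1 rho'_1 eta_0 eta_1 kappa_0 kappa_1 kappa'_1 : R)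
    (f : R -> R) (Lf : R) (u0 omega : 'rV[R]_d -> R)
    (p : R -> 'rV[R]_d -> R) (m m' m'' : R -> R) (zeta : R)
    (u u' u'' : R -> 'rV[R]_d -> R) (h : R -> R) :
  let wbar t := ip Omega (p t) (fdiv omega (rho t)) in
  let wbar_m := inf [set `|wbar t| | t in `[0, T]] in
  let gradnorms :=
    [set normv Omega (grad Omega (fdiv omega (rho t))) | t in `[0, T]] in
  let M := sup gradnorms in
  (0 < d)%N -> lipschitz_domain Omega -> 0 < T ->
  C1 (Linf Omega) T rho rho' -> C0 (H1 Omega) T rho -> 0 < rho_0 ->
  (forall t, t \in `[0, T] -> {ae lebesgue_rV R d, forall x, Omega x ->
     rho_0 <= rho t x <= rho_1 /\ `|rho' t x| <= rho'_1}) ->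
  C0 (Linf Omega) T eta -> 0 < eta_0 ->
  (forall t, t \in `[0, T] -> {ae lebesgue_rV R d, forall x, Omega x ->
     eta_0 <= eta t x <= eta_1}) ->
  C1 (Linf Omega) T kappa kappa' -> 0 < kappa_0 ->
  (forall t, t \in `[0, T] -> {ae lebesgue_rV R d, forall x, Omega x ->
     kappa_0 <= kappa t x <= kappa_1 /\ `|kappa' t x| <= kappa'_1}) ->
  (forall a b, `|f a - f b| <= Lf * `|a - b|) ->
  H10 Omega u0 -> H10 Omega omega ->
  C0 (L2 Omega) T p -> {within `[0, T], continuous wbar} ->
  (forall t, t \in `[0, T] -> wbar t != 0) ->
  H1time (Rspace R) T m m' ->
  (forall t, t \in `[0, T] -> H1 Omega (fdiv omega (rho t))) ->
  has_ubound gradnorms ->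
  0 < zeta < 1 ->
  normC (L2 Omega) T p ^+ 2 *
    ((M ^+ 2 * eta_1 ^+ 2) / (4 * wbar_m ^+ 2 * eta_0 * rho_0)) < zeta ->
  C0 (H10 Omega) T u -> L2time (H10 Omega) T u' ->
  weak_tderive (H10 Omega) T u u' -> L2time (Rspace R) T h ->
  eq_in (H10 Omega) (u 0) u0 ->
  {ae @lebesgue_measure R, forall t, t \in `]0, T[ ->
     exists2 w, tderive (L2 Omega) T (fun s => rho s \* u s) t w &
       variational Omega (eta t) (kappa t) w (u' t) (u t)
         (h t) (p t) (f \o u t)} ->
  (forall t, t \in `[0, T] ->
     h t = source Omega f omega (wbar t) (m' t) (rho t) (rho' t)
             (eta t) (kappa t) (u' t) (u t)) ->
  C2 (Linf Omega) T rho rho' rho'' -> C2 (Rspace R) T m m' m'' ->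
  C2 (H10 Omega) T u u' u'' ->
  exists Cu tau0 : R, [/\ 0 < Cu, 0 < tau0,
    forall n (U : nat -> 'rV[R]_d -> R) (H : nat -> R),
      (0 < n)%N -> T / n%:R < 1 -> T / n%:R <= tau0 ->
      discrete_solution Omega T rho eta kappa f m' omega p wbar u0 n U H ->
      \big[Num.max/0]_(1 <= i < n.+1) H1norm Omega (u (node T n i) - U i)
        <= Cu * (T / n%:R) &
    exists2 Ch : R, 0 < Ch &
    forall n (U : nat -> 'rV[R]_d -> R) (H : nat -> R),
      (0 < n)%N -> T / n%:R < 1 -> T / n%:R <= tau0 ->
      discrete_solution Omega T rho eta kappa f m' omega p wbar u0 n U H ->
      Num.sqrt (\sum_(1 <= i < n.+1)
                  `|h (node T n i) - H i| ^+ 2 * (T / n%:R))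
        <= Ch * (T / n%:R)].
Proof.
move=> wbar wbar_m gradnorms M d0 [oO _ bO _] T0 C1rho CrhoH rho00 rho_ae Ceta
  eta00 eta_ae C1kappa kappa00 kappa_ae fL Hu0 Homega Cp Cwbar wbar0 _ H1q ubM
  /andP[zeta0 zeta1] small Cu _ _ _ u0E aeq hE C2rho C2m C2u.
have mO : measurable Omega by exact: open_measurable_rV.
have N2 := L2_seminormed mO; have Ninf := Linf_seminormed Omega.
have NH1 := H1_seminormed oO bO; have NH10 := H10_seminormed oO bO.
have [_ C1u'] := C2u; have [C1u _] := C2u; have [_ _ Cu'] := C1u.
have [_ _ Cu''] := C1u'.
have [_ [_ _ Crho'']] := C2rho; have [_ _ Crho'] := C1rho.
have [Crho _ _] := C1rho; have [Ckappa _ _] := C1kappa.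
have [[_ _ Cm'] _] := C2m.
have Lomega := H1_L2 (H10_H1 Homega).
have zT : 0 \in `[0, T] by rewrite in_itv/= lexx ltW.
have rho_ge t : t \in `[0, T] -> {ae lebesgue_rV R d, forall x, Omega x -> rho_0 <= rho t x}.
  by move=> /rho_ae; apply: filterS => x /[apply] -[/andP[]].
have eta_ge t : t \in `[0, T] -> {ae lebesgue_rV R d, forall x, Omega x -> eta_0 <= eta t x}.
  by move=> /eta_ae; apply: filterS => x /[apply] /andP[].
(* The bound is [|eta_1|], since the sign of [eta_1] is not determined when [Omega] is null; its
   square in the smallness condition is the same. *)
have eta_le t : t \in `[0, T] ->
    {ae lebesgue_rV R d, forall x, Omega x -> `|eta t x| <= `|eta_1|}.
  move=> /eta_ae; apply: filterS => x /[apply] /andP[e1 e2].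
  by rewrite ger0_norm ?(le_trans (ltW eta00))// (le_trans e2)// ler_norm.
pose q t := fdiv omega (rho t).
have Lq t : t \in `[0, T] -> L2 Omega (q t) by move=> /H1q/H1_L2.
have gq_le t : t \in `[0, T] -> normv Omega (grad Omega (q t)) <= M.
  by move=> tT; apply: (ub_le_sup ubM); exists t.
have M0 : 0 <= M by exact: le_trans (sqrtr_ge0 _) (gq_le 0 zT).
pose P := normC (L2 Omega) T p.
have p_le t : t \in `[0, T] -> fnorm (L2 Omega) (p t) <= P.
  have [K [_ pK]] := C0_norm_bounded N2 Cp.
  move=> tT; apply: ub_le_sup; last by exists t.
  by exists K => _ [s sT <-]; exact: pK.
have P0 : 0 <= P by exact: le_trans (seminormed_ge0 N2 _) (p_le 0 zT).
have cabs : {within `[0, T], continuous (fun t => `|wbar t|)}.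
  apply/subspace_continuousP => t tT; apply: cvg_norm.
  by move/subspace_continuousP : Cwbar; apply.
(* The infimum [wbar_m] is positive because a continuous function attains its minimum, and [wbar]
   never vanishes. *)
have [c cT cmin] := EVT_min (ltW T0) cabs.
have wm0 : 0 < wbar_m.
  apply: lt_le_trans (_ : `|wbar c| <= _); first by rewrite normr_gt0 wbar0.
  apply: lb_le_inf; first by exists `|wbar 0|, 0.
  by move=> _ [t tT <-]; exact: cmin.
have wm_le t : t \in `[0, T] -> wbar_m <= `|wbar t|.
  move=> tT; apply: ge_inf; last by exists t.
  by exists 0 => _ [s _ <-].
(* The smallness condition is quadratic in the coefficient of |D| |grad D|, hence the square
   root. *)
pose theta := Num.sqrt zeta.
have th01 : 0 <= theta < 1.
  by rewrite sqrtr_ge0/= -sqrtr1 ltr_sqrt.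
have small' : (wbar_m^-1 * (`|eta_1| * M) * P) ^+ 2 <= theta ^+ 2 * (4 * (eta_0 * rho_0)).
  rewrite sqr_sqrtr ?(ltW zeta0)//.
  have -> : (wbar_m^-1 * (`|eta_1| * M) * P) ^+ 2 =
      P ^+ 2 * (M ^+ 2 * `|eta_1| ^+ 2 / (4 * wbar_m ^+ 2 * eta_0 * rho_0))
        * (4 * (eta_0 * rho_0)).
    by field; rewrite !gt_eqF.
  rewrite real_normK ?num_real// ler_wpM2r ?(ltW small)//.
  by rewrite ltW// !mulr_gt0.
pose Q := rho_0^-1 * fnorm (L2 Omega) omega.
have q_le t : t \in `[0, T] -> fnorm (L2 Omega) (q t) <= Q.
  by move=> tT; exact: (quotient_norm_le oO rho00 rho_ge Lomega Lq tT).
have Q0 : 0 <= Q by exact: le_trans (sqrtr_ge0 _) (q_le 0 zT).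
have [Kk [Kk0 kappa_le]] := C0_norm_bounded Ninf Ckappa.
have [Kr [Kr0 rho'_le]] := C0_norm_bounded Ninf Crho'.
have [Kd [Kd0 rho''_le]] := C0_norm_bounded Ninf Crho''.
have [Ku [Ku0 u_le]] := C0_norm_bounded N2 (C0_H10_L2 oO bO Cu).
have [K1 [K10 u'_le]] := C0_norm_bounded NH10 Cu'.
have [K2 [K20 u''_le]] := C0_norm_bounded NH10 Cu''.
(* All bounds used here come from continuity on [0, T] and the data; [n] has not been introduced
   yet. *)
have [C C0 HC] := step_constant rho00 eta00 (normr_ge0 eta_1) P0 M0 wm0 Q0
  (ltW Kk0) (ltW Kr0) (ltW Ku0) (normr_ge0 Lf) th01 small'.
pose CC := C * (1 + K1 + Kd) + K2.
have CC0 : 0 < CC by rewrite addr_gt0// mulr_gt0// addr_gt0// addr_gt0.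
have eqt := @equation_everywhere R d Omega T oO bO rho rho' eta kappa p u u' omega
  f m' wbar h rho_0 Lf M T0 C1rho rho00 rho_ge Ceta Ckappa fL Lomega Cp Cwbar
  wbar0 (fun t tT => conj (H1q t tT) (gq_le t tT)) Cm' C1u Cu' aeq hE.
have step n (U : nat -> 'rV[R]_d -> R) (H : nat -> R) : (0 < n)%N ->
    discrete_solution Omega T rho eta kappa f m' omega p wbar u0 n U H ->
    let tau := T / n%:R in
    let e i := H1norm Omega (u (node T n i) - U i) in
    forall i, (1 <= i <= n)%N ->
      e i <= e i.-1 + CC * tau * (e i.-1 + e i + tau) /\
      `|h (node T n i) - H i| <= CC * (e i.-1 + e i + tau).
  move=> n0 [HU0 U0E sol] tau e i ni; have /andP[i1 ilt] := ni.
  have tau0 : 0 < tau by rewrite divr_gt0// ltr0n.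
  have HU j : (j <= n)%N -> H10 Omega (U j).
    case: j => [_|j jn]; first exact: HU0.
    have [Uj _ _] := sol j.+1 jn; exact: Uj.
  have ilt' : (i.-1 <= n)%N by exact: leq_trans (leq_pred _) ilt.
  have bT := node_in T0 n0 ilt; have aT := node_in T0 n0 ilt'.
  have abE : node T n i - node T n i.-1 = tau by exact: node_sub.
  have [_ E2 HE] := sol i ni.
  set b := node T n i in bT abE E2 HE *; set a := node T n i.-1 in aT abE *.
  pose v := u' b; pose w := delta tau U i; pose z := U i.-1; pose y := U i.
  pose r := rho' b; pose dr := delta tau (rho \o node T n) i.
  have Hv : H10 Omega v by exact: C0_in Cu' bT.
  have Hy : H10 Omega y by exact: HU.
  have Hz : H10 Omega z by exact: HU.
  have Hw : H10 Omega w := smZ NH10 tau^-1 (smB NH10 Hy Hz).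
  have Hb : H10 Omega (u b) by exact: C0_in Cu bT.
  have Ha : H10 Omega (u a) by exact: C0_in Cu aT.
  have Lr : Linf Omega r by exact: C0_in Crho' bT.
  have Lrb : Linf Omega (rho b) by exact: C0_in Crho bT.
  have Ldr : Linf Omega dr := smZ Ninf tau^-1 (smB Ninf Lrb (C0_in Crho aT)).
  (* The discrete product rule, with the density at the new node and the unknown at the previous
     one, as in the formula for h_i. *)
  have drE : delta tau (fun j => rho (node T n j) \* U j) i = rho b \* w + dr \* z.
    apply/funext => x.
    rewrite -[LHS]/(tau^-1 * (rho b x * y x - rho a x * z x)).
    rewrite -[RHS]/(rho b x * (tau^-1 * (y x - z x)) + tau^-1 * (rho b x - rho a x) * z x).
    by ring.
  rewrite drE in E2.
  have dr_le : fnorm (Linf Omega) dr <= Kr.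
    exact: (backward_difference_le Ninf aT bT tau0 abE C1rho rho'_le).
  have rdr_le : fnorm (Linf Omega) (r - dr) <= Kd * tau.
    exact: (backward_difference_dist Ninf aT bT tau0 abE C2rho rho''_le).
  have ei0 : 0 <= e i by exact: seminormed_ge0 NH1 _.
  have ei'0 : 0 <= e i.-1 by exact: seminormed_ge0 NH1 _.
  have ab : a <= b by rewrite -subr_ge0 abE ltW.
  (* The scheme uses the previous value in the source and in f; the lag costs one increment of
     [u]. *)
  have uz_le : H1norm Omega (u b - z) <= K1 * tau + e i.-1.
    apply: le_trans (sm_normBB NH10 Hb Ha Hz) _; rewrite lerD2r -abE.
    exact: (C1_increment NH10 C1u aT bT ab u'_le).
  (* The bound is left to unification: it must have the shape of [G] in [step_constant]. *)
  have HG : `|h b - H i| <= _ := eq_dist_le (hE b bT) HE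
    (source_dist oO bO fL (m' b) Lr Ldr (C0_in Ceta bT)
    (C0_in Ckappa bT) (H1q b bT) (H10_H1 Hv) (H10_H1 Hw) (H10_H1 Hb) (H10_H1 Hz)
    (normr_ge0 eta_1) (eta_le b bT) (kappa_le b bT) dr_le rdr_le (u_le b bT)
    uz_le (gq_le b bT) (q_le b bT) wm0 (wm_le b bT)).
  have cc := step_coercive oO bO fL Lrb (C0_in Ceta bT) (C0_in Ckappa bT) Lr Ldr
    Hv Hw Hb Hy Hz (C0_in Cp bT) (rho_ge b bT) (eta_ge b bT) (kappa_le b bT)
    dr_le rdr_le (u_le b bT) uz_le (lexx (e i)) (p_le b bT) HG (eqt b bT) E2.
  have K1t0 : 0 <= K1 * tau + e i.-1 by rewrite addr_ge0// mulr_ge0// ltW.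
  have Kdt0 : 0 <= Kd * tau by rewrite mulr_ge0// ltW.
  have [xy GB] := HC _ _ _ _ _ (sqrtr_ge0 _) (sqrtr_ge0 _) K1t0 ei0 Kdt0 cc.
  have HD : H10 Omega (v - w) := smB NH10 Hv Hw.
  have D_le := le_trans (H1norm_le_sum oO bO (H10_H1 HD)) xy.
  (* The new error is the old one, plus the truncation error of u, plus tau times [D]. *)
  have decomp : u b - y = (u a - z) + (u b - u a - tau *: v) + tau *: (v - w).
    apply/funext => x.
    rewrite -[LHS]/(u b x - y x) -[RHS]/(u a x - z x + (u b x - u a x - tau * v x)
      + tau * (v x - tau^-1 * (y x - z x))).
    by field; rewrite gt_eqF.
  have Hcons : H10 Omega (u b - u a - tau *: v).
    exact: (smB NH10 (smB NH10 Hb Ha) (smZ NH10 tau Hv)).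
  have cons_le : H1norm Omega (u b - u a - tau *: v) <= K2 * tau ^+ 2.
    rewrite -abE; exact: (C2_backward_increment NH10 C2u aT bT ab u''_le).
  have Haz : H10 Omega (u a - z) := smB NH10 Ha Hz.
  have e_le : e i <= e i.-1 + K2 * tau ^+ 2 + tau * H1norm Omega (v - w).
    rewrite -[e i]/(H1norm Omega (u b - y)) decomp.
    apply: le_trans (seminormedD NH10 (smD NH10 Haz Hcons) (smZ NH10 tau HD)) _.
    apply: lerD.
      by apply: le_trans (seminormedD NH10 Haz Hcons) _; rewrite lerD2l.
    have tE := seminormedZ NH10 tau HD; rewrite (ger0_norm (ltW tau0)) in tE.
    by rewrite tE; exact: lexx.
  exact: (step_arith C0 K10 Kd0 K20 tau0 ei0 ei'0 D_le (le_trans HG GB) e_le).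
have Cu0 : 0 < expR (4 * CC * T) :> R := expR_gt0 _.
exists (expR (4 * CC * T)), (2 * CC)^-1.
have bound n (U : nat -> 'rV[R]_d -> R) (H : nat -> R) : (0 < n)%N ->
    T / n%:R <= (2 * CC)^-1 ->
    discrete_solution Omega T rho eta kappa f m' omega p wbar u0 n U H ->
    forall i, (i <= n)%N ->
      H1norm Omega (u (node T n i) - U i) <= expR (4 * CC * T) * (T / n%:R).
  move=> n0 small_tau sol.
  have tau0 : 0 < T / n%:R by rewrite divr_gt0// ltr0n.
  apply: (discrete_gronwall CC0 tau0 _ small_tau).
  - by rewrite mulrC divfK// pnatr_eq0 -lt0n.
  (* [U 0] and [u 0] are both equal to [u0] only in norm, so the initial error vanishes by the
     triangle inequality. *)
  - rewrite node0; have [HU0 U0E _] := sol.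
    apply/eqP; rewrite eq_le; apply/andP; split; last exact: seminormed_ge0 NH1 _.
    apply: le_trans (sm_normBB NH10 (C0_in Cu zT) Hu0 HU0) _.
    by rewrite (sm_normC NH10 Hu0 HU0) u0E U0E addr0.
  - by move=> i; exact: seminormed_ge0 NH1 _.
  - by move=> i ni; have [] := step n U H n0 sol i ni.
split => //; first by rewrite invr_gt0 mulr_gt0.
  move=> n U H n0 _ small_tau sol.
  (* The maximum starts from the default 0, so the bound must also be nonnegative. *)
  rewrite big_nat; apply: bigmax_le => [|i /andP[_ ilt]].
    by rewrite mulr_ge0 ?expR_ge0// divr_ge0// ltW.
  exact: bound sol i ilt.
(* At each step the source error is at most CC (e_(i-1) + e_i + tau), and both errors are at most
   exp(4 CC T) tau; the n weights tau add up to T. *)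
exists (Num.sqrt T * (CC * (2 * expR (4 * CC * T) + 1))).
  by rewrite mulr_gt0 ?sqrtr_gt0// mulr_gt0// addr_gt0// mulr_gt0.
move=> n U H n0 _ small_tau sol.
have tau0 : 0 < T / n%:R by rewrite divr_gt0// ltr0n.
apply: (sqrt_sum_le n0 T0) => [|i ni]; first by rewrite mulr_ge0 ?(ltW CC0)// addr_ge0// mulr_ge0 ?expR_ge0.
have [_ hH] := step n U H n0 sol i ni.
apply: le_trans hH _; rewrite -[leRHS]mulrA ler_wpM2l ?(ltW CC0)//.
have /andP[i1 ilt] := ni.
have b1 := bound n U H n0 small_tau sol i ilt.
have b2 := bound n U H n0 small_tau sol i.-1 (leq_trans (leq_pred _) ilt).
apply: le_trans (lerD (lerD b2 b1) (lexx _)) _.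
move: (expR _) (T / _) => x y; clear; lra.
Qed.
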